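(* Let $\sigma \in [0, \sigma_0]$ for some fixed $0<\sigma_0 <\frac14$. Assume that, as $n\to\infty$, \[ n_1+n_2 \rightarrow \infty, \qquad q_{11} = (n_1+n_2)^{-\sigma+o(1)}, \qquad q_{22} = (n_1+n_2)^{-\sigma+o(1)}, \qquad \frac{q_{11}^2 }{q_{22}} +\frac{q_{22}^2 }{q_{11}} \ll \log (n_1+n_2). \] Then the following hold with probability tending to one as $n\to\infty$. \begin{itemize} \item[(i)] If $ \underline{p} \leq p_{12} \leq \overline{p}$ then \[ \chi(G) = (1 + o(1)) \frac{ n_1^2 q_{11} + 2 n_1 n_2 q_{12} + n_2^2 q_{22} }{ 2 (1-\sigma) (n_1+n_2) \log (n_1+n_2)} . \] \item[(ii)] If $\overline{p} \leq p_{12} \leq 1$ then \[ \chi(G) = (1 + o(1)) \left( \chi(G_1) + \chi(G_2)\right) = (1 + o(1)) \frac{ n_1 q_{11} + n_2 q_{22} }{2 (1-\sigma) \log (n_1+n_2)}. \] \item[(iii)] If $0 \leq p_{12} \leq \underline{p}$ then \[ \chi(G) = (1 + o(1)) \max \left\{ \chi(G_1) , \chi(G_2) \right\} = (1 + o(1)) \frac{\max \left\{ n_1 q_{11} , n_2 q_{22} \right\} }{2 (1-\sigma) \log (n_1+n_2)}. \] \end{itemize}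
   Context: Let $G$ be a random graph from the stochastic block model with two blocks: its vertex set is partitioned into disjoint blocks $B_1,B_2$ with $|B_1|=n_1$, $|B_2|=n_2$ (where $n_1=n_1(n), n_2=n_2(n)$ are positive integers), and each pair of distinct vertices $u\in B_i$, $v\in B_j$ is an edge independently with probability $p_{ij}$, where $p_{12}=p_{21}$ and $0\le p_{11},p_{12},p_{22}<1$ (all may depend on $n$). Let $q_{ij} := \log\left(\frac{1}{1-p_{ij}}\right)$. Let $G_1 := G[B_1]$ and $G_2 := G[B_2]$ be the induced subgraphs, so $G_1$ is distributed as the binomial random graph $G(n_1,p_{11})$ and $G_2$ as $G(n_2,p_{22})$. $\chi(\cdot)$ denotes the chromatic number and $\log$ the natural logarithm. Define \[ \overline{p} := 1 - (1-p_{11})^{\frac 12}(1-p_{22})^{\frac12}, \] \[ \underline{p} := 1 - \min\left\{ (1-p_{11})^{\frac12}\cdot (1-p_{22})^{-\frac{n_2}{2n_1}}, \ (1-p_{22})^{\frac12}\cdot (1-p_{11})^{-\frac{n_1}{2n_2}}\right\}, \] so that $0\le \underline{p}\le \overline{p}\le 1$. Asymptotic notation ($o(\cdot)$, $\ll$) refers to $n\to\infty$, uniformly over parameter sequences satisfying the assumptions. *)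

(* Defs.v *)
From HB Require Import structures.
From mathcomp Require Import all_boot all_order all_algebra.
From mathcomp Require Import all_classical all_reals all_analysis.

Set Implicit Arguments.
Unset Strict Implicit.
Unset Printing Implicit Defensive.

Import Order.TTheory GRing.Theory Num.Theory.

Local Open Scope ring_scope.

Record graph (V : finType) := Graph {
  edges : {set {set V}};
  edgesP : [forall e in edges, #|e| == 2]
}.

HB.instance Definition _ (V : finType) := [isSub for @edges V].
HB.instance Definition _ (V : finType) := [Finite of graph V by <:].

Definition adj (V : finType) (G : graph V) : rel V :=
  fun u v => [set u; v]%SET \in edges G.

Lemma adj_irrefl (V : finType) (G : graph V) : irreflexive (adj G).
Proof.
move=> u; apply/negP => uu.
by have := forallP (edgesP G) [set u; u]%SET;
  rewrite [_ \in _]uu finset.setUid cards1.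
Qed.

Definition colorable (V : finType) (G : graph V) (k : nat) : bool :=
  [exists f : {ffun V -> 'I_k},
    [forall u, forall v, adj G u v ==> (f u != f v)]].

Lemma exists_colorable (V : finType) (G : graph V) : exists k, colorable G k.
Proof.
exists #|V|; apply/existsP; exists [ffun u => enum_rank u].
apply/forallP => u; apply/forallP => v; apply/implyP => uv; rewrite !ffunE.
by apply/eqP => /enum_rank_inj uv_eq; rewrite uv_eq adj_irrefl in uv.
Qed.

Definition chi (V : finType) (G : graph V) : nat :=
  ex_minn (exists_colorable G).

Definition induced_edges (V : finType) (G : graph V) (B : {set V}) :
    {set {set {x : V | x \in B}}} :=
  [set e : {set {x : V | x \in B}} | imset val (mem e) \in edges G]%SET.

Fact induced_edgesP (V : finType) (G : graph V) (B : {set V}) :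
  [forall e in induced_edges G B, #|e| == 2].
Proof.
apply/forallP => e; apply/implyP; rewrite inE => eG.
by have := forallP (edgesP G) (imset val (mem e));
  rewrite eG card_imset //; exact: val_inj.
Qed.

Definition induced_subgraph (V : finType) (G : graph V) (B : {set V}) :
    graph {x : V | x \in B} := Graph (induced_edgesP G B).

(* The law of the random graph on V in which each pair e = {u, v} of distinct
   vertices is an edge independently with probability p e. *)
Definition graph_weight (R : realType) (V : finType) (p : {set V} -> R)
    (G : graph V) : R :=
  \prod_(e : {set V} | #|e| == 2) (if e \in edges G then p e else 1 - p e).

Definition graph_prob (R : realType) (V : finType) (p : {set V} -> R)
    (A : pred (graph V)) : R :=
  \sum_(G : graph V | A G) graph_weight p G.

Record sbm (R : realType) := SBM {
  n1 : nat;
  n2 : nat;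
  p11 : R;
  p12 : R;
  p22 : R;
  n1_gt0 : (0 < n1)%N;
  n2_gt0 : (0 < n2)%N;
  p11_range : 0 <= p11 < 1;
  p12_range : 0 <= p12 < 1;
  p22_range : 0 <= p22 < 1
}.

Section SBM.
Context {R : realType} (S : sbm R).

Definition vertex : finType := ('I_(n1 S) + 'I_(n2 S))%type.

Definition block1 : {set vertex} := [set v : vertex | is_inl v]%SET.
Definition block2 : {set vertex} := [set v : vertex | ~~ is_inl v]%SET.

Definition edge_prob (e : {set vertex}) : R :=
  if e \subset block1 then p11 S
  else if e \subset block2 then p22 S
  else p12 S.

Definition sbm_prob (A : pred (graph vertex)) : R := graph_prob edge_prob A.

Definition nn : R := (n1 S + n2 S)%:R.

Definition q11 : R := ln (1 / (1 - p11 S)).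
Definition q12 : R := ln (1 / (1 - p12 S)).
Definition q22 : R := ln (1 / (1 - p22 S)).

Definition p_upper : R :=
  1 - (1 - p11 S) `^ (1 / 2) * (1 - p22 S) `^ (1 / 2).

Definition p_lower : R :=
  1 - Num.min
    ((1 - p11 S) `^ (1 / 2) * (1 - p22 S) `^ (- ((n2 S)%:R / (2 * (n1 S)%:R))))
    ((1 - p22 S) `^ (1 / 2) * (1 - p11 S) `^ (- ((n1 S)%:R / (2 * (n2 S)%:R)))).

End SBM.

(* The families below are indexed by i : I (a parameter sequence) and n : nat;
   all asymptotics are as n tends to infinity, uniformly in i. *)

Definition unif_eventually (I : Type) (P : I -> nat -> Prop) : Prop :=
  \forall n \near \oo%classic, forall i, P i n.

Definition unif_o1 (R : realType) (I : Type) (e : I -> nat -> R) : Prop :=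
  forall eps : R, 0 < eps -> unif_eventually (fun i n => `|e i n| <= eps).

Definition unif_infty (R : realType) (I : Type) (f : I -> nat -> R) : Prop :=
  forall M : R, unif_eventually (fun i n => M <= f i n).

Definition unif_ll (R : realType) (I : Type) (f g : I -> nat -> R) : Prop :=
  forall eps : R, 0 < eps ->
    unif_eventually (fun i n => `|f i n| <= eps * `|g i n|).

Definition unif_power (R : realType) (I : Type) (f N s : I -> nat -> R) :
    Prop :=
  exists2 e : I -> nat -> R, unif_o1 e &
    unif_eventually (fun i n => f i n = N i n `^ (- s i n + e i n)).

Definition near_ratio1 (R : realType) (eps x y : R) : bool :=
  `|x - y| <= eps * `|y|.

(* E eps i n is the event that the relative errors written o(1) are all at most
   eps in absolute value; its probability tends to one, uniformly over the
   indices (i, n) at which the parameters S i n satisfy C. *)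
Definition whp_if (R : realType) (I : Type) (S : I -> nat -> sbm R)
    (C : sbm R -> Prop)
    (E : R -> forall i n, pred (graph (vertex (S i n)))) : Prop :=
  forall eps delta : R, 0 < eps -> 0 < delta ->
    unif_eventually (fun i n => C (S i n) ->
      1 - delta <= sbm_prob (E eps i n)).
Arguments whp_if {R I} S C E.

(* Main.v *)
(** Write [a], [b], [c] for the rates [q11], [q22], [q12], let [N] be the number
    of vertices and [Q (x, y) = a x^2 + 2 c x y + b y^2].  A set with [x] and [y]
    vertices in the two blocks is independent with probability about
    [exp (- Q (x, y) / 2)], and a first moment computation shows that with high
    probability every independent set satisfies [Q (x, y) <= T (x + y)] with
    [T] close to [2 (1 - sigma) ln N].

    Lower bound: if [2 c <= a + b] then [Q (x, y) / (x + y)] is convex and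
    homogeneous of degree one, hence subadditive, so that summing over the
    colour classes gives [Q (n1, n2) / N <= T chi].  If [2 c > a + b], replace
    [c] by [(a + b) / 2].

    Upper bound: an independent set with [x : y = n1 : n2] and
    [Q (x, y)] slightly below [T (x + y)] is found in every large set of vertices.
    The failure probability is at most [exp (- 2 N)] by Janson's inequality applied
    to the transversals of a partition into small parts, and this beats the [2 ^ N]
    choices of the set.  The condition [p_lower <= p12] is what makes all
    sub-configurations of such a set satisfy the same inequality, and
    [sigma < 1 / 4] is what makes overlaps in a single pair harmless.  The few
    vertices that remain when no further set can be extracted span a graph of small
    degeneracy.  For larger [p12] the blocks are coloured separately; for
    smaller [p12] the bound at [p_lower] still applies. *)

Require Import Defs.
From HB Require Import structures.
From mathcomp Require Import all_boot all_order all_algebra.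
From mathcomp Require Import all_classical all_reals all_analysis.
From mathcomp Require Import fintype finset.
From mathcomp Require Import ring lra.

Set Implicit Arguments.
Unset Strict Implicit.
Unset Printing Implicit Defensive.

Import Order.TTheory GRing.Theory Num.Theory.

Local Open Scope ring_scope.

(** * Janson's inequality *)

(** The union over all [2 ^ N] vertex sets dictates the target: Janson's correlation sum divided by
    the squared mean must be at most [1 / (8 N)]. Parts have size about [N ^ (1 - sigma)] and an
    independent set has about [N ^ sigma] vertices, so agreement in two parts contributes about [(N
    ^ sigma / N ^ (1 - sigma)) ^ 2 = N ^ (4 sigma - 2)], which is below [1 / N] with a power to
    spare when [sigma < 1 / 4]. The hypothesis on [q11 ^ 2 / q22 + q22 ^ 2 / q11] enters as
    [max (q11, q22) = o(ln N)]: relevant independent sets then have unboundedly many vertices, so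
    rounding their sizes and dropping the diagonal terms [a x + b y] costs a factor [1 + o(1)]. A
    proportional set degenerates if one block carries almost none of the load. In that case
    [n1 a + n2 b] is within a factor [1 + eps] of the target, and colouring the blocks separately is
    good enough. For uniformity, all hypotheses at one index are compressed into a single [eta];
    every estimate then concerns one model with [eta] small, and limits appear only at the very
    end. *)

Section RandomSubset.
Context {R : realType} {O : finType}.
Implicit Types (p : O -> R) (E D : {set O}) (f g : {set O} -> R).

Definition rset_weight p E : R := \prod_o (if o \in E then p o else 1 - p o).

Definition rset_expect p f : R := \sum_(E : {set O}) rset_weight p E * f E.

Definition avoid_prob p D : R := \prod_(o in D) (1 - p o).

Definition is_prob p := forall o, 0 <= p o <= 1.

Lemma rset_weight_ge0 p E : is_prob p -> 0 <= rset_weight p E.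
Proof.
by move=> pP; apply: prodr_ge0 => o _; case: ifP => _; have := pP o; lra.
Qed.

Lemma avoid_prob_ge0 p D : is_prob p -> 0 <= avoid_prob p D.
Proof. by move=> pP; apply: prodr_ge0 => o _; have := pP o; lra. Qed.

Lemma rset_expect_prod p (x y : O -> R) :
  rset_expect p (fun E => \prod_o (if o \in E then x o else y o)) =
  \prod_o (p o * x o + (1 - p o) * y o).
Proof.
rewrite bigA_distr; apply: eq_big => [E|E _]; first by rewrite inE.
by rewrite -big_split; apply: eq_bigr => o _; case: ifP.
Qed.

Lemma rset_expect_cst p (x : R) : rset_expect p (fun=> x) = x.
Proof.
rewrite /rset_expect -mulr_suml.
have := rset_expect_prod p (fun=> 1) (fun=> 1); rewrite /rset_expect.
rewrite (eq_bigr (rset_weight p)); last first.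
  by move=> E _; rewrite big1 ?mulr1// => o _; rewrite if_same.
by move=> ->; rewrite big1 ?mul1r// => o _; ring.
Qed.

Lemma rset_expectD p f g :
  rset_expect p (fun E => f E + g E) = rset_expect p f + rset_expect p g.
Proof. by rewrite -big_split; apply: eq_bigr => E _; rewrite mulrDr. Qed.

Lemma rset_expectZ p (x : R) f :
  rset_expect p (fun E => x * f E) = x * rset_expect p f.
Proof. by rewrite /rset_expect mulr_sumr; apply: eq_bigr => E _; rewrite mulrCA. Qed.

Lemma rset_expectB p f g :
  rset_expect p (fun E => f E - g E) = rset_expect p f - rset_expect p g.
Proof. by rewrite -sumrB; apply: eq_bigr => E _; rewrite mulrBr. Qed.

Lemma rset_expect_sum p (I : Type) (r : seq I) (P : pred I)
    (F : I -> {set O} -> R) :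
  rset_expect p (fun E => \sum_(i <- r | P i) F i E) =
  \sum_(i <- r | P i) rset_expect p (F i).
Proof.
rewrite /rset_expect exchange_big; apply: eq_bigr => E _.
by rewrite mulr_sumr.
Qed.

Lemma eq_rset_expect p f g : f =1 g -> rset_expect p f = rset_expect p g.
Proof. by move=> fg; apply: eq_bigr => E _; rewrite fg. Qed.

Lemma le_rset_expect p f g : is_prob p -> (forall E, f E <= g E) ->
  rset_expect p f <= rset_expect p g.
Proof.
by move=> pP fg; apply: ler_sum => E _; rewrite ler_wpM2l// rset_weight_ge0.
Qed.

Lemma rset_expect_avoid1 p (o : O) f :
  rset_expect p (fun E => (o \notin E)%:R * f E) =
  (1 - p o) * rset_expect p (fun E => f (E :\ o)).
Proof.
pose w E := \prod_(o' | o' != o) (if o' \in E then p o' else 1 - p o').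
have wE E : rset_weight p E = (if o \in E then p o else 1 - p o) * w E.
  by rewrite /rset_weight (bigD1 o).
have wU E : w (o |: E) = w E.
  apply: eq_bigr => o' oo'; by rewrite in_setU1 (negbTE oo').
rewrite {1}/rset_expect (bigID (fun E => o \in E)) /= big1 ?add0r; last first.
  by move=> E ->; rewrite mul0r mulr0.
have -> : rset_expect p (fun E => f (E :\ o)) =
    \sum_(E : {set O} | o \notin E) w E * f E.
  rewrite /rset_expect (bigID (fun E => o \in E)) /=.
  rewrite (reindex_onto (fun E => o |: E) (fun E => E :\ o)) /=; last first.
    by move=> E oE; rewrite setD1K.
  under [X in X + _]eq_bigl => E.
    rewrite in_setU1 eqxx /= (_ : ((o |: E) :\ o == E) = (o \notin E)); last first.
      apply/eqP/idP => [<-|oE]; first by rewrite !inE eqxx.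
      by rewrite setU1K.
    over.
  rewrite -big_split; apply: eq_bigr => E oE.
  rewrite setU1K// [rset_weight _ E]wE [rset_weight _ (_ |: _)]wE wU in_setU1 eqxx /= (negbTE oE).
  rewrite (_ : E :\ o = E); first by ring.
  by apply/setP => x; rewrite !inE; case: eqP => // ->; rewrite (negbTE oE).
rewrite mulr_sumr; apply: eq_bigr => E oE.
by rewrite wE (negbTE oE) mul1r mulrA.
Qed.

(** Conditioning on [D] being missed amounts to deleting [D] from the sample. Correlation
    inequalities thereby reduce to monotonicity under deletion. *)
Lemma rset_expect_avoid p D f :
  rset_expect p (fun E => [disjoint D & E]%:R * f E) =
  avoid_prob p D * rset_expect p (fun E => f (E :\: D)).
Proof.
have [n] := ubnP #|D|; elim: n D f => // n IHn D0 f.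
have [-> _|[x xD0]] := set_0Vmem D0.
  rewrite /avoid_prob big_set0 mul1r; apply: eq_rset_expect => E.
  by rewrite setD0 -setI_eq0 set0I eqxx mul1r.
rewrite (cardsD1 x) xD0 add1n ltnS.
set D := D0 :\ x => /IHn IH; rewrite -(setD1K xD0) -/D.
have xD : x \notin D by rewrite !inE eqxx.
rewrite /avoid_prob big_setU1//= -/(avoid_prob p D) -mulrA.
have -> : avoid_prob p D * rset_expect p (fun E => f (E :\: (x |: D))) =
    rset_expect p (fun E => [disjoint D & E :\ x]%:R * f (E :\ x)).
  transitivity (rset_expect p (fun E => [disjoint D & E]%:R * f (E :\ x))).
    by rewrite IH; congr (_ * _); apply: eq_rset_expect => E; rewrite setDDl setUC.
  apply: eq_rset_expect => E; congr (_%:R * _).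
  rewrite -!setI_eq0 setIDA; congr (nat_of_bool (_ == _)).
  by apply/setP => y; rewrite !inE; case: eqP.
rewrite -(rset_expect_avoid1 p x (fun E => [disjoint D & E]%:R * f E)).
apply: eq_rset_expect => E; rewrite mulrA -natrM mulnb; congr (_%:R * _).
by rewrite -!setI_eq0 setIUl setU_eq0 !setI_eq0 disjoints1.
Qed.

Lemma rset_expect_avoid_cst p D :
  rset_expect p (fun E => [disjoint D & E]%:R) = avoid_prob p D.
Proof.
have := rset_expect_avoid p D (fun=> 1); rewrite rset_expect_cst mulr1 => <-.
by apply: eq_rset_expect => E; rewrite mulr1.
Qed.

Lemma avoid_probU p D D' :
  avoid_prob p (D :|: D') * avoid_prob p (D :&: D') =
  avoid_prob p D * avoid_prob p D'.
Proof.
rewrite /avoid_prob [in LHS](big_setID D) /= setUK.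
rewrite [X in _ = _ * X](big_setID D) /= -mulrA; congr (_ * _).
rewrite setDUl setDv set0U mulrC setIC [D' :&: D]setIC; congr (_ * _).
Qed.

(* The factors [1 - s] play the role of an independent thinning of the
   family [D] with retention probability [s]. *)
Definition thinned (I : Type) (D : I -> {set O}) (s : R) (l : seq I) E : R :=
  \prod_(i <- l) (1 - s * [disjoint D i & E]%:R).

Lemma thinned_range (I : Type) (D : I -> {set O}) (s : R) (l : seq I) E :
  0 <= s <= 1 -> 0 <= thinned D s l E <= 1.
Proof.
move=> s01; apply/andP; split.
  by apply: prodr_ge0 => i _; case: [disjoint _ & _]; rewrite ?mulr1 ?mulr0; lra.
apply: prodr_ile1 => i _; apply/andP; split;
  by case: [disjoint _ & _]; rewrite ?mulr1 ?mulr0; lra.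
Qed.

Lemma thinned_setD (I : Type) (D : I -> {set O}) (s : R) (l : seq I) (E F : {set O}) :
  0 <= s <= 1 -> thinned D s l (E :\: F) <= thinned D s l E.
Proof.
move=> s01; apply: ler_prod => i _; apply/andP; split.
  by case: [disjoint _ & _]; rewrite ?mulr1 ?mulr0; lra.
have : ([disjoint D i & E] <= [disjoint D i & E :\: F])%N.
  case H: [disjoint D i & E] => //; rewrite lt0b.
  by rewrite (disjointWr _ H)// subsetDl.
by rewrite -(ler_nat R) => H; rewrite lerD2l lerN2 ler_wpM2l//; lra.
Qed.

Lemma thinned_setD_disjoint (I : Type) (D : I -> {set O}) (s : R) (l : seq I) (E F : {set O}) :
  all (fun i => [disjoint D i & F]) l -> thinned D s l (E :\: F) = thinned D s l E.
Proof.
rewrite /thinned; elim: l => [|i l IHl]; first by rewrite !big_nil.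
move=> /andP[iF lF]; rewrite !big_cons IHl//; congr ((1 - s * _%:R) * _).
rewrite -!setI_eq0 setIDA; congr (nat_of_bool (_ == _)).
by apply/setDidPl/(disjointWl _ iF)/subsetIl.
Qed.

(** A union bound in product form: the factors that fail [P] multiply to at least one minus the sum
    of their deficits. *)
Lemma thinned_filter (I : Type) (D : I -> {set O}) (s : R) (l : seq I)
    (P : pred I) E : 0 <= s <= 1 ->
  thinned D s [seq i <- l | P i] E
    * (1 - s * \sum_(i <- [seq i <- l | ~~ P i]) [disjoint D i & E]%:R)
  <= thinned D s l E.
Proof.
move=> s01; elim: l => [|i l IHl].
  by rewrite /thinned !big_nil mulr0 subr0 mulr1.
rewrite /thinned big_cons -/(thinned D s l E) /=.
have := thinned_range D [seq i <- l | P i] E s01.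
have := thinned_range D l E s01.
case: (P i) => /=; rewrite big_cons -/(thinned _ _ _ _).
  move=> _ _; rewrite -mulrA ler_wpM2l//.
  by case: [disjoint _ & _]; rewrite ?mulr1 ?mulr0; lra.
move=> l01 f01; rewrite [s * (_ + _)]mulrDr.
have : 0 <= ([disjoint D i & E]%:R : R) <= 1.
  by case: [disjoint _ & _]; rewrite ?ler01 ?lexx.
move: ([disjoint D i & E]%:R : R) IHl => x IHl x01.
have : s * x <= 1 by nra.
have : 0 <= s * x by nra.
have : 0 <= s * \sum_(j <- [seq i <- l | ~~ P i]) [disjoint D j & E]%:R.
  by rewrite mulr_ge0 ?sumr_ge0//; lra.
move: (s * x) (s * _) IHl => y z.
move: (thinned D s _ E) (thinned D s _ E) f01 l01 => v u u01 v01 H z0 y0 y1.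
have : 0 <= u * (y * z) by rewrite !mulr_ge0//; lra.
have : 0 <= (1 - y) * (v - u * (1 - z)) by rewrite mulr_ge0//; lra.
by nra.
Qed.

Lemma thinned_filter_ge (I : Type) (D : I -> {set O}) (s : R) (l : seq I)
    (P : pred I) E : 0 <= s <= 1 ->
  thinned D s l E <= thinned D s [seq i <- l | P i] E.
Proof.
move=> s01; elim: l => [|i l IHl] //.
rewrite /thinned big_cons -/(thinned D s l E) /=.
have := thinned_range D l E s01.
have x01 : 0 <= 1 - s * [disjoint D i & E]%:R <= 1.
  by case: [disjoint _ & _]; rewrite ?mulr1 ?mulr0; lra.
case: (P i) => /=; rewrite ?big_cons -/(thinned _ _ _ _) => l01.
  by rewrite ler_wpM2l//; lra.
by apply: le_trans IHl; rewrite ler_piMl; lra.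
Qed.

(** The new factor removes [s] times the expectation restricted to [D i] being missed. Sets disjoint
    from [D i] are unaffected by that event; the others are split off by [thinned_filter]. Missing
    [D i :|: D j] can only lower the product over the disjoint sets, so deletion takes the place of
    Harris' inequality. *)
Lemma janson_step p (I : Type) (D : I -> {set O}) (s : R) i (l : seq I) :
  is_prob p -> 0 <= s <= 1 ->
  rset_expect p (thinned D s (i :: l)) <= rset_expect p (thinned D s l) *
    expR (- (s * (avoid_prob p (D i) - s * \sum_(j <- l | ~~ [disjoint D j & D i])
                                            avoid_prob p (D i :|: D j)))).
Proof.
move=> pP s01; pose P j := [disjoint D j & D i].
set l0 := [seq i <- l | P i]; set y := _ - _.
have -> : rset_expect p (thinned D s (i :: l)) = rset_expect p (thinned D s l) -
    s * rset_expect p (fun E => [disjoint D i & E]%:R * thinned D s l E).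
  rewrite -rset_expectZ -rset_expectB; apply: eq_rset_expect => E.
  by rewrite /thinned big_cons; ring.
have X01 : 0 <= rset_expect p (thinned D s l).
  rewrite -(rset_expect_cst p 0); apply: le_rset_expect => // E.
  by case/andP: (thinned_range D l E s01).
have X0 : rset_expect p (thinned D s l) <= rset_expect p (thinned D s l0).
  by apply: le_rset_expect => // E; apply: thinned_filter_ge.
have Z0 : 0 <= rset_expect p (fun E => [disjoint D i & E]%:R * thinned D s l E).
  rewrite -(rset_expect_cst p 0); apply: le_rset_expect => // E.
  by rewrite mulr_ge0//; case/andP: (thinned_range D l E s01).
have Z1 : rset_expect p (thinned D s l0) * y <=
    rset_expect p (fun E => [disjoint D i & E]%:R * thinned D s l E).
  apply: (@le_trans _ _ (rset_expect p (fun E => [disjoint D i & E]%:R *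
    (thinned D s l0 E * (1 - s *
      \sum_(j <- [seq i <- l | ~~ P i]) [disjoint D j & E]%:R))))); last first.
    by apply: le_rset_expect => // E; rewrite ler_wpM2l// thinned_filter.
  rewrite [leRHS](_ : _ = rset_expect p (fun E => [disjoint D i & E]%:R * thinned D s l0 E)
     - s * \sum_(j <- [seq i <- l | ~~ P i])
       rset_expect p (fun E => [disjoint D i :|: D j & E]%:R * thinned D s l0 E)); last first.
    rewrite -rset_expect_sum -rset_expectZ -rset_expectB.
    apply: eq_rset_expect => E; rewrite mulrA mulrBr mulr1; congr (_ - _).
    rewrite mulrCA; congr (_ * _); rewrite mulr_sumr; apply: eq_bigr => j _.
    rewrite -!setI_eq0 setIUl setU_eq0 !setI_eq0 -mulnb natrM; ring.
  rewrite [X in _ <= X - _](_ : _ =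
      avoid_prob p (D i) * rset_expect p (thinned D s l0)); last first.
    rewrite rset_expect_avoid; congr (_ * _); apply: eq_rset_expect => E.
    apply: thinned_setD_disjoint.
    exact: filter_all.
  rewrite mulrC /y mulrBl lerB// -mulrA ler_wpM2l; [by []|by lra|].
  rewrite big_filter mulr_suml; apply: ler_sum => j _.
  rewrite rset_expect_avoid ler_wpM2l ?avoid_prob_ge0//.
  by apply: le_rset_expect => // E; apply: thinned_setD.
have : 1 - s * y <= expR (- (s * y)) by rewrite -[_ - _]/(1 + _) expR_ge1Dx.
move/(ler_wpM2l X01); apply: le_trans.
rewrite mulrBr mulr1 lerD2l lerN2 mulrCA ler_wpM2l//; first by lra.
(* Passing from the full product to the larger one over [l0] needs [0 <= y]; for negative [y] it
   suffices that the subtracted expectation is nonnegative. *)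
have [y0|y0] := leP 0 y; first exact: le_trans (ler_wpM2r y0 X0) Z1.
by apply: le_trans Z0; rewrite mulr_ge0_le0// ltW.
Qed.

(** Adding the indices one at a time meets each intersecting pair once; summing over ordered pairs
    with the diagonal only weakens the bound. *)
Lemma janson_thinned p (I : Type) (D : I -> {set O}) (s : R) (l : seq I) :
  is_prob p -> 0 <= s <= 1 ->
  rset_expect p (thinned D s l) <=
  expR (- (s * \sum_(i <- l) avoid_prob p (D i)) + s ^+ 2 *
     \sum_(i <- l) \sum_(j <- l | ~~ [disjoint D j & D i])
        avoid_prob p (D i :|: D j)).
Proof.
move=> pP s01; elim: l => [|i l IHl].
  rewrite !big_nil !mulr0 oppr0 addr0 expR0 -[leRHS](rset_expect_cst p 1).
  by apply: le_rset_expect => // E; rewrite /thinned big_nil.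
apply: (le_trans (janson_step D i l pP s01)).
apply: (le_trans (ler_wpM2r (expR_ge0 _) IHl)).
rewrite -expRD ler_expR !big_cons.
set S := \sum_(_ <- l) \sum_(_ <- l | _) _.
set U := \sum_(j <- l | ~~ [disjoint D j & D i]) _.
set V := \sum_(_ <- l) \sum_(_ <- _ | _) _.
have SV : S <= V.
  apply: ler_sum => j _; rewrite big_cons; case: ifP => // _.
  by rewrite lerDr avoid_prob_ge0.
set W := if _ then _ else _.
have UW : U <= W by rewrite /W; case: ifP => // _; rewrite lerDr avoid_prob_ge0.
have : 0 <= s ^+ 2 * ((W - U) + (V - S)) by rewrite mulr_ge0 ?sqr_ge0//; lra.
by move: (\sum_(_ <- l) _) => x; nra.
Qed.

(* Janson's inequality in its extended form: the optimal retention probability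
   is [1 / (2 r m)]. *)
Lemma janson p (I : finType) (D : I -> {set O}) (r : R) :
  let m := \sum_i avoid_prob p (D i) in
  is_prob p -> 0 < m -> 1 <= 2 * r * m ->
  \sum_i \sum_(j | ~~ [disjoint D j & D i]) avoid_prob p (D i :|: D j) <=
    r * m ^+ 2 ->
  rset_expect p (fun E => [forall i, ~~ [disjoint D i & E]]%:R) <=
  expR (- (4 * r)^-1).
Proof.
move=> m pP m0 rm Dr; set s := (2 * r * m)^-1.
have rm0 : 0 < 2 * r * m by lra.
have r0 : 0 < r by rewrite -(pmulr_rgt0 _ (ltr0n _ 2)) -(pmulr_lgt0 _ m0).
have s01 : 0 <= s <= 1 by rewrite invr_ge0 ltW//= invf_le1.
apply: (@le_trans _ _ (rset_expect p (thinned D s (index_enum I)))).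
  apply: le_rset_expect => // E.
  case: forallP => [H|_]; last by case/andP: (thinned_range D (index_enum I) E s01).
  by rewrite /thinned big1 // => i _; rewrite (negbTE (H i)) mulr0 subr0.
apply: (le_trans (janson_thinned D (index_enum I) pP s01)).
rewrite ler_expR -/m.
have -> : - (4 * r)^-1 = - (s * m) + s ^+ 2 * (r * m ^+ 2).
  by rewrite /s; field; rewrite !gt_eqF.
by rewrite lerD2l ler_wpM2l// sqr_ge0.
Qed.

End RandomSubset.
(** * Colourings *)

Section Graphs.
Context {V : finType}.
Implicit Types (G : graph V) (U W A B : {set V}).

Lemma adj_sym G : symmetric (adj G).
Proof. by move=> u v; rewrite /adj setUC. Qed.

Definition independent G A : bool :=
  [forall u in A, forall v in A, ~~ adj G u v].

Lemma independentP G A :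
  reflect {in A &, forall u v, ~~ adj G u v} (independent G A).
Proof.
apply: (iffP forall_inP) => [H u v uA vA|H u uA]; first exact: (forall_inP (H u uA)).
by apply/forall_inP => v vA; exact: H.
Qed.

(** The colour function is total on [V] and constrained only on [U], so that colourings of subsets
    and of induced subgraphs combine without subtypes. *)
Definition proper_on G U (k : nat) : Prop :=
  exists2 f : V -> nat, {in U, forall u, (f u < k)%N} &
    {in U &, forall u v, adj G u v -> f u != f v}.

Lemma proper_onS G U W (j k : nat) : U \subset W -> (j <= k)%N ->
  proper_on G W j -> proper_on G U k.
Proof.
move=> /subsetP UW jk [f fj fP]; exists f => [u /UW /fj|u v /UW uW /UW vW].
  by move=> /leq_trans; apply.
exact: fP.
Qed.

Lemma proper_onU G U W (j k : nat) : proper_on G U j -> proper_on G W k ->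
  proper_on G (U :|: W) (j + k).
Proof.
move=> [f fj fP] [g gk gP].
exists (fun u => if u \in U then f u else j + g u)%N => [u|u v].
  rewrite inE; case: ifP => [uU _|_ /= uW]; last by rewrite ltn_add2l gk.
  by rewrite ltn_addr// fj.
rewrite !inE; case: ifP => uU; case: ifP => vU //= uW vW uv.
- exact: fP.
- by rewrite ltn_eqF// ltn_addr// fj.
- by rewrite gtn_eqF// ltn_addr// fj.
- by rewrite eqn_add2l gP.
Qed.

Lemma independent_proper_on G A : independent G A -> proper_on G A 1.
Proof.
move=> /independentP H; exists (fun=> 0%N) => // u v uA vA.
by rewrite (negbTE (H u v uA vA)).
Qed.

Lemma colorableP G (k : nat) : reflect (proper_on G setT k) (colorable G k).
Proof.
apply: (iffP existsP) => [[f /forallP H]|[f fk fP]].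
  exists (fun u => f u : nat) => // u v _ _ uv.
  by have /forallP/(_ v)/implyP/(_ uv) := H u.
exists [ffun u => Ordinal (fk u (in_setT u))].
apply/forallP => u; apply/forallP => v; apply/implyP => uv.
by rewrite !ffunE -val_eqE /=; apply: fP; rewrite ?inE.
Qed.

Lemma chi_proper_on G : proper_on G setT (chi G).
Proof. by apply/colorableP; rewrite /chi; case: ex_minnP. Qed.

Lemma chi_le G (k : nat) : proper_on G setT k -> (chi G <= k)%N.
Proof. by move=> /colorableP H; rewrite /chi; case: ex_minnP => m _; apply. Qed.

Lemma adj_induced G B (x y : {x : V | x \in B}) :
  adj (induced_subgraph G B) x y = adj G (val x) (val y).
Proof. by rewrite /adj inE /= imsetU1 imset_set1. Qed.

Lemma chi_induced_le G B (k : nat) :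
  proper_on G B k -> (chi (induced_subgraph G B) <= k)%N.
Proof.
move=> [f fk fP]; rewrite /chi; case: ex_minnP => m _; apply; apply/existsP.
exists [ffun x => Ordinal (fk (val x) (valP x))].
apply/forallP => u; apply/forallP => v; apply/implyP; rewrite adj_induced => uv.
by rewrite !ffunE -val_eqE /=; apply: fP => //; exact: valP.
Qed.

Lemma chi_induced_proper_on G B :
  proper_on G B (chi (induced_subgraph G B)).
Proof.
rewrite /chi; case: ex_minnP => k /existsP[f /forallP H] _.
exists (fun v => if insub v is Some x then f x : nat else 0%N) => [u uB|u v uB vB].
  by rewrite insubT.
move=> uv; rewrite !insubT /=.
have /forallP/(_ (Sub v vB))/implyP := H (Sub u uB).
by rewrite adj_induced /= => /(_ uv).
Qed.

Lemma chi_induced_le_chi G B : (chi (induced_subgraph G B) <= chi G)%N.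
Proof.
by apply/chi_induced_le/(proper_onS (subsetT B) (leqnn _))/chi_proper_on.
Qed.

Lemma proper_on_greedy G B (k u d : nat) : (0 < k)%N -> (k <= u)%N ->
  (forall U, U \subset B -> (u <= #|U|)%N ->
    exists A, [/\ A \subset U, independent G A & #|A| = k]) ->
  (forall W, W \subset B -> (#|W| < u)%N -> proper_on G W d) ->
  forall U, U \subset B -> proper_on G U (#|U| %/ k + d).
Proof.
move=> k0 ku HA HW U; have [n] := ubnP #|U|; elim: n U => // n IHn U Un UB.
have [Uu|uU] := ltnP #|U| u.
  by apply: proper_onS (HW U UB Uu) => //; rewrite leq_addl.
have [A [AU Ai Ak]] := HA U UB uU.
have UA : (#|U :\: A| + k = #|U|)%N.
  by rewrite -Ak addnC -[RHS](cardsID A U) (setIidPr AU).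
have UAn : (#|U :\: A| < n)%N by rewrite -ltnS (leq_trans _ Un)// ltnS -UA -addn1 leq_add2l.
have := IHn _ UAn (subset_trans (subsetDl _ _) UB).
move=> /(proper_onU (independent_proper_on Ai)).
rewrite -UA divnDr// divnn k0.
apply: proper_onS; last by rewrite addnA [(1 + _)%N]addnC.
by apply/subsetP => x xU; rewrite !inE xU andbT orbN.
Qed.

(** The summand [s] in [m + s] keeps the supply above the selection threshold at every extraction.
    The case [m = 0] stands apart because a truncated difference equal to zero says nothing about
    the sizes. The remainder [W] is handed back uncoloured, to be split between the blocks. *)
Lemma proper_on_greedy2 G B1 B2 (k1 k2 s : nat) :
  (forall U, (k1 * s <= #|U :&: B1|)%N -> (k2 * s <= #|U :&: B2|)%N ->
    exists A, [/\ A \subset U, independent G A, #|A :&: B1| = k1 & #|A :&: B2| = k2]) ->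
  forall m U, (m = 0 \/ k1 * (m + s) <= #|U :&: B1| /\ k2 * (m + s) <= #|U :&: B2|)%N ->
  exists W, [/\ W \subset U, #|W :&: B1| = (#|U :&: B1| - m * k1)%N,
    #|W :&: B2| = (#|U :&: B2| - m * k2)%N &
    forall r, proper_on G W r -> proper_on G U (m + r)].
Proof.
move=> HA; elim=> [|m IHm] U.
  by exists U; rewrite !mul0n !subn0; split.
case=> // -[U1 U2].
have [||A [AU Ai A1 A2]] := HA U.
- by apply: leq_trans U1; rewrite leq_mul2l leq_addl orbT.
- by apply: leq_trans U2; rewrite leq_mul2l leq_addl orbT.
have UD B : #|(U :\: A) :&: B| = (#|U :&: B| - #|A :&: B|)%N.
  by rewrite setIDAC cardsD setIAC (setIidPr AU).
have [|W [WU W1 W2 WP]] := IHm (U :\: A).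
  right; rewrite !UD A1 A2 !leq_subRL.
  - by rewrite -!mulnS -!addSn U1 U2.
  - by apply: leq_trans U2; rewrite leq_pmulr.
  - by apply: leq_trans U1; rewrite leq_pmulr.
exists W; split.
- by rewrite (subset_trans WU)// subsetDl.
- by rewrite W1 UD A1 mulSn subnDA.
- by rewrite W2 UD A2 mulSn subnDA.
move=> r /WP /(proper_onU (independent_proper_on Ai)).
apply: proper_onS; last by rewrite addnA.
by apply/subsetP => x xU; rewrite !inE xU andbT orbN.
Qed.

Lemma degenerate_proper_on G U (d : nat) :
  (forall W, W \subset U -> W != set0 ->
    exists2 v, v \in W & (#|[set u in W | adj G v u]| < d)%N) ->
  proper_on G U d.
Proof.
have [n] := ubnP #|U|; elim: n U => // n IHn U Un HU.
have [->|U0] := eqVneq U set0; first by exists (fun=> 0%N) => u; rewrite inE.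
have [v vU vd] := HU U (subxx _) U0.
have [|W WU W0|f fd fP] := IHn (U :\ v).
- by move: Un; rewrite (cardsD1 v) vU.
- by apply: HU => //; rewrite (subset_trans WU)// subsetDl.
pose N := [set u in U | adj G v u].
have /hasP[c] : has (fun c => c \notin [seq f u | u <- enum N]) (iota 0 d).
  rewrite -[has _ _]negbK -all_predC; apply/negP => /allP H.
  have : (d <= #|N|)%N.
    rewrite cardE -(size_iota 0 d) -(size_map f); apply: uniq_leq_size.
      exact: iota_uniq.
    by move=> c /H /=; rewrite negbK.
  by rewrite leqNgt vd.
rewrite mem_iota /= add0n => cd cN.
have cf u : u \in U -> adj G v u -> f u != c.
  move=> uU vu; apply: contra cN => /eqP <-; apply: map_f.
  by rewrite mem_enum inE uU.
exists (fun u => if u == v then c else f u) => [u uU|u w uU wU].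
  by case: eqP => // /eqP uv; apply: fd; rewrite !inE uv.
case: (eqVneq u v) => [->|uv]; case: (eqVneq w v) => [->|wv].
- by rewrite adj_irrefl.
- by move=> vw; rewrite eq_sym cf.
- by rewrite adj_sym => vu; rewrite cf.
- by apply: fP; rewrite !inE ?uv ?wv.
Qed.

Lemma sum_set2 (R : nmodType) W (g : {set V} -> R) :
  \sum_(u in W) \sum_(v in W | u != v) g [set u; v] =
  (\sum_(e : {set V} | (e \subset W) && (#|e| == 2)) g e) *+ 2.
Proof.
rewrite pair_big_dep /= -sumrMnl.
rewrite (partition_big (fun x : V * V => [set x.1; x.2])
  (fun e : {set V} => (e \subset W) && (#|e| == 2))) /=; last first.
  move=> [u v] /= /andP[uW /andP[vW uv]]; rewrite cards2 uv eqxx andbT.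
  by apply/subsetP => x; rewrite !inE => /orP[] /eqP ->.
apply: eq_bigr => e /andP[eW /cards2P[x [y [xy exy]]]].
have xW : x \in W by apply: (subsetP eW); rewrite exy !inE eqxx.
have yW : y \in W by apply: (subsetP eW); rewrite exy !inE eqxx orbT.
rewrite (eq_bigl (mem [set (x, y); (y, x)])).
  rewrite /= big_setU1 ?big_set1 ?inE /=.
    by rewrite [[set y; x]]setUC -exy mulr2n.
  by rewrite xpair_eqE negb_and xy.
move=> [u v] /=; rewrite !inE !xpair_eqE exy.
apply/idP/idP.
  move=> /andP[/andP[uW /andP[vW uv]] /eqP uvxy].
  have : u \in [set x; y] by rewrite -uvxy !inE eqxx.
  have : v \in [set x; y] by rewrite -uvxy !inE eqxx orbT.
  rewrite !inE => /orP[]/eqP vE /orP[]/eqP uE; move: uv; rewrite uE vE ?eqxx ?orbT//.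
move=> /orP[] /andP[/eqP -> /eqP ->]; rewrite xW yW ?xy /=.
  exact: eqxx.
by rewrite eq_sym xy setUC eqxx.
Qed.

Definition pairs_in A : {set {set V}} := [set e : {set V} | (e \subset A) && (#|e| == 2)].

Lemma card_pairs_in A : (#|pairs_in A| <= #|A| ^ 2)%N.
Proof.
rewrite cards_draws bin2 expnS expn1; apply: leq_trans (half_leq _) _.
  exact: (leq_mul (leqnn #|A|) (leq_pred #|A|)).
by rewrite leq_half_double -addnn -addnS leq_addr.
Qed.

End Graphs.

(** * Random graphs *)

Section RandomGraph.
Context {R : realType} {V : finType}.
Implicit Types (E : {set {set V}}) (p : {set V} -> R) (A : pred (graph V)).

Fact graph_of_set_subproof E : [forall e in [set e in E | #|e| == 2], #|e| == 2].
Proof. by apply/forallP => e; apply/implyP; rewrite inE => /andP[]. Qed.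

Definition graph_of_set E : graph V := Graph (graph_of_set_subproof E).

Lemma adj_graph_of_set E u v :
  adj (graph_of_set E) u v = ([set u; v] \in E) && (u != v).
Proof. by rewrite /adj /= inE cards2; case: (u != v). Qed.

Lemma independent_graph_of_set E (A : {set V}) :
  independent (graph_of_set E) A = [disjoint pairs_in A & E].
Proof.
apply/independentP/idP => [H|].
  rewrite -setI_eq0; apply/eqP/setP => e; rewrite !inE.
  apply/negP => /andP[/andP[eA /cards2P[u [v [uv euv]]]] eE].
  have uA : u \in A by apply: (subsetP eA); rewrite euv !inE eqxx.
  have vA : v \in A by apply: (subsetP eA); rewrite euv !inE eqxx orbT.
  by move: (H u v uA vA); rewrite adj_graph_of_set -euv eE uv.
rewrite disjoint_subset => /subsetP H u v uA vA.
rewrite adj_graph_of_set; case: (eqVneq u v) => [|uv]; first by rewrite andbF.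
rewrite andbT; have := H [set u; v]; rewrite !inE cards2 uv eqxx andbT; apply.
by apply/subsetP => x; rewrite !inE => /orP[] /eqP ->.
Qed.

(* Coordinates that are not pairs get probability [0], so that all of
   [{set {set V}}] can be used as sample space. *)
Definition pair_prob p (e : {set V}) : R := if #|e| == 2 then p e else 0.

Lemma pair_prob_is_prob p : (forall e, 0 <= p e <= 1) -> is_prob (pair_prob p).
Proof. by move=> pP e; rewrite /pair_prob; case: ifP => // _; rewrite lexx ler01. Qed.

(** Among the sets mapped to a given graph, only its own edge set can have nonzero weight, since a
    non-pair has probability [0]. *)
Lemma graph_probE p A :
  graph_prob p A = rset_expect (pair_prob p) (fun E => (A (graph_of_set E))%:R).
Proof.
rewrite /graph_prob /rset_expect big_mkcond /=.
rewrite [RHS](partition_big graph_of_set xpredT)//=.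
apply: eq_bigr => G _.
have eG : graph_of_set (edges G) = G.
  apply: val_inj; apply/setP => e; rewrite /= inE.
  case eG: (e \in edges G) => //=.
  by have := forallP (edgesP G) e; rewrite eG.
rewrite (bigD1 (edges G)) ?eG ?eqxx//= big1 ?addr0; last first.
  move=> E /andP[/eqP EG EN].
  have /existsP[e /andP[eE e2]] : [exists e, (e \in E) && (#|e| != 2)].
    apply: contraNT EN => /existsPn H; apply/eqP; rewrite -EG /=.
    apply/setP => e; rewrite inE; case eE: (e \in E) => //=.
    by have := H e; rewrite eE /= negbK => ->.
  by rewrite /rset_weight (bigD1 e)//= eE /pair_prob (negbTE e2) !mul0r.
have -> : rset_weight (pair_prob p) (edges G) = graph_weight p G.
  rewrite /rset_weight (bigID (fun e : {set V} => #|e| == 2)) /= [X in _ * X]big1 ?mulr1.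
    by apply: eq_bigr => e e2; rewrite /pair_prob e2.
  move=> e e2; rewrite /pair_prob (negbTE e2) subr0; case: ifP => // eE.
  by have := forallP (edgesP G) e; rewrite eE (negbTE e2).
by case: (A G); rewrite ?mulr1 ?mulr0.
Qed.

Lemma graph_prob_mono p (A B : pred (graph V)) : (forall e, 0 <= p e <= 1) ->
  (forall G, A G -> B G) -> graph_prob p A <= graph_prob p B.
Proof.
move=> pP AB; rewrite !graph_probE; apply: le_rset_expect.
  exact: pair_prob_is_prob.
by move=> E; rewrite ler_nat; case H: (A _) => //; rewrite (AB _ H).
Qed.

Lemma graph_prob_setC p A : graph_prob p A = 1 - graph_prob p (predC A).
Proof.
rewrite !graph_probE -[X in X - _](rset_expect_cst (pair_prob p) 1).
rewrite -rset_expectB; apply: eq_rset_expect => E /=.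
by case: (A _); rewrite ?subr0 ?subrr.
Qed.

Lemma graph_prob_union p (I : finType) (P : pred I) (A : I -> pred (graph V)) :
  (forall e, 0 <= p e <= 1) ->
  graph_prob p (fun G => [exists i, P i && A i G]) <= \sum_(i | P i) graph_prob p (A i).
Proof.
move=> pP; rewrite graph_probE.
under [leRHS]eq_bigr do rewrite graph_probE.
rewrite -rset_expect_sum; apply: le_rset_expect; first exact: pair_prob_is_prob.
move=> E; case: existsP => [[i /andP[Pi Ai]]|_]; last exact: sumr_ge0.
by rewrite (bigD1 i)//= Ai lerDl sumr_ge0.
Qed.

Lemma graph_prob_orb p (A B : pred (graph V)) : (forall e, 0 <= p e <= 1) ->
  graph_prob p (fun G => A G || B G) <= graph_prob p A + graph_prob p B.
Proof.
move=> pP; rewrite !graph_probE -rset_expectD.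
apply: le_rset_expect; first exact: pair_prob_is_prob.
by move=> E; rewrite -natrD ler_nat; case: (A _); case: (B _).
Qed.

Lemma graph_prob_independent p (A : {set V}) :
  graph_prob p (fun G => independent G A) = \prod_(e in pairs_in A) (1 - p e).
Proof.
rewrite graph_probE.
under eq_rset_expect do rewrite independent_graph_of_set.
rewrite rset_expect_avoid_cst; apply: eq_bigr => e.
by rewrite inE /pair_prob => /andP[_ ->].
Qed.

(* Exponential Markov inequality in base [2] for the number of edges inside
   [W]: a graph of minimum degree [d] on [W] has at least [d #|W| / 2] edges. *)
Lemma graph_prob_min_degree p (W : {set V}) (d : nat) (r : R) :
  (forall e, 0 <= p e <= 1) -> 0 <= r ->
  (forall e, e \in pairs_in W -> p e <= r) ->
  graph_prob p (fun G => [forall v in W, (d <= #|[set u in W | adj G v u]|)%N])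
  <= expR (#|W|%:R * (r * #|W|%:R - d%:R / 4)).
Proof.
move=> pP r0 pr; rewrite graph_probE.
set P := pairs_in W.
pose F (E : {set {set V}}) : R :=
  \prod_e (if e \in E then (if e \in P then 2 else 1) else 1).
have FE E : F E = 2 ^+ #|E :&: P|.
  rewrite -prodr_const /F [RHS]big_mkcond /=; apply: eq_bigr => e _.
  by rewrite in_setI; case: (e \in E).
apply: (@le_trans _ _ (rset_expect (pair_prob p)
    (fun E => expR (- (#|W|%:R * d%:R / 4)) * F E))).
  apply: le_rset_expect; first exact: pair_prob_is_prob.
  move=> E; case: forall_inP => [H|_]; last first.
    by rewrite FE mulr_ge0 ?expR_ge0// exprn_ge0.
  rewrite expRN mulrC ler_pdivlMr ?expR_gt0// mul1r FE.
  have : (#|W| * d <= 2 * #|E :&: P|)%N.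
    have := sum_set2 W (fun e => (e \in E : nat)).
    rewrite mulr2n => sE.
    have eP : #|E :&: P| = (\sum_(e : {set V} | (e \subset W) && (#|e| == 2)) (e \in E))%N.
      rewrite -sum1_card big_mkcond /= [RHS]big_mkcond /=; apply: eq_bigr => e _.
      rewrite in_setI [e \in P]inE; case: (e \in E) => //=.
      by case: ifP.
    have -> : (2 * #|E :&: P| = \sum_(u in W) \sum_(v in W | u != v) ([set u; v] \in E))%N.
      by rewrite mul2n -addnn eP; exact: esym sE.
    rewrite -sum_nat_const; apply: leq_sum => u uW.
    apply: leq_trans (H u uW) _; rewrite -sum1_card big_mkcond /= [leqRHS]big_mkcond /=.
    apply: leq_sum => v _; rewrite !inE adj_graph_of_set.
    case: (v \in W) => //=; case: ([set u; v] \in E); case: (u != v) => //.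
  rewrite -(ler_nat R) !natrM => dW.
  (* Each of the at least [#|W| d / 2] edges contributes a factor [2 >= expR (1 / 2)]; this is the
     origin of [d / 4]. *)
  apply: (@le_trans _ _ (expR (2^-1 * #|E :&: P|%:R))).
    by rewrite ler_expR; lra.
  rewrite expRM_natr lerXn2r ?nnegrE ?expR_ge0//.
  have := expR_ge1Dx (- 2^-1 : R); rewrite expRN => h.
  rewrite -lef_pV2 ?posrE ?expR_gt0//; lra.
rewrite rset_expectZ /F rset_expect_prod.
have -> : expR (#|W|%:R * (r * #|W|%:R - d%:R / 4)) =
   expR (- (#|W|%:R * d%:R / 4)) * expR (r * #|W|%:R ^+ 2) :> R.
  by rewrite -expRD; congr expR; ring.
rewrite ler_wpM2l ?expR_ge0//.
apply: (@le_trans _ _ (\prod_(e in P) expR r)).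
  rewrite [leRHS]big_mkcond; apply: ler_prod => e _.
  have := pair_prob_is_prob pP e => /andP[e0 e1].
  case: ifP => eP; last by apply/andP; split; lra.
  apply/andP; split; first by lra.
  apply: le_trans (expR_ge1Dx r).
  have := pr e eP; move: eP; rewrite /pair_prob inE => /andP[_ ->]; lra.
rewrite prodr_const -expRM_natr ler_expR ler_wpM2l// -natrX ler_nat.
exact: card_pairs_in.
Qed.

End RandomGraph.
(** * Independent sets in the block model *)

Definition qform {R : realType} (a b c x y : R) : R :=
  a * x ^+ 2 + 2 * c * (x * y) + b * y ^+ 2.

Section BlockModel.
Context {R : realType} (S : sbm R).
Local Notation V := (vertex S).
Local Notation B1 := (block1 S).
Local Notation B2 := (block2 S).
Local Notation a := (q11 S).
Local Notation b := (q22 S).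
Local Notation c := (q12 S).
Implicit Types (A U W : {set V}).

Lemma ln_inv_subr (p : R) : 0 <= p < 1 ->
  [/\ 1 - p = expR (- ln (1 / (1 - p))), 0 <= ln (1 / (1 - p)) & p <= ln (1 / (1 - p))].
Proof.
move=> /andP[p0 p1]; have p1' : 0 < 1 - p by lra.
have E : 1 - p = expR (- ln (1 / (1 - p))).
  by rewrite div1r lnV ?posrE// opprK lnK ?posrE.
have H : p <= ln (1 / (1 - p)).
  by have := expR_ge1Dx (- ln (1 / (1 - p))); rewrite -E; lra.
by split=> //; lra.
Qed.

Lemma edge_prob_range (e : {set V}) : 0 <= edge_prob e <= 1.
Proof.
rewrite /edge_prob; have := p11_range S; have := p22_range S; have := p12_range S.
by case: ifP => _; [|case: ifP => _]; lra.
Qed.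

Lemma block2C : B2 = ~: B1.
Proof. by apply/setP => v; rewrite !inE. Qed.

Lemma card_blocks A : #|A| = (#|A :&: B1| + #|A :&: B2|)%N.
Proof. by rewrite block2C -setDE cardsID. Qed.

Lemma card_block1 : #|B1| = n1 S.
Proof.
have -> : B1 = [set inl x | x : 'I_(n1 S)].
  apply/setP => -[x|x]; rewrite inE /=; first by rewrite imset_f.
  by apply/esym/negP => /imsetP[].
by rewrite card_imset ?card_ord// => x y [].
Qed.

Lemma card_block2 : #|B2| = n2 S.
Proof.
have -> : B2 = [set inr x | x : 'I_(n2 S)].
  apply/setP => -[x|x]; rewrite inE /=; last by rewrite imset_f.
  by apply/esym/negP => /imsetP[].
by rewrite card_imset ?card_ord// => x y [].
Qed.

Definition edge_rate (e : {set V}) : R :=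
  if e \subset B1 then a else if e \subset B2 then b else c.

Lemma edge_rateE (e : {set V}) : 1 - edge_prob e = expR (- edge_rate e).
Proof.
have [H11 _ _] := ln_inv_subr (p11_range S).
have [H22 _ _] := ln_inv_subr (p22_range S).
have [H12 _ _] := ln_inv_subr (p12_range S).
by rewrite /edge_prob /edge_rate; case: ifP => _; [|case: ifP => _].
Qed.

Lemma edge_rate_set2 (u v : V) : edge_rate [set u; v] =
  if is_inl u then (if is_inl v then a else c) else (if is_inl v then c else b).
Proof.
rewrite /edge_rate !subUset !sub1set !inE.
by case: (is_inl u); case: (is_inl v).
Qed.

(** The form counts ordered pairs and each vertex with itself; removing the diagonal and halving
    leaves the unordered pairs. *)
Definition indep_rate (x y : R) : R := (qform a b c x y - a * x - b * y) / 2.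

Lemma sum_edge_rate A :
  \sum_(e in pairs_in A) edge_rate e = indep_rate #|A :&: B1|%:R #|A :&: B2|%:R.
Proof.
have sB (x y : R) : \sum_(v in A) (if is_inl v then x else y) =
    x * #|A :&: B1|%:R + y * #|A :&: B2|%:R.
  rewrite (big_setID B1) /= setDE -block2C; congr (_ + _).
    rewrite (eq_bigr (fun=> x)); last by move=> v; rewrite !inE => /andP[_ ->].
    by rewrite sumr_const mulr_natr.
  rewrite (eq_bigr (fun=> y)); last by move=> v; rewrite !inE => /andP[_ /negbTE ->].
  by rewrite sumr_const mulr_natr.
have H := sum_set2 A edge_rate.
rewrite (eq_bigl (fun e : {set V} => (e \subset A) && (#|e| == 2))); last first.
  by move=> e; rewrite inE.
have -> : \sum_(e : {set V} | (e \subset A) && (#|e| == 2)) edge_rate e =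
   (\sum_(u in A) \sum_(v in A | u != v) edge_rate [set u; v]) / 2.
  by rewrite H [_ *+ 2]mulr2n; field.
congr (_ / 2).
have -> : \sum_(u in A) \sum_(v in A | u != v) edge_rate [set u; v] =
    \sum_(u in A) (\sum_(v in A) edge_rate [set u; v] - edge_rate [set u; u]).
  apply: eq_bigr => u uA; rewrite [X in _ = X - _](bigD1 u)//= addrAC subrr add0r.
  by apply: eq_bigl => v; rewrite eq_sym.
rewrite sumrB.
have -> : \sum_(u in A) edge_rate [set u; u] = a * #|A :&: B1|%:R + b * #|A :&: B2|%:R.
  by rewrite -sB; apply: eq_bigr => u _; rewrite edge_rate_set2; case: (is_inl u).
have -> : \sum_(u in A) \sum_(v in A) edge_rate [set u; v] =
   \sum_(u in A) (if is_inl u then a * #|A :&: B1|%:R + c * #|A :&: B2|%:R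
      else c * #|A :&: B1|%:R + b * #|A :&: B2|%:R).
  apply: eq_bigr => u _; rewrite -!sB; case uB: (is_inl u);
    by apply: eq_bigr => v _; rewrite edge_rate_set2 uB.
by rewrite sB /qform; ring.
Qed.

Lemma prod_edge_prob A : \prod_(e in pairs_in A) (1 - edge_prob e) =
  expR (- indep_rate #|A :&: B1|%:R #|A :&: B2|%:R).
Proof.
rewrite -sum_edge_rate -sumrN expR_sum; apply: eq_bigr => e _.
exact: edge_rateE.
Qed.

Lemma sbm_prob_independent A : sbm_prob (fun G => independent G A) =
  expR (- indep_rate #|A :&: B1|%:R #|A :&: B2|%:R).
Proof. by rewrite /sbm_prob graph_prob_independent prod_edge_prob. Qed.

Section Slots.
Context (k1 k2 : nat).
Local Notation K := ('I_k1 + 'I_k2)%type.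
Implicit Type J : {set K}.

Definition slots1 (J : {set K}) : nat := #|[set j in J | is_inl j]|.
Definition slots2 (J : {set K}) : nat := #|[set j in J | ~~ is_inl j]|.

Lemma card_slots J : #|J| = (slots1 J + slots2 J)%N.
Proof.
rewrite -(cardsID [set j : K | is_inl j] J) /slots1 /slots2.
by congr (_ + _)%N; apply: eq_card => j; rewrite !inE andbC.
Qed.

Lemma slots1_le J : (slots1 J <= k1)%N.
Proof.
rewrite -[k1]card_ord -(card_imset _ (@inl_inj 'I_k1 'I_k2)); apply: subset_leq_card.
by apply/subsetP => -[x|x]; rewrite !inE ?andbF// => _; rewrite imset_f.
Qed.

Lemma slots2_le J : (slots2 J <= k2)%N.
Proof.
rewrite -[k2]card_ord -(card_imset _ (@inr_inj 'I_k1 'I_k2)); apply: subset_leq_card.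
by apply/subsetP => -[x|x]; rewrite !inE ?andbF// => _; rewrite imset_f.
Qed.

Lemma slots1T : slots1 setT = k1.
Proof.
rewrite -[RHS]card_ord -(card_imset _ (@inl_inj 'I_k1 'I_k2)); apply: eq_card.
move=> -[x|x]; rewrite !inE /=; first by rewrite imset_f.
by apply/esym/negP => /imsetP[].
Qed.

Lemma slots2T : slots2 setT = k2.
Proof.
rewrite -[RHS]card_ord -(card_imset _ (@inr_inj 'I_k1 'I_k2)); apply: eq_card.
move=> -[x|x]; rewrite !inE /=; last by rewrite imset_f.
by apply/esym/negP => /imsetP[].
Qed.

(** An upper bound for Janson's ratio of correlation sum to squared mean, taken over transversals:
    [s ^- #|J|] is the probability that two random transversals agree on [J], and the exponential is
    the gain from sharing the pairs inside [J]. Sharing a pair takes at least two agreements. *)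
Definition overlap_sum (s : nat) : R :=
  \sum_(J : {set K} | (2 <= #|J|)%N)
    s%:R ^- #|J| * expR (indep_rate (slots1 J)%:R (slots2 J)%:R).

Lemma card_transversal (s : nat) (v : K * 'I_s -> V) : injective v ->
  (forall j, is_inl (v j) = is_inl j.1) ->
  forall (f : {ffun K -> 'I_s}) (J : {set K}),
    #|[set v (j, f j) | j in J] :&: B1| = slots1 J /\
    #|[set v (j, f j) | j in J] :&: B2| = slots2 J.
Proof.
move=> vinj vB f J; have fi : injective (fun j => v (j, f j)) by move=> i j /vinj [].
split; rewrite /slots1 /slots2 -[RHS](card_imset _ fi); apply: eq_card => x; rewrite !inE.
  apply/andP/imsetP => [[/imsetP[j jJ ->]]|[j]].
    by rewrite vB /= => jl; exists j; rewrite // inE jJ.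
  by rewrite inE => /andP[jJ jl] ->; rewrite vB imset_f.
apply/andP/imsetP => [[/imsetP[j jJ ->]]|[j]].
  by rewrite vB /= => jl; exists j; rewrite // inE jJ.
by rewrite inE => /andP[jJ jl] ->; rewrite vB imset_f.
Qed.

(* The candidates are the transversals of [k1 + k2] disjoint parts of size [s]:
   two of them overlap in the vertices chosen from the parts on which they
   agree. *)
Lemma transversal_prob (s : nat) (v : K * 'I_s -> V) :
  (0 < s)%N -> (2 <= k1 + k2)%N -> injective v ->
  (forall j, is_inl (v j) = is_inl j.1) ->
  sbm_prob (fun G => [forall f : {ffun K -> 'I_s},
      ~~ independent G [set v (j, f j) | j in [set: K]]]) <=
  expR (- (4 * overlap_sum s)^-1).
Proof.
move=> s0 kk vinj vB.
pose A (f : {ffun K -> 'I_s}) := [set v (j, f j) | j in [set: K]].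
pose D f := pairs_in (A f).
pose ag (f g : {ffun K -> 'I_s}) := [set j | f j == g j].
pose p := pair_prob (@edge_prob R S).
have cardA := card_transversal vinj vB.
have AI f g : A f :&: A g = [set v (j, f j) | j in ag f g].
  apply/setP => x; rewrite inE; apply/andP/imsetP => [[/imsetP[j _ ->] /imsetP[i _]]|[j]].
    by move=> /vinj [<- ff]; exists j; rewrite // inE ff.
  by rewrite inE => /eqP fg ->; split; [|rewrite fg]; apply: imset_f; rewrite inE.
have DI f g : D f :&: D g = pairs_in (A f :&: A g).
  by apply/setP => e; rewrite !inE subsetI; case: (#|e| == 2); rewrite ?andbT ?andbF.
have avA A' : avoid_prob p (pairs_in A') = expR (- indep_rate #|A' :&: B1|%:R #|A' :&: B2|%:R).
  rewrite -prod_edge_prob; apply: eq_bigr => e.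
  by rewrite inE /p /pair_prob => /andP[_ ->].
pose x0 := expR (- indep_rate k1%:R k2%:R).
have avD f : avoid_prob p (D f) = x0.
  by have [c1 c2] := cardA f setT; rewrite avA /= c1 c2 slots1T slots2T.
have avU f g : avoid_prob p (D f :|: D g) =
    x0 ^+ 2 * expR (indep_rate (slots1 (ag f g))%:R (slots2 (ag f g))%:R).
  have := avoid_probU p (D f) (D g); rewrite DI AI avA !avD.
  have [-> ->] := cardA f (ag f g).
  set y := indep_rate _ _; rewrite expRN expr2 => <-.
  by rewrite divfK// gt_eqF ?expR_gt0.
have sR0 : (s%:R : R) != 0 by rewrite pnatr_eq0 -lt0n.
have cK : #|{: K}| = (k1 + k2)%N by rewrite card_sum !card_ord.
set m := \sum_f avoid_prob p (D f).
have mE : m = s%:R ^+ (k1 + k2) * x0.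
  rewrite /m (eq_bigr (fun=> x0)) // sumr_const card_ffun card_ord cK.
  by rewrite -natrX mulr_natl.
have m0 : 0 < m.
  by rewrite mE mulr_gt0 ?expR_gt0// exprn_gt0// ltr0n.
have pP : is_prob p by apply: pair_prob_is_prob => e; exact: edge_prob_range.
have -> : sbm_prob (fun G => [forall f : {ffun K -> 'I_s}, ~~ independent G (A f)]) =
   rset_expect p (fun E => [forall f, ~~ [disjoint D f & E]]%:R).
  rewrite /sbm_prob graph_probE; apply: eq_rset_expect => E; congr (nat_of_bool _)%:R.
  by apply: eq_forallb => f; rewrite independent_graph_of_set.
(* The full overlap alone contributes [1 / m]; this keeps the retention probability in Janson's
   inequality at most one. *)
have rho_ge : 1 <= overlap_sum s * m.
  rewrite /overlap_sum (bigD1 setT) ?cardsT ?cK//= slots1T slots2T mulrDl mE /x0 expRN.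
  rewrite mulrACA mulVf ?expf_neq0// mulfV ?gt_eqF ?expR_gt0// mul1r lerDl.
  apply: mulr_ge0; last by rewrite mulr_ge0 ?invr_ge0 ?expR_ge0 ?exprn_ge0.
  by apply: sumr_ge0 => J _; rewrite mulr_ge0 ?expR_ge0// invr_ge0 exprn_ge0.
apply: janson => //; first by rewrite -/m -mulrA; lra.
(* The exact agreement set is replaced by a sum over all [J] on which agreement is required: this is
   larger, but factorises over the coordinates. *)
apply: (@le_trans _ _ (\sum_(f : {ffun K -> 'I_s}) \sum_(g : {ffun K -> 'I_s})
  \sum_(J : {set K} | (2 <= #|J|)%N)
    x0 ^+ 2 * expR (indep_rate (slots1 J)%:R (slots2 J)%:R) *
      \prod_j (if j \in J then (f j == g j)%:R else 1))).
  apply: ler_sum => f _; rewrite big_mkcond /=; apply: ler_sum => g _.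
  have t0 J : 0 <= x0 ^+ 2 * expR (indep_rate (slots1 J)%:R (slots2 J)%:R) *
      \prod_j (if j \in J then (f j == g j)%:R else 1).
    by rewrite !mulr_ge0 ?expR_ge0 ?sqr_ge0// prodr_ge0// => j _; case: ifP.
  case: ifP => [nd|_]; last exact: sumr_ge0.
  rewrite (bigD1 (ag f g)) /=.
    rewrite avU [X in _ * X + _]big1 ?mulr1 ?lerDl ?sumr_ge0//.
    by move=> j _; rewrite inE; case: eqP.
  move: nd; rewrite -setI_eq0 DI setIC AI => /set0Pn[e].
  rewrite inE => /andP[/subset_leq_card eA /eqP e2].
  rewrite e2 in eA; apply: leq_trans eA _.
  by rewrite (leq_trans (leq_imset_card _ _))// subset_leq_card//;
    apply/subsetP => j; rewrite !inE eq_sym.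
under eq_bigr do rewrite exchange_big /=.
rewrite exchange_big /= /overlap_sum mulr_suml; apply: ler_sum => J _.
rewrite le_eqVlt; apply/orP; left; apply/eqP.
under eq_bigr => f _.
  rewrite -mulr_sumr -(bigA_distr_bigA (fun j x => if j \in J then (f j == x)%:R else 1)).
  rewrite (eq_bigr (fun j => if j \in J then 1 else s%:R)); last first.
    move=> j _; case: ifP => _; last by rewrite sumr_const card_ord.
    by rewrite (bigD1 (f j))//= eqxx big1 ?addr0// => x /negbTE; rewrite eq_sym => ->.
  over.
rewrite /= sumr_const card_ffun card_ord cK -[LHS]mulr_natl natrX.
rewrite (_ : \prod_j _ = s%:R ^+ (k1 + k2) / s%:R ^+ #|J| :> R); last first.
  rewrite -cK -cardsT -(cardsID J setT) setTI exprD mulrAC mulfV ?expf_neq0// mul1r.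
  rewrite -prodr_const [RHS]big_mkcond /=; apply: eq_bigr => j _.
  by rewrite !inE andbT; case: (j \in J).
by rewrite -/m mE; ring.
Qed.

End Slots.

Definition has_indep (k1 k2 : nat) (U : {set V}) (G : graph V) : bool :=
  [exists A : {set V}, [&& A \subset U, independent G A,
     #|A :&: B1| == k1 & #|A :&: B2| == k2]].

Lemma parts_exist (k1 k2 s : nat) U :
  (k1 * s <= #|U :&: B1|)%N -> (k2 * s <= #|U :&: B2|)%N ->
  exists v : ('I_k1 + 'I_k2) * 'I_s -> V,
   [/\ injective v, forall j, is_inl (v j) = is_inl j.1 & forall j, v j \in U].
Proof.
move=> U1 U2; pose x0 : V := inl (Ordinal (n1_gt0 S)).
have idx k (j : 'I_k) (x : 'I_s) : (j * s + x < k * s)%N.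
  by rewrite (@leq_trans (j.+1 * s))// ?leq_mul2r ?ltn_ord ?orbT// mulSn addnC ltn_add2r.
have idx_inj k (j j' : 'I_k) (x x' : 'I_s) : (j * s + x = j' * s + x')%N -> j = j' /\ x = x'.
  move=> H; have s0 : (0 < s)%N by rewrite (leq_ltn_trans _ (ltn_ord x)).
  have := congr1 (divn^~ s) H; rewrite !divnMDl// !divn_small// !addn0 => /val_inj jj.
  by have := congr1 (modn^~ s) H; rewrite !modnMDl !modn_small// => /val_inj.
pose v (y : ('I_k1 + 'I_k2) * 'I_s) : V := match y.1 with
  | inl j => nth x0 (enum (U :&: B1)) (j * s + y.2)
  | inr j => nth x0 (enum (U :&: B2)) (j * s + y.2) end.
have v1 j x : v (inl j, x) \in U :&: B1.
  by rewrite -mem_enum mem_nth// -cardE (leq_trans (idx _ _ _) U1).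
have v2 j x : v (inr j, x) \in U :&: B2.
  by rewrite -mem_enum mem_nth// -cardE (leq_trans (idx _ _ _) U2).
have vB j : is_inl (v j) = is_inl j.1.
  case: j => -[j|j] x; first by have := v1 j x; rewrite !inE => /andP[].
  by have := v2 j x; rewrite !inE => /andP[_ /negbTE].
exists v; split=> //; last first.
  case=> -[j|j] x; first by have := v1 j x; rewrite inE => /andP[].
  by have := v2 j x; rewrite inE => /andP[].
move=> [[j|j] x] [[j'|j'] x'] vv; try by have := congr1 is_inl vv; rewrite !vB.
  move: vv; rewrite /v /= => /eqP; rewrite nth_uniq ?enum_uniq// -?cardE;
    try by rewrite (leq_trans (idx _ _ _) U1).
  by move=> /eqP/idx_inj[-> ->].
move: vv; rewrite /v /= => /eqP; rewrite nth_uniq ?enum_uniq// -?cardE;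
  try by rewrite (leq_trans (idx _ _ _) U2).
by move=> /eqP/idx_inj[-> ->].
Qed.

Lemma no_indep_prob (k1 k2 s : nat) U : (0 < s)%N -> (2 <= k1 + k2)%N ->
  (k1 * s <= #|U :&: B1|)%N -> (k2 * s <= #|U :&: B2|)%N ->
  sbm_prob (fun G => ~~ has_indep k1 k2 U G) <=
  expR (- (4 * overlap_sum k1 k2 s)^-1).
Proof.
move=> s0 kk U1 U2; have [v [vinj vB vU]] := parts_exist U1 U2.
apply: le_trans (transversal_prob s0 kk vinj vB).
apply: graph_prob_mono => [e|G]; first exact: edge_prob_range.
move=> /existsPn H; apply/forallP => f; apply/negP => fi.
have := H [set v (j, f j) | j in [set: 'I_k1 + 'I_k2]]; rewrite fi /=.
have [-> ->] := card_transversal vinj vB f setT.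
rewrite slots1T slots2T !eqxx !andbT => /negP; apply.
by apply/subsetP => x /imsetP[j _ ->].
Qed.

End BlockModel.
Lemma sum_expr_card {R : comPzRingType} {T : finType} (x : R) :
  \sum_(J : {set T}) x ^+ #|J| = (1 + x) ^+ #|T|.
Proof.
have -> : (1 + x) ^+ #|T| = \prod_(i : T) (x + 1) by rewrite prodr_const addrC.
rewrite bigA_distr /=; apply: eq_big => [J|J _]; first by rewrite inE.
by rewrite -big_mkcond prodr_const.
Qed.

(** * Probabilities of the exceptional events *)

Section BadEvents.
Context {R : realType} (S : sbm R).
Local Notation V := (vertex S).
Local Notation B1 := (block1 S).
Local Notation B2 := (block2 S).
Local Notation a := (q11 S).
Local Notation b := (q22 S).
Local Notation c := (q12 S).
Local Notation N := (n1 S + n2 S)%N.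
Implicit Types (A U W : {set V}) (G : graph V).

Lemma card_vertex : #|V| = N.
Proof. by rewrite card_sum !card_ord. Qed.

Lemma q11_ge0 : 0 <= a. Proof. by have [] := ln_inv_subr (p11_range S). Qed.
Lemma q22_ge0 : 0 <= b. Proof. by have [] := ln_inv_subr (p22_range S). Qed.

Definition no_selection (k1 k2 s : nat) G : bool :=
  [exists U : {set V}, [&& (k1 * s <= #|U :&: B1|)%N, (k2 * s <= #|U :&: B2|)%N
    & ~~ has_indep k1 k2 U G]].

Lemma no_selection_prob (k1 k2 s : nat) : (0 < s)%N -> (2 <= k1 + k2)%N ->
  sbm_prob (no_selection k1 k2 s) <=
  2 ^+ N * expR (- (4 * overlap_sum S k1 k2 s)^-1).
Proof.
move=> s0 kk.
pose P (U : {set V}) := (k1 * s <= #|U :&: B1|)%N && (k2 * s <= #|U :&: B2|)%N.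
apply: (@le_trans _ _ (sbm_prob (fun G => [exists U, P U && ~~ has_indep k1 k2 U G]))).
  apply: graph_prob_mono => [e|G]; first exact: edge_prob_range.
  by move=> /existsP[U H]; apply/existsP; exists U; rewrite /P -andbA.
apply: le_trans (graph_prob_union _ _ (@edge_prob_range R S)) _.
apply: (@le_trans _ _ (\sum_(U : {set V}) expR (- (4 * overlap_sum S k1 k2 s)^-1))).
  rewrite big_mkcond /=; apply: ler_sum => U _; case: ifP => [/andP[U1 U2]|_].
    exact: no_indep_prob.
  exact: expR_ge0.
rewrite -[X in \sum_(U : {set V}) X]mul1r -mulr_suml ler_wpM2r ?expR_ge0//.
have := sum_expr_card (T := V) (1 : R); rewrite card_vertex => <-.
by rewrite le_eqVlt (eq_bigr (fun J : {set V} => 1 ^+ #|J|)) ?eqxx// => J _; rewrite expr1n.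
Qed.

(** Confined to a single block because [p12] may be arbitrarily close to one, so that mixed sets can
    be dense. *)
Definition dense_spot (w d : nat) G : bool :=
  [exists W : {set V}, [&& (W \subset B1) || (W \subset B2), W != set0, (#|W| <= w)%N
    & [forall v in W, (d <= #|[set u in W | adj G v u]|)%N]]].

Lemma dense_spot_prob (w d : nat) (r x : R) : a <= r -> b <= r ->
  expR (r * w%:R - d%:R / 4) <= x -> 0 <= x ->
  sbm_prob (dense_spot w d) <= expR (N%:R * x) - 1.
Proof.
move=> ar br xx x0.
pose P W := ((W \subset B1) || (W \subset B2)) && ((W != set0) && (#|W| <= w)%N).
apply: (@le_trans _ _ (sbm_prob (fun G => [exists W : {set V}, P W &&
    [forall v in W, (d <= #|[set u in W | adj G v u]|)%N]]))).
  apply: graph_prob_mono => [e|G]; first exact: edge_prob_range.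
  move=> /existsP[W /and4P[H1 H2 H3 H4]].
  by apply/existsP; exists W; rewrite /P H1 H2 H3 H4.
apply: le_trans (graph_prob_union _ _ (@edge_prob_range R S)) _.
apply: (@le_trans _ _ (\sum_(W : {set V} | W != set0) x ^+ #|W|)).
  rewrite big_mkcond [leRHS]big_mkcond /=; apply: ler_sum => W _.
  case: ifP => [/andP[WB /andP[-> Ww]]|_]; last by case: ifP => // _; rewrite exprn_ge0.
  apply: le_trans (@graph_prob_min_degree _ _ _ _ _ r (@edge_prob_range R S) _ _) _.
  - exact: le_trans q11_ge0 ar.
  - move=> e; rewrite inE => /andP[eW /eqP e2].
    have [_ _ p11q] := ln_inv_subr (p11_range S).
    have [_ _ p22q] := ln_inv_subr (p22_range S).
    rewrite /edge_prob; case: ifP => [_|eB1]; first exact: le_trans ar.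
    case: ifP => [_|eB2]; first exact: le_trans br.
    by case/orP: WB => /(subset_trans eW); rewrite ?eB1 ?eB2.
  rewrite mulrC expRM_natr lerXn2r ?nnegrE ?expR_ge0//.
  apply: le_trans xx; rewrite ler_expR lerD2r ler_wpM2l ?ler_nat//.
  exact: le_trans q11_ge0 ar.
have := sum_expr_card (T := V) x; rewrite (bigD1 set0)//= cards0 expr0 => /eqP.
rewrite addrC eq_sym -subr_eq => /eqP <-; rewrite lerD2r card_vertex.
rewrite mulrC expRM_natr lerXn2r ?nnegrE ?expR_ge0 ?expR_ge1Dx//; lra.
Qed.

(** The parameter [ct] stands for the cross rate after capping it at [(q11 + q22) / 2], which
    secures convexity. *)
Definition big_indep (ct t : R) G : bool :=
  [exists A : {set V}, independent G A &&
    (t * #|A|%:R < qform a b ct #|A :&: B1|%:R #|A :&: B2|%:R)].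

(* Sets of at least [M] vertices are counted with weight [(M / N) ^+ #|A|],
   whose total is at most [expR M]. *)
Lemma big_indep_prob (ct t M y : R) : ct <= c -> 0 < M -> 0 < y ->
  (forall A, t * #|A|%:R < qform a b ct #|A :&: B1|%:R #|A :&: B2|%:R ->
    M <= #|A|%:R) ->
  expR (- ((t - Num.max a b) / 2)) * N%:R <= M * expR (- 1 - y) ->
  sbm_prob (big_indep ct t) <= expR (- (y * M)).
Proof.
move=> ctc M0 y0 HM Hz; set z := expR _ in Hz.
have N0 : 0 < N%:R :> R by rewrite ltr0n addn_gt0 n1_gt0.
pose P A := t * #|A|%:R < qform a b ct #|A :&: B1|%:R #|A :&: B2|%:R.
apply: (@le_trans _ _ (sbm_prob (fun G => [exists A : {set V}, P A && independent G A]))).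
  apply: graph_prob_mono => [e|G]; first exact: edge_prob_range.
  by move=> /existsP[A H]; apply/existsP; exists A; rewrite andbC.
apply: le_trans (graph_prob_union _ _ (@edge_prob_range R S)) _.
apply: (@le_trans _ _ (\sum_(A : {set V}) expR (- (1 + y) * M) * (M / N%:R) ^+ #|A|)).
  rewrite big_mkcond /=; apply: ler_sum => A _.
  case: ifP => [PA|_]; last by rewrite mulr_ge0 ?expR_ge0// exprn_ge0// divr_ge0 ?ltW.
  have MA := HM A PA.
  rewrite [leLHS]sbm_prob_independent.
  apply: (@le_trans _ _ (z ^+ #|A|)).
    (* The diagonal terms of [indep_rate] are at most [Num.max a b] per vertex, hence the correction
       of [t] in [z]. *)
    rewrite -expRM_natr ler_expR /indep_rate.
    move: PA; rewrite /P /qform (card_blocks A) natrD => PA.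
    have a1 : a * #|A :&: B1|%:R <= Num.max a b * #|A :&: B1|%:R.
      by rewrite ler_wpM2r// le_max lexx.
    have b1 : b * #|A :&: B2|%:R <= Num.max a b * #|A :&: B2|%:R.
      by rewrite ler_wpM2r// le_max lexx orbT.
    have c1 : ct * (#|A :&: B1|%:R * #|A :&: B2|%:R) <= c * (#|A :&: B1|%:R * #|A :&: B2|%:R).
      by rewrite ler_wpM2r// mulr_ge0.
    move: PA a1 b1 c1; move: (#|A :&: B1|%:R : R) (#|A :&: B2|%:R : R) (Num.max a b).
    by move=> k1 k2 mx; lra.
  have zM : z <= M / N%:R * expR (- 1 - y).
    by rewrite mulrAC ler_pdivlMr.
  apply: (@le_trans _ _ ((M / N%:R * expR (- 1 - y)) ^+ #|A|)).
    by rewrite lerXn2r ?nnegrE ?expR_ge0// mulr_ge0 ?expR_ge0// divr_ge0 ?ltW.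
  rewrite exprMn mulrC ler_wpM2r ?exprn_ge0 ?divr_ge0 ?(ltW M0)//.
  rewrite -expRM_natr ler_expR; nra.
rewrite -mulr_sumr sum_expr_card card_vertex.
have -> : expR (- (y * M)) = expR (- (1 + y) * M) * expR M.
  by rewrite -expRD; congr expR; ring.
rewrite ler_wpM2l ?expR_ge0//.
have NM : M / N%:R * N%:R = M by rewrite divfK ?gt_eqF.
rewrite -[X in _ <= expR X]NM expRM_natr lerXn2r ?nnegrE ?expR_ge0 ?expR_ge1Dx//.
by rewrite addr_ge0// divr_ge0// ltW.
Qed.

(* Overlaps [J] of proportion at most [eps] contribute the first summand, which is
   dominated by overlaps in two vertices; larger ones contribute the second. *)
Lemma overlap_sum_le (k1 k2 s : nat) (K1 K2 eps t M m0 g : R) :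
  (0 < s)%N -> (k1 + k2)%:R <= M -> 0 < M -> 0 < g ->
  (forall th x y, 0 <= th -> 0 <= x <= th * K1 -> 0 <= y <= th * K2 ->
    qform a b c x y <= th * t * (x + y)) ->
  0 <= eps ->
  k1%:R <= K1 -> k2%:R <= K2 ->
  (forall l1 l2 : nat, (l1 <= k1)%N -> (l2 <= k2)%N ->
    eps * K1 < l1%:R \/ eps * K2 < l2%:R -> m0 <= (l1 + l2)%:R) ->
  expR (eps * t / 2) / s%:R * M <= 1 ->
  expR (t / 2) / s%:R <= expR (- (2 * g)) ->
  overlap_sum S k1 k2 s <=
  expR 1 * (expR (eps * t / 2) / s%:R * M) ^+ 2 + expR (M * expR (- g) - g * m0).
Proof.
move=> s0 kM M0 g0 Hq e0 kK1 kK2 Hm y1M y2g.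
have sR : 0 < s%:R :> R by rewrite ltr0n.
set y1 := expR (eps * t / 2) / s%:R in y1M *.
set y2 := expR (t / 2) / s%:R in y2g *.
have y10 : 0 <= y1 by rewrite divr_ge0 ?expR_ge0.
have y20 : 0 <= y2 by rewrite divr_ge0 ?expR_ge0.
pose z := expR (- g).
have z0 : 0 < z := expR_gt0 _.
have cK : #|{: 'I_k1 + 'I_k2}| = (k1 + k2)%N by rewrite card_sum !card_ord.
have tJ (J : {set 'I_k1 + 'I_k2}) : (2 <= #|J|)%N ->
   s%:R ^- #|J| * expR (indep_rate S (slots1 J)%:R (slots2 J)%:R) <=
   (y1 * M) ^+ 2 * M ^- #|J| + expR (- (g * m0)) * z ^+ #|J|.
  move=> J2.
  have t1 : 0 <= (y1 * M) ^+ 2 * M ^- #|J|.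
    by rewrite mulr_ge0 ?sqr_ge0// invr_ge0 exprn_ge0// ltW.
  have t2 : 0 <= expR (- (g * m0)) * z ^+ #|J|.
    by rewrite mulr_ge0 ?expR_ge0// exprn_ge0// ltW.
  have rate th : 0 <= th -> (slots1 J)%:R <= th * K1 -> (slots2 J)%:R <= th * K2 ->
      s%:R ^- #|J| * expR (indep_rate S (slots1 J)%:R (slots2 J)%:R) <=
      (expR (th * t / 2) / s%:R) ^+ #|J|.
    move=> th0 J1K J2K; rewrite exprMn exprVn mulrC.
    rewrite ler_wpM2r ?invr_ge0 ?exprn_ge0 ?(ltW M0) ?(ltW sR)//.
    rewrite -expRM_natr ler_expR /indep_rate.
    have := Hq th (slots1 J)%:R (slots2 J)%:R th0.
    rewrite J1K J2K !ler0n => /(_ isT isT); rewrite -natrD -card_slots.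
    have : 0 <= a * (slots1 J)%:R by rewrite mulr_ge0// q11_ge0.
    have : 0 <= b * (slots2 J)%:R by rewrite mulr_ge0// q22_ge0.
    by move: (qform _ _ _ _ _) => q; clear; lra.
  have small : (slots1 J)%:R <= eps * K1 -> (slots2 J)%:R <= eps * K2 ->
      s%:R ^- #|J| * expR (indep_rate S (slots1 J)%:R (slots2 J)%:R) <=
      (y1 * M) ^+ 2 * M ^- #|J|.
    move=> H1 H2; apply: le_trans (rate eps e0 H1 H2) _; rewrite -/y1.
    rewrite -[leLHS]mulr1 -(mulfV (expf_neq0 #|J| (lt0r_neq0 M0))) mulrA -exprMn.
    rewrite ler_wpM2r ?invr_ge0 ?exprn_ge0 ?(ltW M0) ?(ltW sR)//.
    (* Since [y1 * M <= 1] and [2 <= #|J|], a pair is the worst case; the factor [M ^- #|J|] set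
       aside makes the sum over [J] at most [expR 1]. *)
    by apply: ler_wiXn2l => //; rewrite mulr_ge0// ltW.
  have large : m0 <= #|J|%:R ->
      s%:R ^- #|J| * expR (indep_rate S (slots1 J)%:R (slots2 J)%:R) <=
      expR (- (g * m0)) * z ^+ #|J|.
    move=> mJ.
    have H1 : (slots1 J)%:R <= 1 * K1.
      by rewrite mul1r; apply: le_trans kK1; rewrite ler_nat slots1_le.
    have H2 : (slots2 J)%:R <= 1 * K2.
      by rewrite mul1r; apply: le_trans kK2; rewrite ler_nat slots2_le.
    apply: le_trans (rate 1 ler01 H1 H2) _; rewrite mul1r -/y2.
    (* Half of the exponent [2 g #|J|] pays for [expR (- g m0)]; the other half keeps the sum over
       [J] below [expR (M expR (- g))]. *)
    apply: (@le_trans _ _ (expR (- (2 * g)) ^+ #|J|)).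
      by rewrite lerXn2r ?nnegrE ?expR_ge0.
    have : g * m0 <= g * #|J|%:R by rewrite ler_wpM2l// ltW.
    by rewrite /z -!expRM_natr -expRD ler_expR; clear; lra.
  have [H1|H1] := leP (slots1 J)%:R (eps * K1).
    have [H2|H2] := leP (slots2 J)%:R (eps * K2).
      by apply: le_trans (small H1 H2) _; rewrite lerDl.
    apply: le_trans (large _) _; last by rewrite lerDr.
    by rewrite (card_slots J); apply: Hm; [exact: slots1_le|exact: slots2_le|right].
  apply: le_trans (large _) _; last by rewrite lerDr.
  by rewrite (card_slots J); apply: Hm; [exact: slots1_le|exact: slots2_le|left].
apply: le_trans (ler_sum _ tJ) _.
apply: (@le_trans _ _ (\sum_(J : {set 'I_k1 + 'I_k2})
   ((y1 * M) ^+ 2 * M ^- #|J| + expR (- (g * m0)) * z ^+ #|J|))).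
  rewrite big_mkcond /=; apply: ler_sum => J _; case: ifP => // _.
  by rewrite addr_ge0// mulr_ge0 ?sqr_ge0 ?expR_ge0 ?invr_ge0 ?exprn_ge0// ltW.
rewrite big_split /= -!mulr_sumr; apply: lerD.
  rewrite mulrC ler_wpM2r ?sqr_ge0//.
  under eq_bigr do rewrite -exprVn.
  rewrite sum_expr_card cK.
  apply: (@le_trans _ _ (expR (M^-1 * (k1 + k2)%:R))).
    rewrite expRM_natr lerXn2r ?nnegrE ?expR_ge0 ?expR_ge1Dx//.
    by rewrite addr_ge0// invr_ge0 ltW.
  by rewrite ler_expR mulrC ler_pdivrMr// mul1r.
rewrite sum_expr_card cK [M * _ - _]addrC expRD ler_wpM2l ?expR_ge0//.
apply: (@le_trans _ _ (expR (z * (k1 + k2)%:R))).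
  rewrite expRM_natr lerXn2r ?nnegrE ?expR_ge0 ?expR_ge1Dx//.
  by rewrite addr_ge0// ltW.
by rewrite ler_expR mulrC ler_wpM2r ?(ltW z0).
Qed.

End BadEvents.

(** * Deterministic bounds on the chromatic number outside the exceptional events *)

Section ColouringBlockModel.
Context {R : realType} (S : sbm R).
Local Notation V := (vertex S).
Local Notation B1 := (block1 S).
Local Notation B2 := (block2 S).
Implicit Types (A U W : {set V}) (G : graph V).

Lemma proper_on_sparse G (w d : nat) W : ~~ dense_spot w d G ->
  (W \subset B1) || (W \subset B2) -> (#|W| <= w)%N -> proper_on G W d.
Proof.
move=> /existsPn HG WB Ww; apply: degenerate_proper_on => W' W'W W'0.
have := HG W'; rewrite W'0 (leq_trans (subset_leq_card W'W) Ww) /= => H.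
have W'B : (W' \subset B1) || (W' \subset B2).
  by case/orP: WB => /(subset_trans W'W) ->; rewrite ?orbT.
move: H; rewrite W'B /= => /forall_inPn[v vW]; rewrite -ltnNge => vd.
by exists v.
Qed.

Lemma proper_on_block1 G (k s w d : nat) U : (0 < k)%N -> (0 < s)%N ->
  (k * s <= w)%N -> ~~ no_selection k 0 s G -> ~~ dense_spot w d G ->
  U \subset B1 -> proper_on G U (#|U| %/ k + d).
Proof.
move=> k0 s0 ksw /existsPn HX HD.
apply: (@proper_on_greedy _ _ B1 k (k * s)) => //; first by rewrite leq_pmulr.
  move=> W WB Wk; have := HX W; rewrite (setIidPl WB) Wk mul0n /= negbK.
  move=> /existsP[A /and4P[AW Ai /eqP A1 _]]; exists A; split=> //.
  by rewrite -A1 (setIidPl (subset_trans AW WB)).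
move=> W WB Wk; apply: (proper_on_sparse HD); first by rewrite WB.
by rewrite (leq_trans (ltnW Wk)).
Qed.

Lemma proper_on_block2 G (k s w d : nat) U : (0 < k)%N -> (0 < s)%N ->
  (k * s <= w)%N -> ~~ no_selection 0 k s G -> ~~ dense_spot w d G ->
  U \subset B2 -> proper_on G U (#|U| %/ k + d).
Proof.
move=> k0 s0 ksw /existsPn HX HD.
apply: (@proper_on_greedy _ _ B2 k (k * s)) => //; first by rewrite leq_pmulr.
  move=> W WB Wk; have := HX W; rewrite (setIidPl WB) Wk mul0n /= negbK.
  move=> /existsP[A /and4P[AW Ai _ /eqP A1]]; exists A; split=> //.
  by rewrite -A1 (setIidPl (subset_trans AW WB)).
move=> W WB Wk; apply: (proper_on_sparse HD); first by rewrite WB orbT.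
by rewrite (leq_trans (ltnW Wk)).
Qed.

Lemma blocksU : B1 :|: B2 = setT.
Proof. by rewrite block2C setUCr. Qed.

(** Mixed classes are extracted [s] rounds short of exhaustion, so that selection still applies; the
    leftovers of the two blocks then get single-block classes from disjoint palettes. *)
Lemma chi_le_mixed G (k1 k2 j1 j2 s w d : nat) :
  let m := (minn (n1 S %/ k1) (n2 S %/ k2) - s)%N in
  (0 < k1)%N -> (0 < k2)%N -> (0 < j1)%N -> (0 < j2)%N -> (0 < s)%N ->
  (j1 * s <= w)%N -> (j2 * s <= w)%N ->
  ~~ no_selection k1 k2 s G -> ~~ no_selection j1 0 s G ->
  ~~ no_selection 0 j2 s G -> ~~ dense_spot w d G ->
  (chi G <= m + ((n1 S - m * k1) %/ j1 + d + ((n2 S - m * k2) %/ j2 + d)))%N.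
Proof.
move=> m k10 k20 j10 j20 s0 j1w j2w /existsPn HX HX1 HX2 HD; apply: chi_le.
have [||W [WT W1 W2 WP]] := @proper_on_greedy2 _ G B1 B2 k1 k2 s _ m setT.
- move=> U U1 U2; have := HX U; rewrite U1 U2 /= negbK.
  by move=> /existsP[A /and4P[AW Ai /eqP A1 /eqP A2]]; exists A; split.
- rewrite !setTI card_block1 card_block2.
  have [->|m0] := posnP m; [by left|right].
  have ms : (m + s = minn (n1 S %/ k1) (n2 S %/ k2))%N.
    by rewrite subnK// ltnW// -subn_gt0.
  rewrite ms; split; rewrite mulnC.
    by apply: leq_trans (leq_divM _ k1); rewrite leq_mul2r geq_minl orbT.
  by apply: leq_trans (leq_divM _ k2); rewrite leq_mul2r geq_minr orbT.
apply: WP; rewrite -[W]setIT -blocksU setIUr.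
apply: proper_onU.
  rewrite -card_block1 -[B1 in X in (X - _)%N]setTI -W1.
  exact: (proper_on_block1 j10 s0 j1w HX1 HD (subsetIr _ _)).
rewrite -card_block2 -[B2 in X in (X - _)%N]setTI -W2.
exact: (proper_on_block2 j20 s0 j2w HX2 HD (subsetIr _ _)).
Qed.

Lemma chi_le_blocks G : (chi G <= chi (induced_subgraph G B1)
   + chi (induced_subgraph G B2))%N.
Proof.
apply: chi_le; rewrite -blocksU; apply: proper_onU; exact: chi_induced_proper_on.
Qed.

(* If [c <= (a + b) / 2], then [qform x y / (x + y)] is convex and homogeneous
   of degree one, hence subadditive: [(l1, l2)] is its gradient at [(u, v)]. *)
Lemma qform_tangent (a b c u v x y : R) :
  let l1 := ((a * u + c * v) * 2 - qform a b c u v / (u + v)) / (u + v) in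
  let l2 := ((c * u + b * v) * 2 - qform a b c u v / (u + v)) / (u + v) in
  2 * c <= a + b -> 0 < u + v -> 0 < x + y ->
  l1 * x + l2 * y <= qform a b c x y / (x + y).
Proof.
move=> l1 l2 cab uv xy; rewrite ler_pdivlMr//.
have uv0 : u + v != 0 by rewrite gt_eqF.
have -> : (l1 * x + l2 * y) * (x + y) =
   qform a b c x y - (a + b - 2 * c) * ((x * v - y * u) / (u + v)) ^+ 2.
  by rewrite /l1 /l2 /qform; field.
by rewrite gerBl mulr_ge0 ?sqr_ge0// subr_ge0.
Qed.

Lemma sum_color_classes U (f : V -> nat) (k : nat) : {in U, forall u, (f u < k)%N} ->
  #|U| = (\sum_(j < k) #|[set u in U | f u == j]|)%N.
Proof.
move=> fk; rewrite -sum1_card.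
have [->|[u0 u0U]] := set_0Vmem U.
  rewrite big_set0 big1// => j _; apply/eqP; rewrite cards_eq0.
  by apply/eqP/setP => u; rewrite !inE.
have k0 : (0 < k)%N by rewrite (leq_ltn_trans _ (fk u0 u0U)).
rewrite (partition_big (fun u => insubd (Ordinal k0) (f u)) xpredT)//=.
apply: eq_bigr => j _; rewrite -sum1_card; apply: eq_bigl => u; rewrite !inE.
by case uU: (u \in U) => //=; rewrite -val_eqE val_insubd fk.
Qed.

(** The tangent functional at the sizes of [U] is linear, hence splits over the colour classes. On
    each class it is at most the form divided by the class size, and so at most [t]. A general [U]
    covers the two blocks as well as the whole graph. *)
Lemma proper_on_lower G U (ct t : R) (k : nat) :
  let u1 := #|U :&: B1|%:R in let u2 := #|U :&: B2|%:R in
  2 * ct <= q11 S + q22 S -> 0 <= t -> ~~ big_indep ct t G -> proper_on G U k ->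
  qform (q11 S) (q22 S) ct u1 u2 <= t * k%:R * (u1 + u2).
Proof.
move=> u1 u2 cab t0 /existsPn HL [f fk fP].
have [U0|U0] := eqVneq U set0.
  by rewrite /u1 /u2 U0 !set0I cards0 /qform expr0n !(mulr0, mul0r, addr0).
have uu : 0 < u1 + u2 by rewrite -natrD -card_blocks ltr0n card_gt0.
rewrite -ler_pdivrMr//.
pose l1 := ((q11 S * u1 + ct * u2) * 2 - qform (q11 S) (q22 S) ct u1 u2 / (u1 + u2)) / (u1 + u2).
pose l2 := ((ct * u1 + q22 S * u2) * 2 - qform (q11 S) (q22 S) ct u1 u2 / (u1 + u2)) / (u1 + u2).
have uv0 : u1 + u2 != 0 by rewrite gt_eqF.
have -> : qform (q11 S) (q22 S) ct u1 u2 / (u1 + u2) = l1 * u1 + l2 * u2.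
  by rewrite /l1 /l2 /qform; field.
pose C (j : 'I_k) := [set u in U | f u == j].
have CB (B : {set V}) : #|U :&: B|%:R = \sum_(j < k) #|C j :&: B|%:R :> R.
  rewrite -natr_sum (sum_color_classes (f := f) (k := k)); last first.
    by move=> u; rewrite inE => /andP[/fk].
  congr (_%:R); apply: eq_bigr => j _; apply: eq_card => u; rewrite !inE.
  by rewrite -!andbA [(_ == _) && _]andbC.
have -> : l1 * u1 + l2 * u2 = l1 * (\sum_(j < k) #|C j :&: B1|%:R) +
    l2 * (\sum_(j < k) #|C j :&: B2|%:R) by rewrite -!CB.
rewrite !mulr_sumr -big_split /=.
rewrite -[k in t * k%:R]card_ord mulr_natr -sumr_const; apply: ler_sum => j _.
have [C0|C0] := eqVneq (C j) set0.
  by rewrite C0 !set0I cards0 !mulr0 addr0.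
have cc : 0 < #|C j :&: B1|%:R + #|C j :&: B2|%:R :> R.
  by rewrite -natrD -card_blocks ltr0n card_gt0.
apply: le_trans (qform_tangent cab uu cc) _.
rewrite ler_pdivrMr// -natrD -card_blocks.
have Ci : independent G (C j).
  apply/independentP => x y; rewrite !inE => /andP[xU /eqP fx] /andP[yU /eqP fy].
  by apply/negP => /(fP x y xU yU); rewrite fx fy eqxx.
by have := HL (C j); rewrite Ci /= -leNgt.
Qed.

End ColouringBlockModel.
(** * Asymptotics *)

Section Regular.
Context {R : realType} (sigma0 : R).
Implicit Types (S : sbm R) (P Q : sbm R -> R -> Prop).

Definition qmin S : R := Num.min (q11 S) (q22 S).
Definition qmax S : R := Num.max (q11 S) (q22 S).

(** All asymptotic hypotheses at one index, with every error term replaced by the same [eta]. The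
    last clause is what the ratio condition on [q11] and [q22] supplies. *)
Definition regular (eta : R) S (sigma : R) : Prop :=
  [/\ 0 <= sigma <= sigma0, eta^-1 <= ln (nn S),
    expR (- (sigma + eta) * ln (nn S)) <= qmin S,
    qmax S <= expR (- (sigma - eta) * ln (nn S)) & qmax S <= eta * ln (nn S)].

(** Plays the role of a filter: since [eta] may not depend on the model, estimates proved this way
    are uniform over parameter sequences. *)
Definition regularly P : Prop :=
  exists2 eta, 0 < eta & forall S sigma, regular eta S sigma -> P S sigma.

Lemma regular_le (eta eta' : R) S sigma : 0 < eta -> eta <= eta' ->
  regular eta S sigma -> regular eta' S sigma.
Proof.
move=> e0 ee' [s01 eL mn mx mxL].
have L0 : 0 <= ln (nn S) by apply: le_trans eL; rewrite invr_ge0 ltW.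
split=> //.
- by apply: le_trans eL; rewrite lef_pV2 ?posrE// (lt_le_trans e0).
- apply: le_trans mn; rewrite ler_expR ler_wpM2r//; lra.
- apply: le_trans mx _; rewrite ler_expR ler_wpM2r//; lra.
- by apply: le_trans mxL _; rewrite ler_wpM2r.
Qed.

Lemma regularlyS P Q : (forall S sigma, P S sigma -> Q S sigma) ->
  regularly P -> regularly Q.
Proof. by move=> PQ [eta e0 H]; exists eta => // S sigma /H /PQ. Qed.

Lemma regularlyI P Q : regularly P -> regularly Q ->
  regularly (fun S sigma => P S sigma /\ Q S sigma).
Proof.
move=> [e1 e10 H1] [e2 e20 H2]; exists (Num.min e1 e2); first by rewrite lt_min e10.
have m0 : 0 < Num.min e1 e2 by rewrite lt_min e10.
move=> S sigma H; split; [apply: H1|apply: H2]; apply: regular_le H => //.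
  by rewrite ge_min lexx.
by rewrite ge_min lexx orbT.
Qed.

Lemma regularly_regular (eta : R) : 0 < eta -> regularly (regular eta).
Proof. by move=> e0; exists eta. Qed.

(** Powers of [ln N] are beaten by every positive power of [N]: one term of the exponential series,
    of degree [n + 1], is enough. *)
Lemma regularly_exp (g C : R) (n : nat) : 0 < g ->
  regularly (fun S _ => C * ln (nn S) ^+ n <= expR (g * ln (nn S))).
Proof.
move=> g0; pose B := `|C| * (n.+1)`!%:R / g ^+ n.+1 + 1.
have gn : 0 < g ^+ n.+1 by rewrite exprn_gt0.
have B1 : 1 <= B by rewrite lerDr !mulr_ge0 ?invr_ge0// ltW.
have B0 : 0 < B by apply: lt_le_trans B1.
exists B^-1; first by rewrite invr_gt0.
move=> S sigma [_ + _ _ _]; rewrite invrK; set L := ln _ => BL.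
have L0 : 0 <= L by lra.
apply: le_trans (_ : (g * L) ^+ n.+1 / (n.+1)`!%:R <= _); last first.
  apply: le_trans (expR_ge1Dxn n _); last by rewrite mulr_ge0// ltW.
  by rewrite lerDr.
rewrite ler_pdivlMr ?ltr0n ?fact_gt0// exprMn [L ^+ n.+1]exprSr mulrA.
rewrite [leRHS]mulrAC [leLHS]mulrAC ler_wpM2r ?exprn_ge0//.
apply: (@le_trans _ _ (`|C| * (n.+1)`!%:R)).
  by rewrite ler_wpM2r// ler_norm.
by rewrite [leRHS]mulrC -ler_pdivrMr//; apply: le_trans BL; rewrite lerDl.
Qed.

End Regular.

(** * Every large vertex set contains an independent set of the target shape *)

Section Selection.
Context {R : realType} (sigma0 : R).
Implicit Types (S : sbm R).

Lemma q_bounds S : [/\ qmin S <= q11 S, qmin S <= q22 S, q11 S <= qmax S,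
  q22 S <= qmax S & qmin S <= qmax S].
Proof.
have H1 : qmin S <= q11 S by rewrite ge_min lexx.
have H2 : q11 S <= qmax S by rewrite le_max lexx.
split=> //; first by rewrite ge_min lexx orbT.
- by rewrite le_max lexx orbT.
- exact: le_trans H1 H2.
Qed.

Lemma nn_gt0 S : 0 < nn S.
Proof. by rewrite ltr0n addn_gt0 n1_gt0. Qed.

Lemma expR_ln_nn S : expR (ln (nn S)) = nn S.
Proof. by rewrite lnK// posrE nn_gt0. Qed.

Lemma expR1_le4 : expR 1 <= 4 :> R.
Proof.
have := expR_ge1Dx (- 2^-1 : R).
have -> : expR 1 = (expR (- 2^-1) ^+ 2)^-1 :> R.
  by rewrite expr2 -expRD -expRN; congr expR; lra.
move: (expR _) => x xh.
have x0 : 0 < x by lra.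
rewrite -[leRHS]invrK lef_pV2 ?posrE ?exprn_gt0 ?invr_gt0//.
by rewrite expr2; nra.
Qed.

Lemma overlap_sum_gt0 S (k1 k2 s : nat) : (0 < s)%N -> (2 <= k1 + k2)%N ->
  0 < overlap_sum S k1 k2 s.
Proof.
move=> s0 kk; rewrite /overlap_sum (bigD1 setT) /=; last first.
  by rewrite cardsT card_sum !card_ord.
rewrite ltr_pwDl//.
  by rewrite mulr_gt0 ?expR_gt0// invr_gt0 exprn_gt0// ltr0n.
by apply: sumr_ge0 => J _; rewrite mulr_ge0 ?expR_ge0// invr_ge0 exprn_ge0.
Qed.

(** Large enough that [expR (t / 2)], which is at most [N ^ (1 - sigma - 3 eps / 4)], is smaller by
    a power of [N]; small enough that parts times an independent set size of about [N ^ sigma] stay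
    below [N ^ (1 - eps / 8)]. *)
Definition part_size (eps : R) S (sigma : R) : nat :=
  Num.truncn (expR ((1 - sigma - eps / 4) * ln (nn S))).

Definition colour_rate S (sigma : R) : R := 2 * (1 - sigma) * ln (nn S).

(** Real target sizes [K1] and [K2] may vanish, so single-block sets are included. The lower bounds
    with [zeta] force an overlap of proportion above [eps] in some block to have many vertices. The
    final [expR (- nn S)] is what remains of [expR (- 2 N)] after paying for [2 ^ N] sets. *)
Lemma regularly_selection (eps zeta : R) :
  0 < eps -> 8 * eps <= 1 - 4 * sigma0 -> 0 < sigma0 -> 0 < zeta <= 1 ->
  regularly sigma0 (fun S sigma =>
    (0 < part_size eps S sigma)%N /\
    forall K1 K2 : R, let t := (1 - eps) * colour_rate S sigma in
    (forall th x y, 0 <= th -> 0 <= x <= th * K1 -> 0 <= y <= th * K2 ->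
      qform (q11 S) (q22 S) (q12 S) x y <= th * t * (x + y)) ->
    K1 = 0 \/ zeta * t <= q11 S * K1 -> K2 = 0 \/ zeta * t <= q22 S * K2 ->
    q11 S * K1 <= t -> q22 S * K2 <= t -> 0 <= K1 -> 0 <= K2 -> 0 < K1 + K2 ->
    sbm_prob (S := S) (no_selection (Num.truncn K1) (Num.truncn K2) (part_size eps S sigma))
      <= expR (- nn S)).
Proof.
move=> e0 e8 s00 /andP[z0 z1].
have s0q : sigma0 < 1 / 4 by lra.
have e18 : eps < 1 / 8 by lra.
(* With [qmax S <= eta * L] this yields [64 <= eps * m0] for the minimal size [m0] of a large
   overlap. *)
pose eta := eps ^+ 2 * zeta / 64.
have eta0 : 0 < eta by rewrite !mulr_gt0// exprn_gt0.
have eta_e : 64 * eta <= eps by rewrite /eta expr2; nra.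
have h2 : 0 < 2^-1 :> R by rewrite invr_gt0.
have h4 : 0 < eps / 4 by rewrite divr_gt0.
have h5 : 0 < 5 * eps by rewrite mulr_gt0.
have h16 : 0 < eps / 16 by rewrite divr_gt0.
have := regularlyI (regularly_regular sigma0 eta0)
 (regularlyI (regularly_exp sigma0 2 0 h2)
 (regularlyI (regularly_exp sigma0 2 0 h4)
 (regularlyI (regularly_exp sigma0 8 1 e0)
 (regularlyI (regularly_exp sigma0 4096 2 h5)
 (regularlyI (regularly_exp sigma0 (64 / (eps ^+ 2 * zeta)) 0 h16)
             (regularly_exp sigma0 16 0 (ltr01 : 0 < 1 :> R))))))).
apply: regularlyS => S sigma.
set L := ln (nn S).
rewrite !expr0 !mulr1 expr1 mul1r.
move=> [[/andP[sg0 sgle] etaL mnL mxL mxe] [E1 [E2 [E3 [E4 [E5 E6]]]]]].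
have [amn bmn amx bmx mnmx] := q_bounds S.
rewrite -/L in etaL mnL mxL mxe.
have L64 : 64 <= L.
  apply: le_trans etaL; rewrite -[64]invrK lef_pV2 ?posrE ?invr_gt0//.
  by move: eta_e e18; clear; lra.
have mn0 : 0 < qmin S by apply: lt_le_trans mnL; exact: expR_gt0.
have mx0 : 0 < qmax S by apply: lt_le_trans mnmx.
set X := expR ((1 - sigma - eps / 4) * L).
have [L1 L0] : 1 <= L /\ 0 < L by move: L64; clear; lra.
have X2 : 2 <= X.
  apply: le_trans E1 _; rewrite ler_expR ler_wpM2r ?(ltW L0)//.
  by move: sgle s0q e18; clear; lra.
have [sX Xs] : (part_size eps S sigma)%:R <= X /\ X / 2 <= (part_size eps S sigma)%:R.
  have := truncn_itv (ltW (expR_gt0 ((1 - sigma - eps / 4) * L))).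
  rewrite -/X -/(part_size eps S sigma) => /andP[-> ]; rewrite -natr1.
  by move: X2; clear; lra.
set s := part_size eps S sigma in sX Xs *.
have s0 : (0 < s)%N by rewrite -(ltr0n R); move: Xs X2; clear; lra.
split=> // K1 K2 t Hq K1z K2z K1t K2t K10 K20 K12.
have tL : L <= t.
  rewrite /t /colour_rate -/L mulrA ler_peMl ?(ltW L0)//.
  by move: e0 e18 sg0 sgle s0q; clear; nra.
have tL2 : t <= 2 * L.
  rewrite /t /colour_rate -/L mulrA ler_wpM2r ?(ltW L0)//.
  by move: e0 e18 sg0 sgle s0q; clear; nra.
have t0 : 0 < t by exact: lt_le_trans tL.
have tE : t = (1 - eps) * (2 * (1 - sigma) * L) by [].
clearbody t.
set Y := expR ((sigma + eta) * L).
have Y0 : 0 < Y by exact: expR_gt0.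
have mnY : 1 <= qmin S * Y.
  apply: le_trans (ler_wpM2r (ltW Y0) mnL).
  by rewrite -expRD mulNr addNr expR0.
have KY (q K : R) : qmin S <= q -> 0 <= K -> q * K <= t -> K <= 2 * L * Y.
  move=> mnq K0 qK; apply: (@le_trans _ _ (K * (qmin S * Y))).
    by rewrite ler_peMr.
  rewrite mulrA ler_wpM2r ?(ltW Y0)//; apply: le_trans tL2; apply: le_trans qK.
  by rewrite mulrC ler_wpM2r.
pose M := 4 * L * Y.
have M0 : 0 < M by rewrite !mulr_gt0.
have k1K : (Num.truncn K1)%:R <= K1 by rewrite truncn_le.
have k2K : (Num.truncn K2)%:R <= K2 by rewrite truncn_le.
have kM : (Num.truncn K1 + Num.truncn K2)%:R <= M.
  rewrite natrD; have := KY _ _ amn K10 K1t; have := KY _ _ bmn K20 K2t.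
  by move: k1K k2K; rewrite /M; clear; lra.
have Kbig (q K : R) : q <= qmax S -> 0 <= K -> zeta * t <= q * K -> 64 <= K.
  move=> qmx K0 qK.
  have H : zeta * L <= eta * L * K.
    apply: (@le_trans _ _ (zeta * t)); first by rewrite ler_wpM2l// ltW.
    apply: le_trans qK _; rewrite ler_wpM2r//; exact: le_trans mxe.
  have H2 : zeta <= eta * K by rewrite -(ler_pM2r L0) mulrAC.
  have H3 : zeta * 64 <= zeta * (eps ^+ 2 * K).
    by move: H2; rewrite /eta; clear; lra.
  rewrite ler_pM2l// in H3; apply: le_trans H3 _.
  by rewrite ler_piMl// expr2; move: e0 e18; clear; nra.
have kk : (2 <= Num.truncn K1 + Num.truncn K2)%N.
  have [K1p|K1p] := ltP 0 K1.
    case: K1z => [K1e|K1z]; first by rewrite K1e ltxx in K1p.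
    rewrite (@leq_trans (Num.truncn K1)) ?leq_addr// truncn_ge_nat//.
    by apply: le_trans (Kbig _ _ amx K10 K1z); rewrite ler_nat.
  have K2p : 0 < K2 by move: K12 K1p; clear; lra.
  case: K2z => [K2e|K2z]; first by rewrite K2e ltxx in K2p.
  rewrite (@leq_trans (Num.truncn K2)) ?leq_addl// truncn_ge_nat//.
  by apply: le_trans (Kbig _ _ bmx K20 K2z); rewrite ler_nat.
pose m0 := eps * zeta * t / qmax S.
have Klow (q K : R) (l : nat) : q <= qmax S -> 0 <= K -> (l <= Num.truncn K)%N ->
    K = 0 \/ zeta * t <= q * K -> eps * K < l%:R -> m0 <= l%:R.
  move=> qmx K0 lK [Ke|H] el.
    by move: lK el; rewrite Ke truncn0 leqn0 => /eqP ->; rewrite mulr0 ltxx.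
  apply: le_trans (ltW el); rewrite /m0 ler_pdivrMr// -!mulrA ler_wpM2l ?(ltW e0)//.
  by apply: le_trans H _; rewrite mulrC ler_wpM2l.
have g0 : 0 < eps / 8 * L by rewrite mulr_gt0// divr_gt0.
have em0 : 64 <= eps * m0.
  rewrite /m0 !mulrA ler_pdivlMr//; apply: (@le_trans _ _ (64 * (eta * L))).
    by rewrite ler_wpM2l.
  rewrite (_ : 64 * (eta * L) = eps * eps * zeta * L); last by rewrite /eta; field.
  by rewrite ler_wpM2l// !mulr_ge0// ltW.
(* Bounds [N ^ eps * M / s] with [M] about [N ^ sigma] and [s] at least half of [X]; the excess
   [eta + eps / 4] is rounded up to [eps / 2]. *)
pose W := 8 * L * expR (- (1 - 2 * sigma - 3 / 2 * eps) * L).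
have sR : 0 < s%:R :> R by rewrite ltr0n.
have y1M : expR (eps * t / 2) / s%:R * M <= W.
  rewrite mulrAC ler_pdivrMr//.
  apply: (@le_trans _ _ (W * (X / 2))); last first.
    by rewrite ler_wpM2l// !mulr_ge0 ?expR_ge0// ltW.
  apply: (@le_trans _ _ (expR (eps * L) * M)).
    rewrite ler_wpM2r ?(ltW M0)// ler_expR.
    by rewrite -mulrA ler_wpM2l ?(ltW e0)//; move: tL2; clear; lra.
  rewrite /W /X /M /Y.
  rewrite [leLHS](_ : _ = 4 * L * expR (eps * L + (sigma + eta) * L)); last first.
    by rewrite expRD; ring.
  rewrite [leRHS](_ : _ = 4 * L * expR (- (1 - 2 * sigma - 3 / 2 * eps) * L
      + (1 - sigma - eps / 4) * L)); last first.
    by rewrite [in RHS]expRD; field.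
  rewrite ler_wpM2l ?mulr_ge0 ?(ltW L0)// ler_expR -!mulrDl ler_wpM2r ?(ltW L0)//.
  by move: eta_e e0; clear; lra.
have W1 : W <= 1.
  apply: (@le_trans _ _ (expR (eps * L) * expR (- (1 - 2 * sigma - 3 / 2 * eps) * L))).
    by rewrite ler_wpM2r ?expR_ge0.
  rewrite -expRD -[leRHS]expR0 ler_expR -mulrDl mulr_le0_ge0 ?(ltW L0)//.
  by move: e18 sg0 sgle s0q; clear; lra.
have y2g : expR (t / 2) / s%:R <= expR (- (2 * (eps / 8 * L))).
  rewrite ler_pdivrMr//; apply: (@le_trans _ _ (expR (- (2 * (eps / 8 * L))) * (X / 2))); last first.
    by rewrite ler_wpM2l ?expR_ge0.
  rewrite mulrA ler_pdivlMr// mulrC /X -expRD.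
  apply: (@le_trans _ _ (expR (eps / 4 * L) * expR (t / 2))).
    by rewrite ler_wpM2r ?expR_ge0.
  rewrite -expRD ler_expR tE.
  rewrite [leLHS](_ : _ = (eps / 4 + (1 - eps) * (1 - sigma)) * L); last by field.
  rewrite [leRHS](_ : _ = (1 - sigma - eps / 2) * L); last by field.
  rewrite ler_wpM2r ?(ltW L0)//.
  have : 0 <= eps * (1 / 4 - sigma) by rewrite mulr_ge0 ?(ltW e0)//; move: sgle s0q; clear; lra.
  by clear; nra.
have rho_le := overlap_sum_le s0 kM M0 g0 Hq (ltW e0) k1K k2K _ (le_trans y1M W1) y2g.
have {}rho_le : overlap_sum S (Num.truncn K1) (Num.truncn K2) s <= expR (- L) / 8.
  apply: le_trans (rho_le m0 _) _.
    move=> l1 l2 l1k l2k [H|H]; rewrite natrD.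
      by apply: le_trans (Klow _ _ _ amx K10 l1k K1z H) _; rewrite lerDl.
    by apply: le_trans (Klow _ _ _ bmx K20 l2k K2z H) _; rewrite lerDr.
  rewrite [leRHS](_ : _ = expR (- L) / 16 + expR (- L) / 16); last by field.
  apply: lerD.
    (* Small overlaps: [W ^+ 2] is about [N ^ (4 sigma - 2 + 3 eps)], and the factor [4096 * L ^+ 2]
       costs at most [N ^ (5 eps)]. The result is below [1 / N] because
       [8 * eps <= 1 - 4 * sigma0]. *)
    apply: (@le_trans _ _ (4 * W ^+ 2)).
      apply: ler_pM; rewrite ?expR_ge0 ?sqr_ge0 ?expR1_le4//.
      rewrite lerXn2r ?nnegrE//; last by rewrite !mulr_ge0 ?expR_ge0// ltW.
      by rewrite !mulr_ge0 ?invr_ge0 ?expR_ge0// ltW.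
    rewrite /W !exprMn -expRM_natr ler_pdivlMr//.
    apply: (@le_trans _ _ (expR (5 * eps * L) * expR (- (1 - 2 * sigma - 3 / 2 * eps) * L * 2%:R))).
      rewrite [leLHS](_ : _ = 4096 * L ^+ 2 * expR (- (1 - 2 * sigma - 3 / 2 * eps) * L * 2%:R)).
        by rewrite ler_wpM2r ?expR_ge0.
      by ring.
    rewrite -expRD ler_expR.
    rewrite [leLHS](_ : _ = (8 * eps + 4 * sigma - 2) * L); last by field.
    rewrite -[leRHS]mulN1r ler_wpM2r ?(ltW L0)//.
    by move: e8 sgle; clear; lra.
  apply: (@le_trans _ _ (expR (- (L + L)))).
    rewrite ler_expR.
    (* Large overlaps: half of the exponent [eps / 8 * L * m0] absorbs the entropy term; the other
       half is at least [4 * L]. *)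
    have H1 : M * expR (- (eps / 8 * L)) <= eps / 16 * L * m0.
      rewrite /M /Y -mulrA -expRD.
      have mxi : expR ((sigma - eta) * L) <= (qmax S)^-1.
        rewrite -[leLHS]invrK lef_pV2 ?posrE ?invr_gt0 ?expR_gt0//.
        by apply: le_trans mxL _; rewrite -expRN mulNr.
      apply: (@le_trans _ _ (eps / 16 * L * (eps * zeta * L * expR ((sigma - eta) * L)))); last first.
        rewrite /m0 ler_wpM2l ?mulr_ge0 ?(ltW L0) ?(ltW h16) ?(ltW e0)//.
        apply: ler_pM; rewrite ?expR_ge0//; last first.
          by rewrite ler_wpM2l// mulr_ge0// ltW.
        by rewrite !mulr_ge0// ltW.
      have H4 : 4 <= eps ^+ 2 * zeta / 16 * expR (eps / 16 * L).
        move: E5; rewrite ler_pdivrMr; last by rewrite mulr_gt0// exprn_gt0.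
        by clear; lra.
      apply: (@le_trans _ _ (eps ^+ 2 * zeta / 16 * expR (eps / 16 * L) * L
          * expR ((sigma + eta) * L - eps / 8 * L))).
        by rewrite ler_wpM2r ?expR_ge0// ler_wpM2r// ltW.
      rewrite [leLHS](_ : _ = eps ^+ 2 * zeta / 16 * L
          * expR (eps / 16 * L + ((sigma + eta) * L - eps / 8 * L))); last first.
        by rewrite [in RHS]expRD; ring.
      rewrite [leRHS](_ : _ = eps ^+ 2 * zeta / 16 * L * (L * expR ((sigma - eta) * L))); last first.
        by field.
      rewrite ler_wpM2l//; first by rewrite !mulr_ge0 ?invr_ge0 ?exprn_ge0// ltW.
      apply: (@le_trans _ _ (expR ((sigma - eta) * L))); last by rewrite ler_peMl ?expR_ge0.
      rewrite ler_expR.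
      rewrite [leLHS](_ : _ = (sigma + eta - eps / 16) * L); last by field.
      rewrite ler_wpM2r ?(ltW L0)//.
      by move: eta_e e0; clear; lra.
    have H2 : 64 * L <= eps * m0 * L by rewrite ler_wpM2r// ltW.
    move: H1 H2 L0; move: (M * _) => u; clear.
    by rewrite (_ : eps / 16 * L * m0 = eps * m0 * L / 16); [lra|field].
  rewrite opprD expRD ler_wpM2l ?expR_ge0// expRN.
  by rewrite lef_pV2 ?posrE ?expR_gt0//; rewrite mul1r in E6.
apply: le_trans (no_selection_prob S s0 kk) _.
have rho0 := overlap_sum_gt0 S s0 kk.
have H2N : 2 * nn S <= (4 * overlap_sum S (Num.truncn K1) (Num.truncn K2) s)^-1.
  rewrite -[leLHS]invrK lef_pV2 ?posrE ?invr_gt0 ?mulr_gt0//; last 1 first.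
    by rewrite -expR_ln_nn expR_gt0.
  rewrite invfM -expR_ln_nn -expRN -/L.
  by move: rho_le; clear; lra.
apply: (@le_trans _ _ (expR (nn S) * expR (- (2 * nn S)))).
  apply: ler_pM; rewrite ?expR_ge0 ?exprn_ge0//; last by rewrite ler_expR lerN2.
  rewrite /nn -[in leRHS](mul1r (n1 S + n2 S)%:R) expRM_natr lerXn2r ?nnegrE ?expR_ge0//.
  by apply: le_trans (expR_ge1Dx 1); rewrite -natr1 addrC.
by rewrite -expRD ler_expR; clear; lra.
Qed.

End Selection.

(** * Sparse leftovers and the orders of magnitude of all sizes *)

Section UpperBound.
Context {R : realType} (sigma0 : R).
Implicit Types (S : sbm R).

Definition spot_size (eps : R) S : nat :=
  Num.truncn (expR ((1 - eps / 8) * ln (nn S))).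

(** Chosen so that the exponent in [dense_spot_prob] is at most [- 2 ln N]: a set of at most
    [spot_size] vertices then costs at most [N ^ (- 2)] per vertex, against [N] choices for each. *)
Definition spot_degree (eps : R) S : nat :=
  (Num.truncn (4 * (qmax S * expR ((1 - eps / 8) * ln (nn S)) + 2 * ln (nn S)))).+1.

Lemma regularly_dense_spot (eps delta : R) : 0 < delta ->
  regularly sigma0 (fun S sigma =>
    sbm_prob (S := S) (dense_spot (spot_size eps S) (spot_degree eps S)) <= delta).
Proof.
move=> d0.
have := regularlyI (regularly_exp sigma0 2 0 (ltr01 : 0 < 1 :> R))
  (regularly_exp sigma0 (2 / delta) 0 (ltr01 : 0 < 1 :> R)).
apply: regularlyS => S sigma; rewrite !expr0 !mulr1 !mul1r => -[E1 E2].
set L := ln (nn S).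
have [amn bmn amx bmx mnmx] := q_bounds S.
have mx0 : 0 <= qmax S by apply: le_trans amx; exact: q11_ge0.
set Z := expR ((1 - eps / 8) * L).
have Z0 : 0 <= Z by exact: expR_ge0.
have xx : expR (qmax S * (spot_size eps S)%:R - (spot_degree eps S)%:R / 4) <= expR (- (2 * L)).
  rewrite ler_expR.
  have H1 : qmax S * (spot_size eps S)%:R <= qmax S * Z.
    by rewrite ler_wpM2l// truncn_le.
  have := truncnS_gt (4 * (qmax S * Z + 2 * L)); rewrite -/(spot_degree eps S).
  by move: H1; clear; lra.
apply: le_trans (dense_spot_prob amx bmx xx (expR_ge0 _)) _.
rewrite -[(n1 S + n2 S)%:R]expR_ln_nn -expRD -/L.
rewrite (_ : L + - (2 * L) = - L); last by ring.
rewrite -/L in E1 E2.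
set u := expR (- L).
have u0 : 0 < u by exact: expR_gt0.
have u2 : u * 2 <= 1.
  by rewrite -ler_pdivlMl// mulr1 /u expRN invrK.
have ud : u * 2 <= delta.
  by move: E2; rewrite ler_pdivrMr// /u expRN ler_pdivrMl ?expR_gt0// mulrC.
have := expR_ge1Dx (- u); rewrite expRN => H.
have eu : expR u <= (1 - u)^-1.
  by rewrite -[leLHS]invrK lef_pV2 ?posrE ?invr_gt0 ?expR_gt0//; move: u2; clear; lra.
rewrite lerBlDr; apply: le_trans eu _.
rewrite -[leLHS]mul1r ler_pdivrMr; last by move: u2; clear; lra.
by move: u0 u2 ud; clear; nra.
Qed.

Lemma colour_rate_bounds (eta : R) S sigma : 0 < sigma0 < 1 / 4 ->
  regular sigma0 eta S sigma -> 0 < eta <= 1 / 2 ->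
  [/\ ln (nn S) <= colour_rate S sigma, colour_rate S sigma <= 2 * ln (nn S),
      0 <= sigma <= 1 / 4 & 2 <= ln (nn S)].
Proof.
move=> s0q [/andP[sg0 sgle] etaL _ _ _] /andP[e0 e2]; rewrite /colour_rate; set L := ln (nn S).
have L2 : 2 <= L.
  by apply: le_trans etaL; rewrite -[2]invrK lef_pV2 ?posrE ?invr_gt0//; lra.
have L0 : 0 < L by lra.
split=> //.
- by rewrite ler_peMl ?(ltW L0)//; lra.
- by rewrite ler_wpM2r ?(ltW L0)//; lra.
- by lra.
Qed.

Definition block_load S (sigma : R) : R :=
  ((n1 S)%:R * q11 S + (n2 S)%:R * q22 S) / colour_rate S sigma.

(** The separate colouring needs at least about [N ^ (1 - sigma - eta) / ln N] colours, while the
    spot degree and the part size are smaller by a power of [N] of order [eps]; hence both are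
    negligible. *)
Lemma regularly_sizes (eps : R) : 0 < eps < 1 / 8 -> 0 < sigma0 < 1 / 4 ->
  regularly sigma0 (fun S sigma => let t := (1 - eps) * colour_rate S sigma in
   [/\ forall q, qmin S <= q -> q <= qmax S ->
       (Num.truncn (t / q) * part_size eps S sigma <= spot_size eps S)%N
       /\ 64 <= eps * (t / q),
     (spot_degree eps S)%:R <= eps / 2 * block_load S sigma,
     (part_size eps S sigma)%:R + 1 <= eps / 2 * block_load S sigma
     & 0 < qmin S]).
Proof.
move=> /andP[e0 e8] s0q.
pose eta := eps / 128.
have eta0 : 0 < eta by rewrite divr_gt0.
have h16 : 0 < eps / 16 by rewrite divr_gt0.
have h2 : 0 < 2^-1 :> R by rewrite invr_gt0.
have := regularlyI (regularly_regular sigma0 eta0)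
 (regularlyI (regularly_exp sigma0 2 1 h16)
 (regularlyI (regularly_exp sigma0 (32 / eps) 1 h16)
             (regularly_exp sigma0 (72 / eps) 2 h2))).
apply: regularlyS => S sigma [reg [E1 [E2 E3]]] t.
have [] := colour_rate_bounds s0q reg; first by rewrite eta0 /eta; move: e8; clear; lra.
case: reg => sg etaL mnL mxL mxe.
set L := ln (nn S) in etaL mnL mxL mxe E1 E2 E3 *.
set Tr := colour_rate S sigma => LT TL sg14 L2.
rewrite expr1 in E1 E2.
have L0 : 0 < L by move: L2; clear; lra.
have [amn bmn amx bmx mnmx] := q_bounds S.
have mn0 : 0 < qmin S by apply: lt_le_trans mnL; exact: expR_gt0.
have mx0 : 0 < qmax S by apply: lt_le_trans mnmx.
have t2L : t <= 2 * L.
  by rewrite /t -/Tr; move: e0 e8 LT TL L0; clear; nra.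
have tL : L / 2 <= t.
  by rewrite /t -/Tr; move: e0 e8 LT TL L0; clear; nra.
have Tr0 : 0 < Tr by exact: lt_le_trans LT.
have F0 : expR ((1 - sigma - eta) * L) / (2 * L) <= block_load S sigma.
  rewrite /block_load -/Tr ler_pdivrMr ?mulr_gt0//.
  apply: (@le_trans _ _ (nn S * qmin S)).
    apply: (@le_trans _ _ (expR L * expR (- (sigma + eta) * L))).
      by rewrite -expRD ler_expR; rewrite le_eqVlt; apply/orP; left; apply/eqP; ring.
    by rewrite -expR_ln_nn ler_wpM2l ?expR_ge0.
  rewrite mulrAC ler_pdivlMr//.
  apply: (@le_trans _ _ (((n1 S)%:R * q11 S + (n2 S)%:R * q22 S) * Tr)).
    rewrite ler_wpM2r ?(ltW Tr0)// /nn natrD mulrDl.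
    by apply: lerD; rewrite ler_wpM2l.
  rewrite ler_wpM2l// addr_ge0// mulr_ge0// ?q11_ge0 ?q22_ge0//.
set W := expR ((1 - sigma - eta) * L) in F0.
set X := expR ((1 - sigma - eps / 4) * L).
have sX : (part_size eps S sigma)%:R <= X by rewrite truncn_le expR_ge0.
set B := block_load S sigma in F0 *.
have WB : W <= 2 * L * B by move: F0; rewrite ler_pdivrMr ?mulr_gt0// mulrC.
have B0 : 0 <= B.
  by apply: le_trans F0; rewrite divr_ge0 ?expR_ge0// mulr_ge0// ltW.
split=> //.
- move=> q mnq qmx.
  have q0 : 0 < q by exact: lt_le_trans mnq.
  have tq0 : 0 <= t / q by rewrite divr_ge0 ?(ltW q0)//; move: tL L0; clear; lra.
  split.
    rewrite truncn_ge_nat ?expR_ge0// natrM -/L.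
    apply: (@le_trans _ _ (2 * L * expR ((sigma + eta) * L) * X)).
      apply: ler_pM => //; apply: (@le_trans _ _ (t / q)); first by rewrite truncn_le.
      apply: ler_pM => //.
      - by move: tL L0; clear; lra.
      - by rewrite invr_ge0 ltW.
      - rewrite -[leRHS]invrK lef_pV2 ?posrE ?invr_gt0 ?expR_gt0// -expRN -mulNr.
        exact: le_trans mnq.
    apply: (@le_trans _ _ (expR (eps / 16 * L) * expR ((sigma + eta) * L) * X)).
      by rewrite ler_wpM2r ?expR_ge0// ler_wpM2r ?expR_ge0.
    rewrite /X -!expRD ler_expR -!mulrDl ler_wpM2r ?(ltW L0)// /eta.
    by move: e0; clear; lra.
  rewrite mulrA ler_pdivlMr//; apply: (@le_trans _ _ (64 * (eta * L))).
    by rewrite ler_wpM2l//; exact: le_trans mxe.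
  rewrite /eta.
  have : eps * (L / 2) <= eps * t by rewrite ler_wpM2l ?(ltW e0).
  by clear; lra.
- rewrite /spot_degree -/L -natr1.
  set Z := expR ((1 - eps / 8) * L).
  have Q0 : 0 <= 4 * (qmax S * Z + 2 * L).
    by rewrite mulr_ge0// addr_ge0// mulr_ge0 ?expR_ge0 ?(ltW L0) ?(ltW mx0).
  have := truncn_le (4 * (qmax S * Z + 2 * L)); rewrite Q0 => H1.
  pose U := expR ((1 - sigma - eps / 8 + eta) * L).
  have H2 : qmax S * Z <= U.
    apply: (@le_trans _ _ (expR (- (sigma - eta) * L) * Z)).
      by rewrite ler_wpM2r ?expR_ge0.
    by rewrite -expRD ler_expR le_eqVlt; apply/orP; left; apply/eqP; ring.
  have H3 : 32 / eps * L * U <= W.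
    apply: (@le_trans _ _ (expR (eps / 16 * L) * U)).
      by rewrite ler_wpM2r ?expR_ge0.
    rewrite -expRD ler_expR -mulrDl ler_wpM2r ?(ltW L0)// /eta.
    by move: e0; clear; lra.
  have H4 : 72 / eps * L ^+ 2 <= W.
    apply: le_trans E3 _; rewrite ler_expR ler_wpM2r ?(ltW L0)// /eta.
    by move: e8 sg14; clear; lra.
  have H3' : 32 * L * U <= eps * W.
    rewrite -ler_pdivrMl//; apply: le_trans H3; rewrite le_eqVlt; apply/orP; left.
    by apply/eqP; field; rewrite gt_eqF.
  have H4' : 72 * (L * L) <= eps * W.
    rewrite -ler_pdivrMl//; apply: le_trans H4; rewrite le_eqVlt; apply/orP; left.
    by apply/eqP; field; rewrite gt_eqF.
  have H5 : eps * W <= eps * (2 * L * B) by rewrite ler_wpM2l ?(ltW e0).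
  rewrite -(ler_pM2l L0).
  apply: (@le_trans _ _ (L * (4 * U + 9 * L))).
    by rewrite ler_wpM2l ?(ltW L0)//; move: H1 H2 L2; clear; lra.
  by move: H3' H4' H5; clear; lra.
have s1 : 1 <= X.
  rewrite -expR0 ler_expR mulr_ge0 ?(ltW L0)//.
  by move: e8 sg14; clear; lra.
rewrite -(ler_pM2l L0).
apply: (@le_trans _ _ (L * (2 * X))).
  by rewrite ler_wpM2l ?(ltW L0)//; move: s1 sX; clear; lra.
have H3 : 32 / eps * L * X <= W.
  apply: (@le_trans _ _ (expR (eps / 16 * L) * X)).
    by rewrite ler_wpM2r ?expR_ge0.
  rewrite -expRD ler_expR -mulrDl ler_wpM2r ?(ltW L0)// /eta.
  by move: e0; clear; lra.
have H3' : 32 * L * X <= eps * W.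
  rewrite -ler_pdivrMl//; apply: le_trans H3; rewrite le_eqVlt; apply/orP; left.
  by apply/eqP; field; rewrite gt_eqF.
have H5 : eps * W <= eps * (2 * L * B) by rewrite ler_wpM2l ?(ltW e0).
have : 0 <= L * X by rewrite mulr_ge0 ?expR_ge0// ltW.
by move: H3' H5; clear; lra.
Qed.

End UpperBound.

(** * Colouring each block on its own *)

Section UpperBoundColouring.
Context {R : realType} (sigma0 : R).
Implicit Types (S : sbm R).

Lemma le_qform (a b c c' x y : R) : c <= c' -> 0 <= x -> 0 <= y ->
  qform a b c x y <= qform a b c' x y.
Proof.
move=> cc x0 y0; rewrite /qform lerD2r lerD2l ler_wpM2r ?mulr_ge0//.
by rewrite ler_wpM2l.
Qed.

(* On the box [[0, X] x [0, Y]] the form is dominated by a bilinear one, for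
   which the corners suffice. *)
Lemma qform_box (a b c r X Y x y : R) : 0 <= a -> 0 <= b -> 0 < X -> 0 < Y ->
  a * X <= r -> b * Y <= r -> qform a b c X Y <= r * (X + Y) ->
  0 <= x <= X -> 0 <= y <= Y -> qform a b c x y <= r * (x + y).
Proof.
move=> a0 b0 X0 Y0 aX bY Qr /andP[x0 xX] /andP[y0 yY].
have ax : a * x ^+ 2 <= a * X * x by rewrite expr2 mulrA ler_wpM2r// ler_wpM2l.
have bx : b * y ^+ 2 <= b * Y * y by rewrite expr2 mulrA ler_wpM2r// ler_wpM2l.
suff H : 2 * c * (x * y) <= (r - a * X) * x + (r - b * Y) * y.
  by rewrite /qform; move: H ax bx; clear; lra.
have [c0|c0] := leP c 0.
  apply: (@le_trans _ _ 0).
    by rewrite mulr_le0_ge0 ?mulr_ge0//; move: c0; clear; lra.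
  by rewrite addr_ge0// mulr_ge0// subr_ge0.
have XY : 0 < X * Y by rewrite mulr_gt0.
rewrite -(ler_pM2l XY).
have H1 : 2 * c * (X * Y) <= (r - a * X) * X + (r - b * Y) * Y.
  by move: Qr; rewrite /qform; clear; lra.
have H2 : 2 * c * (X * Y) * (x * y) <= ((r - a * X) * X + (r - b * Y) * Y) * (x * y).
  by rewrite ler_wpM2r// mulr_ge0.
have H3 : (r - a * X) * X * x * y <= (r - a * X) * X * x * Y.
  by rewrite ler_wpM2l// !mulr_ge0 ?subr_ge0// ltW.
have H4 : (r - b * Y) * Y * y * x <= (r - b * Y) * Y * y * X.
  by rewrite ler_wpM2l// !mulr_ge0 ?subr_ge0// ltW.
by move: H2 H3 H4; clear; lra.
Qed.

Definition slot_size (eps : R) S (sigma q : R) : nat :=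
  Num.truncn ((1 - eps) * colour_rate S sigma / q).

Definition block_bad (eps : R) S (sigma : R) (G : graph (vertex S)) : bool :=
  [|| no_selection (slot_size eps S sigma (q11 S)) 0 (part_size eps S sigma) G,
      no_selection 0 (slot_size eps S sigma (q22 S)) (part_size eps S sigma) G
    | dense_spot (spot_size eps S) (spot_degree eps S) G].

Lemma regularly_expN_nn (delta : R) : 0 < delta ->
  regularly sigma0 (fun S _ => expR (- nn S) <= delta).
Proof.
move=> d0; have := regularly_exp sigma0 delta^-1 0 (ltr01 : 0 < 1 :> R).
apply: regularlyS => S _; rewrite expr0 mulr1 mul1r expR_ln_nn => H.
have n0 : 0 < nn S by apply: lt_le_trans H; rewrite invr_gt0.
rewrite expRN -[leRHS]invrK lef_pV2 ?posrE ?invr_gt0 ?expR_gt0//.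
apply: le_trans H _; apply: le_trans (expR_ge1Dx _); lra.
Qed.

Lemma regularly_block_bad (eps delta : R) : 0 < eps ->
  8 * eps <= 1 - 4 * sigma0 -> 0 < sigma0 < 1 / 4 -> 0 < delta ->
  regularly sigma0 (fun S sigma => sbm_prob (@block_bad eps S sigma) <= delta).
Proof.
move=> e0 e8 s0q d0.
have e18 : 0 < eps < 1 / 8 by lra.
have d3 : 0 < delta / 3 by rewrite divr_gt0.
have s00 : 0 < sigma0 by lra.
have z1 : 0 < (1 : R) <= 1 by rewrite ltr01 lexx.
have := regularlyI (regularly_selection e0 e8 s00 z1)
  (regularlyI (regularly_dense_spot sigma0 eps d3)
  (regularlyI (regularly_sizes e18 s0q) (regularly_expN_nn d3))).
apply: regularlyS => S sigma [[_ HX] [HD [[Hq _ _ mn0] HN]]].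
set t := (1 - eps) * colour_rate S sigma in HX Hq.
have [amn bmn amx bmx mnmx] := q_bounds S.
have a0 : 0 < q11 S by exact: lt_le_trans amn.
have b0 : 0 < q22 S by exact: lt_le_trans bmn.
have [_ ta] := Hq _ amn amx.
have [_ tb] := Hq _ bmn bmx.
have ta0 : 0 < t / q11 S by rewrite -(pmulr_rgt0 _ e0); apply: lt_le_trans ta.
have tb0 : 0 < t / q22 S by rewrite -(pmulr_rgt0 _ e0); apply: lt_le_trans tb.
have at_ : q11 S * (t / q11 S) = t by rewrite mulrC divfK// gt_eqF.
have bt_ : q22 S * (t / q22 S) = t by rewrite mulrC divfK// gt_eqF.
rewrite (_ : delta = delta / 3 + (delta / 3 + delta / 3)); last by field.
apply: le_trans (graph_prob_orb _ _ (@edge_prob_range R S)) _.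
apply: lerD.
  apply: le_trans HN.
  (* Zero is rewritten as a truncation so that the selection lemma applies with [K2 = 0], where the
     form reduces to [q11 S * x ^+ 2]. *)
  have -> : no_selection (slot_size eps S sigma (q11 S)) 0 (part_size eps S sigma) =
     no_selection (S := S) (Num.truncn (t / q11 S)) (Num.truncn (0 : R)) (part_size eps S sigma).
    by rewrite truncn0.
  apply: HX => //; rewrite ?mul1r ?at_ ?mulr0 ?addr0 ?(ltW ta0) //; [|by right|by left|].
  - move=> th x y th0 /andP[x0 xth]; rewrite mulr0 => /andP[y0 y00].
    have -> : y = 0 by apply/eqP; rewrite eq_le y0 y00.
    rewrite /qform !(mulr0, addr0, expr0n) /= expr2 mulrA ler_wpM2r//.
    rewrite mulrC -ler_pdivlMr//; apply: le_trans xth _.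
    by rewrite mulrA.
  - by rewrite -at_ mulr_ge0// ltW.
apply: le_trans (graph_prob_orb _ _ (@edge_prob_range R S)) _.
apply: lerD => //.
apply: le_trans HN.
have -> : no_selection 0 (slot_size eps S sigma (q22 S)) (part_size eps S sigma) =
   no_selection (S := S) (Num.truncn (0 : R)) (Num.truncn (t / q22 S)) (part_size eps S sigma).
  by rewrite truncn0.
apply: HX => //; rewrite ?mul1r ?bt_ ?mulr0 ?add0r ?(ltW tb0) //; [|by left|by right|].
- move=> th x y th0; rewrite mulr0 => /andP[x0 x00] /andP[y0 yth].
  have -> : x = 0 by apply/eqP; rewrite eq_le x0 x00.
  rewrite /qform !(mul0r, mulr0, add0r, expr0n) /= expr2 mulrA ler_wpM2r//.
  rewrite mulrC -ler_pdivlMr//; apply: le_trans yth _.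
  by rewrite mulrA.
- by rewrite -bt_ mulr_ge0// ltW.
Qed.

Lemma slot_size_bounds (eps t q : R) : 0 < eps < 1 / 8 -> 0 < q ->
  64 <= eps * (t / q) ->
  [/\ (0 < Num.truncn (t / q))%N, 1 <= eps * (Num.truncn (t / q))%:R &
    (1 - eps) * (t / q) <= (Num.truncn (t / q))%:R].
Proof.
move=> /andP[e0 e8] q0 H.
have tq0 : 0 <= t / q by rewrite -(pmulr_rge0 _ e0); apply: le_trans H.
have := truncn_itv tq0; rewrite -natr1 => /andP[_ T1].
have T2 : 1 <= eps * (Num.truncn (t / q))%:R.
  have : eps * (t / q) <= eps * ((Num.truncn (t / q))%:R + 1) by rewrite ler_wpM2l// ltW.
  by move: H e8; clear; lra.
split=> //; last by move: H T1; clear; lra.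
by rewrite lt0n; apply: contraTneq T2 => ->; rewrite mulr0 -ltNge.
Qed.

(* Rounding [t / q] costs a factor [1 - eps], and so does replacing the rate
   [T] by [t = (1 - eps) T]. *)
Lemma divn_slot_size (eps T q : R) (n : nat) : 0 < eps < 1 / 8 -> 0 < q -> 0 < T ->
  64 <= eps * ((1 - eps) * T / q) ->
  (n %/ Num.truncn ((1 - eps) * T / q))%:R <= (1 + 3 * eps) * (n%:R * q / T).
Proof.
move=> e01 q0 T0 H; have [j0 _ jt] := slot_size_bounds e01 q0 H.
case/andP: e01 => e0 e8; set j := Num.truncn _ in j0 jt *.
have jR : 0 < j%:R :> R by rewrite ltr0n.
have H1 : (n %/ j)%:R * j%:R <= n%:R :> R by rewrite -natrM ler_nat leq_divM.
have H2 : (n %/ j)%:R * ((1 - eps) * ((1 - eps) * T / q)) <= n%:R.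
  by apply: le_trans H1; rewrite ler_wpM2l.
rewrite mulrA ler_pdivlMr//.
have H3 : (n %/ j)%:R * T * (1 - eps) ^+ 2 <= n%:R * q.
  rewrite -ler_pdivrMr//; apply: le_trans H2; rewrite le_eqVlt; apply/orP; left; apply/eqP.
  by field; rewrite gt_eqF.
have H4 : 1 <= (1 + 3 * eps) * (1 - eps) ^+ 2.
  by rewrite expr2; move: e0 e8; clear; nra.
have H5 : 0 <= (n %/ j)%:R * T by rewrite mulr_ge0// ltW.
apply: (@le_trans _ _ ((1 + 3 * eps) * ((n %/ j)%:R * T * (1 - eps) ^+ 2))).
  by rewrite mulrCA ler_peMr.
by rewrite ler_wpM2l//; move: e0; clear; lra.
Qed.

Lemma regularly_chi_blocks (eps : R) : 0 < eps < 1 / 8 -> 0 < sigma0 < 1 / 4 ->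
  regularly sigma0 (fun S sigma => forall G : graph (vertex S),
    ~~ block_bad eps sigma G ->
    (chi (induced_subgraph G (block1 S)))%:R + (chi (induced_subgraph G (block2 S)))%:R
      <= (1 + 4 * eps) * block_load S sigma).
Proof.
move=> e01 s0q.
have h2 : 0 < 2^-1 :> R by rewrite invr_gt0.
have := regularlyI (regularly_regular sigma0 h2) (regularly_sizes e01 s0q).
apply: regularlyS => S sigma [reg [Hq dF sF mn0]] G.
have hh : 0 < (2^-1 : R) <= 1 / 2 by rewrite h2 /= mul1r lexx.
have [LT _ sg14 L2] := colour_rate_bounds s0q reg hh.
have T0 : 0 < colour_rate S sigma.
  by apply: lt_le_trans LT; apply: lt_le_trans L2.
rewrite /block_bad !negb_or => /and3P[HX1 HX2 HD].
have [amn bmn amx bmx mnmx] := q_bounds S.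
have a0 : 0 < q11 S by exact: lt_le_trans amn.
have b0 : 0 < q22 S by exact: lt_le_trans bmn.
have [ws1 e1] := Hq _ amn amx.
have [ws2 e2] := Hq _ bmn bmx.
have [j10 _ _] := slot_size_bounds e01 a0 e1.
have [j20 _ _] := slot_size_bounds e01 b0 e2.
have s0 : (0 < part_size eps S sigma)%N.
  rewrite truncn_gt0 -[leLHS]expR0 ler_expR mulr_ge0//; last by move: L2; clear; lra.
  by move: sg14 e01; clear; lra.
have c1 : (chi (induced_subgraph G (block1 S)) <= n1 S %/ slot_size eps S sigma (q11 S)
    + spot_degree eps S)%N.
  apply: chi_induced_le; rewrite -card_block1.
  exact: (proper_on_block1 j10 s0 ws1 HX1 HD).
have c2 : (chi (induced_subgraph G (block2 S)) <= n2 S %/ slot_size eps S sigma (q22 S)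
    + spot_degree eps S)%N.
  apply: chi_induced_le; rewrite -card_block2.
  exact: (proper_on_block2 j20 s0 ws2 HX2 HD).
move: c1 c2; rewrite -!(ler_nat R) !natrD.
have := divn_slot_size (n1 S) e01 a0 T0 e1; have := divn_slot_size (n2 S) e01 b0 T0 e2.
rewrite -/(slot_size eps S sigma (q11 S)) -/(slot_size eps S sigma (q22 S)).
move: dF; rewrite /block_load [((n1 S)%:R * q11 S + (n2 S)%:R * q22 S) / _]mulrDl; clear.
by lra.
Qed.

End UpperBoundColouring.

(** * Colouring with mixed classes, and the first moment bound *)

Section Mixed.
Context {R : realType} (sigma0 : R).
Implicit Types (S : sbm R).

(** Rounding [K] down loses at most one vertex per round and stopping early loses at most [s + 1]
    rounds, so at most [t0 + (s + 1) k] vertices remain. Since [1 <= eps * j] and [k <= j], classes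
    of size [j] absorb them cheaply. *)
Lemma leftover_count (n k j s m : nat) (eps K t0 : R) :
  0 < eps -> 0 <= t0 -> n%:R = K * t0 -> K <= k%:R + 1 ->
  (k <= j)%N -> 1 <= eps * j%:R -> t0 - 1 - s%:R <= m%:R -> (m * k <= n)%N ->
  ((n - m * k) %/ j)%:R <= eps * t0 + (s%:R + 1).
Proof.
move=> e0 t00 nK Kk kj ej tm mn.
have j0 : 0 < j%:R :> R by rewrite -(pmulr_rgt0 _ e0); apply: lt_le_trans ej.
rewrite -(ler_pM2r j0).
have H1 : ((n - m * k) %/ j)%:R * j%:R <= n%:R - m%:R * k%:R :> R.
  by rewrite -!natrM -natrB// ler_nat leq_divM.
apply: le_trans H1 _; rewrite nK.
have H2 : K * t0 <= (k%:R + 1) * t0 by rewrite ler_wpM2r.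
have H3 : (t0 - 1 - s%:R) * k%:R <= m%:R * k%:R by rewrite ler_wpM2r.
have H4 : (s%:R + 1) * k%:R <= (s%:R + 1) * j%:R :> R
  by rewrite ler_wpM2l ?ler_nat ?addr_ge0.
have H5 : t0 <= t0 * (eps * j%:R) by rewrite ler_peMr.
by move: H2 H3 H4 H5; clear; lra.
Qed.

Lemma mixed_count (n1 n2 k1 k2 j1 j2 s d : nat) (eps K1 K2 t0 : R) :
  let m := (minn (n1 %/ k1) (n2 %/ k2) - s)%N in
  0 < eps < 1 / 8 -> 0 <= t0 -> n1%:R = K1 * t0 -> n2%:R = K2 * t0 ->
  (0 < k1)%N -> (0 < k2)%N -> 0 < K1 ->
  (1 - eps) * K1 <= k1%:R -> k1%:R <= K1 -> k2%:R <= K2 ->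
  K1 <= k1%:R + 1 -> K2 <= k2%:R + 1 ->
  (k1 <= j1)%N -> (k2 <= j2)%N -> 1 <= eps * j1%:R -> 1 <= eps * j2%:R ->
  (m + ((n1 - m * k1) %/ j1 + d + ((n2 - m * k2) %/ j2 + d)))%:R <=
  t0 / (1 - eps) + 2 * eps * t0 + 2 * (s%:R + 1) + 2 * d%:R.
Proof.
move=> m /andP[e0 e8] t00 nK1 nK2 k10 k20 K10 kl1 ku1 ku2 Ku1 Ku2 kj1 kj2 ej1 ej2.
have mk1 : (m * k1 <= n1)%N.
  apply: leq_trans (leq_divM n1 k1); rewrite leq_mul2r.
  by rewrite (leq_trans (leq_subr _ _)) ?orbT// geq_minl.
have mk2 : (m * k2 <= n2)%N.
  apply: leq_trans (leq_divM n2 k2); rewrite leq_mul2r.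
  by rewrite (leq_trans (leq_subr _ _)) ?orbT// geq_minr.
have div_ge (n k : nat) (K : R) : (0 < k)%N -> n%:R = K * t0 -> k%:R <= K ->
    t0 - 1 <= (n %/ k)%:R.
  move=> k0 nK kK; have kR : 0 < k%:R :> R by rewrite ltr0n.
  have : n%:R < (n %/ k).+1%:R * k%:R :> R by rewrite -natrM ltr_nat ltn_ceil.
  rewrite nK -natr1 => H.
  have : k%:R * t0 <= K * t0 by rewrite ler_wpM2r.
  move=> H'; rewrite lerBlDr -(ler_pM2r kR); move: H H'; clear; lra.
have mt : t0 - 1 - s%:R <= m%:R.
  rewrite lerBlDr -natrD; apply: (@le_trans _ _ (minn (n1 %/ k1) (n2 %/ k2))%:R); last first.
    by rewrite ler_nat /m addnC -leq_subLR.
  rewrite /minn; case: ifP => _.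
    exact: div_ge nK1 ku1.
  exact: div_ge nK2 ku2.
have L1 := leftover_count e0 t00 nK1 Ku1 kj1 ej1 mt mk1.
have L2 := leftover_count e0 t00 nK2 Ku2 kj2 ej2 mt mk2.
have mu : m%:R <= t0 / (1 - eps).
  rewrite ler_pdivlMr; last by move: e8; clear; lra.
  rewrite -(ler_pM2r K10) -mulrA.
  apply: (@le_trans _ _ (m%:R * k1%:R)); first by rewrite ler_wpM2l.
  by rewrite -natrM mulrC -nK1 ler_nat.
by rewrite !natrD; move: L1 L2 mu; clear; lra.
Qed.

(** The [10 * eps] is made up of [3 * eps] from the two factors [(1 - eps)^-1], [3 * eps] from the
    leftover vertices, and [2 * eps] each from the part size and the spot degree. *)
Lemma chi_mixed_le (S : sbm R) (sigma eps D : R) (G : graph (vertex S)) :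
  let Tr := colour_rate S sigma in let t := (1 - eps) * Tr in
  let K1 := t * (n1 S)%:R / D in let K2 := t * (n2 S)%:R / D in
  0 < eps < 1 / 8 -> 0 < Tr -> 0 < D -> 0 < q11 S -> 0 < q22 S ->
  (0 < part_size eps S sigma)%N ->
  [/\ forall q, qmin S <= q -> q <= qmax S ->
       (Num.truncn (t / q) * part_size eps S sigma <= spot_size eps S)%N
       /\ 64 <= eps * (t / q),
     (spot_degree eps S)%:R <= eps / 2 * block_load S sigma,
     (part_size eps S sigma)%:R + 1 <= eps / 2 * block_load S sigma
     & 0 < qmin S] ->
  q11 S * K1 <= t -> q22 S * K2 <= t -> 1 <= eps * K1 -> 1 <= eps * K2 ->
  block_load S sigma <= 2 * (D / Tr) ->
  ~~ block_bad eps sigma G ->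
  ~~ no_selection (Num.truncn K1) (Num.truncn K2) (part_size eps S sigma) G ->
  (chi G)%:R <= (1 + 10 * eps) * (D / Tr).
Proof.
move=> Tr t K1 K2 e01 T0 D0 a0 b0 s0 [Hq dF sF mn0] aK bK eK1 eK2 FD.
rewrite /block_bad !negb_or => /and3P[HX1 HX2 HD] HX.
have [amn bmn amx bmx mnmx] := q_bounds S.
have [ws1 e1] := Hq _ amn amx.
have [ws2 e2] := Hq _ bmn bmx.
have [j10 ej1 _] := slot_size_bounds e01 a0 e1.
have [j20 ej2 _] := slot_size_bounds e01 b0 e2.
case/andP: (e01) => e0 e8.
have size K : 1 <= eps * K ->
   [/\ 0 < K, (0 < Num.truncn K)%N, (Num.truncn K)%:R <= K,
      K <= (Num.truncn K)%:R + 1 & (1 - eps) * K <= (Num.truncn K)%:R].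
  move=> eK; have K0 : 0 < K by rewrite -(pmulr_rgt0 _ e0); apply: lt_le_trans eK.
  have := truncn_itv (ltW K0); rewrite -natr1 => /andP[T1 T2].
  split=> //; first last.
  - by move: eK T2; clear; lra.
  - exact: ltW.
  - by rewrite truncn_gt0; move: e8 e0 eK K0; clear; nra.
have [K10 k10 ku1 Ku1 kl1] := size _ eK1.
have [K20 k20 ku2 Ku2 _] := size _ eK2.
have kj1 : (Num.truncn K1 <= Num.truncn (t / q11 S))%N.
  by rewrite le_truncn// ler_pdivlMr// mulrC.
have kj2 : (Num.truncn K2 <= Num.truncn (t / q22 S))%N.
  by rewrite le_truncn// ler_pdivlMr// mulrC.
have t0 : 0 < t by rewrite mulr_gt0//; move: e8; clear; lra.
have tD0 : 0 <= D / t by rewrite divr_ge0 ?(ltW t0) ?(ltW D0).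
have nK (n : nat) : n%:R = t * n%:R / D * (D / t) :> R.
  by field; rewrite !gt_eqF.
have := chi_le_mixed k10 k20 j10 j20 s0 ws1 ws2 HX HX1 HX2 HD.
rewrite -(ler_nat R) => /le_trans; apply.
apply: le_trans (mixed_count _ _ e01 tD0 (nK _) (nK _) k10 k20 K10 kl1 ku1 ku2 Ku1 Ku2
   kj1 kj2 ej1 ej2) _.
have -> : D / t = D / Tr / (1 - eps).
  by rewrite /t; field; rewrite !gt_eqF//; move: e8; clear; lra.
have DT : 0 <= D / Tr by rewrite divr_ge0 ?(ltW D0) ?(ltW T0).
have u1 : (1 - eps)^-1 * (1 - eps)^-1 <= 1 + 3 * eps.
  rewrite -invfM -[leLHS]mul1r ler_pdivrMr; last by move: e0 e8; clear; nra.
  by move: e0 e8; clear; nra.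
have u2 : (1 - eps)^-1 <= 3 / 2.
  rewrite -[leLHS]mul1r ler_pdivrMr; last by move: e0 e8; clear; lra.
  by move: e8; clear; lra.
have H1 : D / Tr * ((1 - eps)^-1 * (1 - eps)^-1) <= D / Tr * (1 + 3 * eps).
  by rewrite ler_wpM2l.
have H2 : (eps * (D / Tr)) * (1 - eps)^-1 <= (eps * (D / Tr)) * (3 / 2).
  by rewrite ler_wpM2l// mulr_ge0// ltW.
have H3 : eps * block_load S sigma <= eps * (2 * (D / Tr)).
  by rewrite ler_wpM2l// ltW.
by move: H1 H2 H3 dF sF; clear; lra.
Qed.

(** Raising the cross rate to [c'] only enlarges the form, so one bound serves two regimes:
    [c' = q12 S] between the thresholds and [c' = c_lower S] below them. The lower bounds on [D] say
    that neither block part of the target set exceeds the single-block size. *)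
Lemma regularly_chi_upper (eps delta : R) : 0 < eps ->
  8 * eps <= 1 - 4 * sigma0 -> 0 < sigma0 < 1 / 4 -> 0 < delta ->
  regularly sigma0 (fun S sigma => forall c' D : R, q12 S <= c' ->
    D * nn S = qform (q11 S) (q22 S) c' (n1 S)%:R (n2 S)%:R ->
    (n1 S)%:R * q11 S <= D -> (n2 S)%:R * q22 S <= D ->
    D <= (n1 S)%:R * q11 S + (n2 S)%:R * q22 S ->
    sbm_prob (S := S) (fun G =>
      (1 + 10 * eps) * (D / colour_rate S sigma) < (chi G)%:R) <= delta).
Proof.
move=> e0 e8 s0q d0.
have e01 : 0 < eps < 1 / 8 by lra.
have d2 : 0 < delta / 2 by rewrite divr_gt0.
have s00 : 0 < sigma0 by lra.
have z1 : 0 < eps / 2 <= 1 by lra.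
have h2 : 0 < 2^-1 :> R by rewrite invr_gt0.
have he : 0 < eps ^+ 2 / 8 by rewrite divr_gt0 ?exprn_gt0.
have := regularlyI (regularly_regular sigma0 h2)
  (regularlyI (regularly_regular sigma0 he)
  (regularlyI (regularly_selection e0 e8 s00 z1)
  (regularlyI (regularly_block_bad e0 e8 s0q d2)
  (regularlyI (regularly_sizes e01 s0q)
  (regularlyI (regularly_chi_blocks e01 s0q) (regularly_expN_nn sigma0 d2)))))).
apply: regularlyS => S sigma [reg [reg' [[s0 HX] [HB [Hs [Hc HN]]]]]] c' D cc QD A1D A2D DA.
have hh : 0 < (2^-1 : R) <= 1 / 2 by rewrite h2 /= mul1r lexx.
have [LT _ sg14 L2] := colour_rate_bounds s0q reg hh.
set Tr := colour_rate S sigma in LT HX Hs *.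
have L0 : 0 < ln (nn S) by apply: lt_le_trans L2.
have T0 : 0 < Tr by apply: lt_le_trans LT.
have [_ _ _ mn0] := Hs.
have [amn bmn amx bmx mnmx] := q_bounds S.
have a0 : 0 < q11 S by exact: lt_le_trans amn.
have b0 : 0 < q22 S by exact: lt_le_trans bmn.
have n10 : 0 < (n1 S)%:R :> R by rewrite ltr0n n1_gt0.
have n20 : 0 < (n2 S)%:R :> R by rewrite ltr0n n2_gt0.
set A1 := (n1 S)%:R * q11 S in A1D DA *.
set A2 := (n2 S)%:R * q22 S in A2D DA *.
have A10 : 0 < A1 by rewrite mulr_gt0.
have A20 : 0 < A2 by rewrite mulr_gt0.
have D0 : 0 < D by exact: lt_le_trans A1D.
have DT : 0 < D / Tr by rewrite divr_gt0.
have FE : block_load S sigma = (A1 + A2) / Tr by [].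
have eb (G : graph (vertex S)) : A1 + A2 <= (1 + eps) * D -> ~~ block_bad eps sigma G ->
    (chi G)%:R <= (1 + 10 * eps) * (D / Tr).
  move=> AD /Hc; have := chi_le_blocks G; rewrite -(ler_nat R) natrD FE => H1 H2.
  apply: le_trans H1 _; apply: le_trans H2 _.
  apply: (@le_trans _ _ ((1 + 4 * eps) * ((1 + eps) * D / Tr))).
    rewrite ler_wpM2l//; first by move: e0; clear; lra.
    by rewrite ler_wpM2r// invr_ge0 ltW.
  rewrite -!mulrA mulrA ler_wpM2r ?(ltW DT)//.
  by move: e01; clear; nra.
have pr := @edge_prob_range R S.
(* If the blocks together cost at most [(1 + eps) * D], they are coloured separately. Otherwise both
   [A1] and [A2] are at least [eps * D], so both parts of the mixed set are large. *)
have [AD|AD] := leP (A1 + A2) ((1 + eps) * D).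
  apply: (@le_trans _ _ (sbm_prob (block_bad (S := S) eps sigma))).
    apply: graph_prob_mono => // G; apply: contraTT => gb; rewrite -leNgt.
    exact: eb.
  by apply: le_trans HB _; move: d0; clear; lra.
have eA1 : eps * D <= A1 by move: AD A2D; clear; lra.
have eA2 : eps * D <= A2 by move: AD A1D; clear; lra.
set t := (1 - eps) * Tr in HX Hs.
have t0 : 0 < t by rewrite mulr_gt0//; move: e01; clear; lra.
pose K1 := t * (n1 S)%:R / D; pose K2 := t * (n2 S)%:R / D.
have K10 : 0 < K1 by rewrite divr_gt0// mulr_gt0.
have K20 : 0 < K2 by rewrite divr_gt0// mulr_gt0.
have aK : q11 S * K1 = t * (A1 / D) by rewrite /K1 /A1; ring.
have bK : q22 S * K2 = t * (A2 / D) by rewrite /K2 /A2; ring.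
have A1D1 : A1 / D <= 1 by rewrite ler_pdivrMr// mul1r.
have A2D1 : A2 / D <= 1 by rewrite ler_pdivrMr// mul1r.
have A1De : eps <= A1 / D by rewrite ler_pdivlMr.
have A2De : eps <= A2 / D by rewrite ler_pdivlMr.
have aKt : q11 S * K1 <= t by rewrite aK ler_piMr// ltW.
have bKt : q22 S * K2 <= t by rewrite bK ler_piMr// ltW.
have mxe : qmax S <= eps ^+ 2 / 8 * ln (nn S) by case: reg'.
have tL : ln (nn S) / 2 <= t by rewrite /t; move: e01 LT L0; clear; nra.
have Kbig (q K A : R) : q <= qmax S -> 0 < K -> q * K = t * A -> eps <= A -> 1 <= eps * K.
  move=> qmx K0 qK eA.
  have H1 : t * eps <= eps ^+ 2 / 8 * ln (nn S) * K.
    apply: (@le_trans _ _ (q * K)); first by rewrite qK ler_wpM2l// ltW.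
    by rewrite ler_wpM2r ?(ltW K0)//; exact: le_trans mxe.
  have H2 : ln (nn S) / 2 * eps <= t * eps by rewrite ler_wpM2r// ltW.
  have L8 : 0 < ln (nn S) * eps by rewrite mulr_gt0.
  rewrite -(ler_pM2l L8) mulr1; move: H1 H2; rewrite expr2.
  have : 0 <= ln (nn S) * eps * (eps * K) by rewrite !mulr_ge0 ?(ltW L0) ?(ltW e0) ?(ltW K0).
  by clear; lra.
have eK1 := Kbig _ _ _ amx K10 aK A1De.
have eK2 := Kbig _ _ _ bmx K20 bK A2De.
have HX' : sbm_prob (S := S) (no_selection (Num.truncn K1) (Num.truncn K2)
    (part_size eps S sigma)) <= delta / 2.
  apply: le_trans HN; apply: HX => //; last first.
  - by rewrite addr_gt0.
  - exact: ltW.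
  - exact: ltW.
  - by right; rewrite bK mulrC ler_wpM2l ?(ltW t0)//; move: A2De e0; clear; lra.
  - by right; rewrite aK mulrC ler_wpM2l ?(ltW t0)//; move: A1De e0; clear; lra.
  move=> th x y th0 x0 y0.
  case/andP: (x0) => x00 _; case/andP: (y0) => y00 _.
  apply: le_trans (le_qform _ _ cc x00 y00) _.
  move: th0 x0 y0; rewrite le_eqVlt => /orP[/eqP <-|th0 x0 y0].
    rewrite !mul0r => /andP[x1 x2] /andP[y1 y2].
    have -> : x = 0 by apply/eqP; rewrite eq_le x1 x2.
    have -> : y = 0 by apply/eqP; rewrite eq_le y1 y2.
    by rewrite /qform expr0n /= !(mulr0, addr0).
  apply: (qform_box (ltW a0) (ltW b0) (mulr_gt0 th0 K10) (mulr_gt0 th0 K20)) => //.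
  - by rewrite mulrCA ler_wpM2l ?(ltW th0).
  - by rewrite mulrCA ler_wpM2l ?(ltW th0).
  (* Equality holds at the corner: the form is homogeneous of degree two, and [D * nn S] is its
     value at the block sizes. *)
  rewrite le_eqVlt; apply/orP; left; apply/eqP.
  transitivity (th ^+ 2 * (t / D) ^+ 2 * qform (q11 S) (q22 S) c' (n1 S)%:R (n2 S)%:R).
    by rewrite /K1 /K2 /qform; field; rewrite gt_eqF.
  by rewrite -QD /K1 /K2 /nn natrD; field; rewrite gt_eqF.
apply: (@le_trans _ _ (sbm_prob (S := S) (fun G => block_bad eps sigma G ||
    no_selection (Num.truncn K1) (Num.truncn K2) (part_size eps S sigma) G))).
  apply: graph_prob_mono => // G; apply: contraTT; rewrite negb_or -leNgt => /andP[gb gx].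
  apply: (chi_mixed_le e01 T0 D0 a0 b0 s0 Hs aKt bKt eK1 eK2 _ gb gx).
  rewrite FE mulrA ler_wpM2r ?invr_ge0 ?(ltW T0)//.
  by move: A1D A2D; clear; lra.
apply: le_trans (graph_prob_orb _ _ pr) _.
rewrite (_ : delta = delta / 2 + delta / 2); last by field.
exact: lerD.
Qed.

(** Each coefficient of the form is at most [qmax S], so a violating set has more than [t / qmax S]
    vertices. This removes a factor of about [N ^ sigma] from the count of sets, which is why
    [1 - sigma] appears in [colour_rate]. *)
Lemma regularly_big_indep (eps delta : R) : 0 < eps <= 1 -> 0 < sigma0 < 1 / 4 ->
  0 < delta ->
  regularly sigma0 (fun S sigma =>
    sbm_prob (S := S) (big_indep (Num.min (q12 S) ((q11 S + q22 S) / 2))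
      ((1 + eps) * colour_rate S sigma)) <= delta).
Proof.
move=> /andP[e0 e1] s0q d0.
pose eta := eps / 16.
have eta0 : 0 < eta by rewrite divr_gt0.
have h2 : 0 < eps / 2 by rewrite divr_gt0.
have := regularlyI (regularly_regular sigma0 eta0)
  (regularly_exp sigma0 delta^-1 0 h2).
apply: regularlyS => S sigma [reg E]; rewrite expr0 mulr1 in E.
have hh : 0 < eta <= 1 / 2 by rewrite eta0 /eta; move: e1; clear; lra.
have [LT TL sg14 L2] := colour_rate_bounds s0q reg hh.
case: reg => _ etaL mnL mxL mxe.
set L := ln (nn S) in E LT TL L2 etaL mnL mxL mxe.
set ct := Num.min _ _; set t := (1 + eps) * colour_rate S sigma.
have [amn bmn amx bmx mnmx] := q_bounds S.
have mx0 : 0 < qmax S by apply: lt_le_trans mnmx; apply: lt_le_trans mnL; exact: expR_gt0.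
have L0 : 0 < L by apply: lt_le_trans L2.
have ctc : ct <= q12 S by rewrite ge_min lexx.
have ctm : ct <= qmax S.
  have : ct <= (q11 S + q22 S) / 2 by rewrite ge_min lexx orbT.
  by move: amx bmx; clear; lra.
pose M := L / qmax S; pose y := eps / 2 * L.
have M0 : 0 < M by rewrite divr_gt0.
have y0 : 0 < y by rewrite mulr_gt0.
have eL : 1 <= eta * L by move: etaL; rewrite -[eta^-1]mul1r ler_pdivrMr// mulrC.
have M1 : 1 <= M.
  rewrite ler_pdivlMr// mul1r; apply: le_trans mxe _.
  by rewrite ler_piMl ?(ltW L0)//; move: hh; clear; lra.
have tL : L <= t.
  apply: (le_trans (LT)); rewrite ler_peMl//; first exact: le_trans (ltW L0) LT.
  by move: e0; clear; lra.
apply: (@le_trans _ _ (expR (- (y * M)))); last first.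
  apply: (@le_trans _ _ (expR (- (eps / 2 * L)))).
    by rewrite ler_expR lerN2 ler_peMr ?(ltW y0).
  by rewrite expRN -[leRHS]invrK lef_pV2 ?posrE ?expR_gt0 ?invr_gt0.
apply: big_indep_prob => //.
  move=> A; rewrite (card_blocks A) natrD.
  move: (ler0n R #|A :&: block1 S|) (ler0n R #|A :&: block2 S|).
  move: (#|A :&: block1 S|%:R : R) (#|A :&: block2 S|%:R : R) => x z x0 z0.
  have H1 : qform (q11 S) (q22 S) ct x z <= qmax S * (x + z) * (x + z).
    rewrite /qform.
    have h1 : q11 S * x ^+ 2 <= qmax S * x ^+ 2 by rewrite ler_wpM2r// sqr_ge0.
    have h3 : q22 S * z ^+ 2 <= qmax S * z ^+ 2 by rewrite ler_wpM2r// sqr_ge0.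
    have h4 : ct * (x * z) <= qmax S * (x * z) by rewrite ler_wpM2r// mulr_ge0.
    by move: h1 h3 h4; clear; rewrite !expr2; lra.
  move=> /lt_le_trans/(_ H1) H2.
  have xz : 0 < x + z.
    rewrite lt_neqAle addr_ge0// andbT eq_sym; apply: contraTneq H2 => ->.
    by rewrite !mulr0 ltxx.
  move: H2; rewrite ltr_pM2r// => H2.
  by rewrite /M ler_pdivrMr// mulrC; apply: le_trans tL _; exact: ltW.
rewrite -[(n1 S + n2 S)%:R]expR_ln_nn -/L -/(qmax S).
apply: (@le_trans _ _ (expR ((sigma - eta) * L) * expR (- 1 - y))); last first.
  rewrite ler_wpM2r ?expR_ge0// /M.
  apply: (@le_trans _ _ (qmax S)^-1); last first.
    by rewrite ler_peMl ?invr_ge0 ?(ltW mx0)//; move: L2; clear; lra.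
  rewrite -[leLHS]invrK lef_pV2 ?posrE ?invr_gt0 ?expR_gt0//.
  by apply: le_trans mxL _; rewrite -expRN mulNr.
rewrite -!expRD ler_expR /t /colour_rate -/L /y.
have H : eps * L * (1 - sigma) >= eps * L * (3 / 4).
  by rewrite ler_wpM2l ?mulr_ge0 ?(ltW e0) ?(ltW L0)//; move: sg14; clear; lra.
move: H mxe eL L0; rewrite /eta; clear; lra.
Qed.

End Mixed.

(** * The two thresholds in terms of rates *)

Section Thresholds.
Context {R : realType} (S : sbm R).
Local Notation a := (q11 S).
Local Notation b := (q22 S).
Local Notation c := (q12 S).
Local Notation m1 := ((n1 S)%:R : R).
Local Notation m2 := ((n2 S)%:R : R).

(** The rate belonging to [p_lower S]. Its two arguments are the cross rates at which [load] equals
    [m1 * a] and [m2 * b], respectively. *)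
Definition c_lower : R :=
  Num.max (a / 2 - b * m2 / (2 * m1)) (b / 2 - a * m1 / (2 * m2)).

Lemma p12E : p12 S = 1 - expR (- c).
Proof.
have [H _ _] := ln_inv_subr (p12_range S).
by rewrite /q12 -H; ring.
Qed.

Lemma p_upperE : p_upper S = 1 - expR (- ((a + b) / 2)).
Proof.
have [H11 _ _] := ln_inv_subr (p11_range S).
have [H22 _ _] := ln_inv_subr (p22_range S).
rewrite /p_upper H11 H22 -!expRM -expRD; congr (_ - expR _).
by rewrite -/a -/b; ring.
Qed.

Lemma p_lowerE : p_lower S = 1 - expR (- c_lower).
Proof.
have [H11 _ _] := ln_inv_subr (p11_range S).
have [H22 _ _] := ln_inv_subr (p22_range S).
have n10 : m1 != 0 by rewrite pnatr_eq0 -lt0n n1_gt0.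
have n20 : m2 != 0 by rewrite pnatr_eq0 -lt0n n2_gt0.
rewrite /p_lower H11 H22 -!expRM -!expRD -/a -/b; congr (_ - _).
rewrite /c_lower oppr_max.
have -> : - a * (1 / 2) + - b * - (m2 / (2 * m1)) = - (a / 2 - b * m2 / (2 * m1)).
  by field.
have -> : - b * (1 / 2) + - a * - (m1 / (2 * m2)) = - (b / 2 - a * m1 / (2 * m2)).
  by field.
have [H|H] := leP (- (a / 2 - b * m2 / (2 * m1))) (- (b / 2 - a * m1 / (2 * m2))).
  by rewrite min_l// ler_expR.
by rewrite min_r// ler_expR ltW.
Qed.

Lemma p12_le_upper : (p12 S <= p_upper S) = (2 * c <= a + b).
Proof.
rewrite p12E p_upperE lerD2l lerN2 ler_expR lerN2 ler_pdivlMr//.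
by rewrite mulrC.
Qed.

Lemma upper_le_p12 : (p_upper S <= p12 S) = (a + b <= 2 * c).
Proof.
rewrite p12E p_upperE lerD2l lerN2 ler_expR lerN2 ler_pdivrMr//.
by rewrite mulrC.
Qed.

Lemma p12_le_lower : (p12 S <= p_lower S) = (c <= c_lower).
Proof. by rewrite p12E p_lowerE lerD2l lerN2 ler_expR lerN2. Qed.

Lemma lower_le_p12 : (p_lower S <= p12 S) = (c_lower <= c).
Proof. by rewrite p12E p_lowerE lerD2l lerN2 ler_expR lerN2. Qed.

Definition load (c' : R) : R := qform a b c' m1 m2 / nn S.

Lemma loadM c' : load c' * nn S = qform a b c' m1 m2.
Proof. by rewrite divfK// gt_eqF ?nn_gt0. Qed.

Lemma load_le c' : 2 * c' <= a + b -> load c' <= m1 * a + m2 * b.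
Proof.
move=> H; rewrite ler_pdivrMr; last exact: nn_gt0.
rewrite /nn natrD /qform.
have : 2 * c' * (m1 * m2) <= (a + b) * (m1 * m2) by rewrite ler_wpM2r// mulr_ge0.
by clear; lra.
Qed.

(** The role of the lower threshold in the construction: with target sizes proportional to
    [m1 / load c'] and [m2 / load c'], each block part is then small enough to be independent by
    itself. *)
Lemma load_ge c' : c_lower <= c' -> m1 * a <= load c' /\ m2 * b <= load c'.
Proof.
have n10 : 0 < m1 by rewrite ltr0n n1_gt0.
have n20 : 0 < m2 by rewrite ltr0n n2_gt0.
have nn0 := nn_gt0 S.
rewrite /c_lower ge_max => /andP[H1 H2].
rewrite !ler_pdivlMr// /nn natrD /qform; split.
  have H : m1 * a <= 2 * c' * m1 + b * m2.
    have : (a / 2 - b * m2 / (2 * m1)) * (2 * m1) <= c' * (2 * m1).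
      by rewrite ler_wpM2r// mulr_ge0// ltW.
    rewrite mulrBl divfK ?mulf_neq0 ?gt_eqF//; clear; lra.
  have : m1 * a * m2 <= (2 * c' * m1 + b * m2) * m2 by rewrite ler_wpM2r// ltW.
  by clear; lra.
have H : m2 * b <= 2 * c' * m2 + a * m1.
  have : (b / 2 - a * m1 / (2 * m2)) * (2 * m2) <= c' * (2 * m2).
    by rewrite ler_wpM2r// mulr_ge0// ltW.
  rewrite mulrBl divfK ?mulf_neq0 ?gt_eqF//; clear; lra.
have : m2 * b * m1 <= (2 * c' * m2 + a * m1) * m1 by rewrite ler_wpM2r// ltW.
by clear; lra.
Qed.

(** At the lower threshold the mixed colouring already costs no more than the more expensive block,
    so the upper bound there matches the trivial lower bound for all smaller [p12 S]. *)
Lemma load_lower : load c_lower = Num.max (m1 * a) (m2 * b).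
Proof.
have n10 : 0 < m1 by rewrite ltr0n n1_gt0.
have n20 : 0 < m2 by rewrite ltr0n n2_gt0.
have nn0 : m1 + m2 != 0 by rewrite gt_eqF// addr_gt0.
have E1 : a / 2 - b * m2 / (2 * m1) = (m1 * a - m2 * b) / (2 * m1).
  by field; rewrite gt_eqF.
have E2 : b / 2 - a * m1 / (2 * m2) = (m2 * b - m1 * a) / (2 * m2).
  by field; rewrite gt_eqF.
have [H|H] := leP (m1 * a) (m2 * b).
  have -> : c_lower = b / 2 - a * m1 / (2 * m2).
    rewrite /c_lower max_r// E1 E2; apply: (@le_trans _ _ 0).
      by rewrite pmulr_lle0 ?invr_gt0 ?mulr_gt0// subr_le0.
    by rewrite divr_ge0 ?subr_ge0// mulr_ge0// ltW.
  by rewrite /load /qform /nn natrD; field; rewrite nn0 gt_eqF.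
have -> : c_lower = a / 2 - b * m2 / (2 * m1).
  rewrite /c_lower max_l// E1 E2; apply: (@le_trans _ _ 0).
    by rewrite pmulr_lle0 ?invr_gt0 ?mulr_gt0// subr_le0 ltW.
  by rewrite divr_ge0 ?subr_ge0 ?(ltW H)// mulr_ge0// ltW.
by rewrite /load /qform /nn natrD; field; rewrite nn0 gt_eqF.
Qed.

Lemma c_lower_le : 2 * c_lower <= a + b.
Proof.
have a0 := q11_ge0 S; have b0 := q22_ge0 S.
have [H1 H2] : 0 <= b * m2 / (2 * m1) /\ 0 <= a * m1 / (2 * m2).
  by rewrite !divr_ge0 ?mulr_ge0.
rewrite mulrC -ler_pdivlMr// ge_max.
by move: a0 b0 H1 H2; clear; lra.
Qed.

(** On a single block the form is a pure square, and cancelling the block size leaves a bound that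
    is linear in it. *)
Lemma chi_lower (ct t : R) (G : graph (vertex S)) :
  2 * ct <= a + b -> 0 <= t -> ~~ big_indep ct t G ->
  [/\ load ct <= t * (chi G)%:R,
      m1 * a <= t * (chi (induced_subgraph G (block1 S)))%:R &
      m2 * b <= t * (chi (induced_subgraph G (block2 S)))%:R].
Proof.
move=> cab t0 HL.
have n10 : 0 < m1 by rewrite ltr0n n1_gt0.
have n20 : 0 < m2 by rewrite ltr0n n2_gt0.
split.
- have := proper_on_lower cab t0 HL (chi_proper_on G).
  rewrite !setTI card_block1 card_block2 -natrD => H.
  by rewrite ler_pdivrMr// nn_gt0.
- have := proper_on_lower cab t0 HL (chi_induced_proper_on G (block1 S)).
  rewrite finset.setIid block2C setICr cards0 card_block1 /qform expr0n /= !(mulr0, addr0).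
  by rewrite expr2 mulrA ler_pM2r// mulrC.
have := proper_on_lower cab t0 HL (chi_induced_proper_on G (block2 S)).
have d21 : block2 S :&: block1 S = set0 by rewrite block2C setIC setICr.
rewrite finset.setIid d21 cards0 card_block2.
rewrite /qform expr0n /= !(mulr0, mul0r, add0r).
by rewrite expr2 mulrA ler_pM2r// mulrC.
Qed.

Lemma sbm_prob_ge (E bad1 bad2 : pred (graph (vertex S))) (delta : R) :
  (forall G, ~~ bad1 G -> ~~ bad2 G -> E G) ->
  sbm_prob bad1 <= delta / 2 -> sbm_prob bad2 <= delta / 2 ->
  1 - delta <= sbm_prob E.
Proof.
move=> HE H1 H2; rewrite /sbm_prob graph_prob_setC lerD2l lerN2.
apply: (@le_trans _ _ (graph_prob (@edge_prob R S) (fun G => bad1 G || bad2 G))).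
  apply: graph_prob_mono => [e|G /=]; first exact: edge_prob_range.
  by apply: contraNT; rewrite negb_or => /andP[]; exact: HE.
apply: le_trans (graph_prob_orb _ _ (@edge_prob_range R S)) _.
by move: H1 H2; rewrite /sbm_prob; clear; lra.
Qed.

End Thresholds.

(** * The three regimes and the passage to limits *)

Section Cases.
Context {R : realType}.

Lemma half_gt0 : 0 < 2^-1 :> R.
Proof. by rewrite invr_gt0. Qed.

Lemma colour_rate_gt0 (sigma0 : R) (S : sbm R) sigma : 0 < sigma0 < 1 / 4 ->
  regular sigma0 2^-1 S sigma -> 0 < colour_rate S sigma.
Proof.
move=> s0q reg; have hh : 0 < (2^-1 : R) <= 1 / 2 by rewrite half_gt0 /= mul1r lexx.
have [LT _ _ L2] := colour_rate_bounds s0q reg hh.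
by apply: lt_le_trans LT; apply: lt_le_trans L2.
Qed.

Lemma near_ratio1_interval (eps e x F : R) :
  0 < e < 1 / 8 -> 22 * e <= eps -> 0 <= F ->
  F <= (1 + e) * x -> x <= (1 + 10 * e) * F -> near_ratio1 eps x F.
Proof.
move=> e1 e22 F0 H1 H2; case/andP: (e1) => e0 _; rewrite /near_ratio1 (ger0_norm F0) ler_distl.
have : 22 * e * F <= eps * F by rewrite ler_wpM2r.
have : 0 <= e * F by rewrite mulr_ge0// ltW.
have : e * x <= e * ((1 + 10 * e) * F) by rewrite ler_wpM2l// ltW.
have : e * (e * F) <= (1 / 8) * (e * F).
  rewrite ler_wpM2r ?mulr_ge0 ?(ltW e0)//; move: e1; clear; lra.
by move: H1 H2; clear; lra.
Qed.

Lemma regularly_mixed_case (sigma0 eps delta e : R) : 0 < sigma0 < 1 / 4 ->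
  0 < e -> 22 * e <= eps -> 8 * e <= 1 - 4 * sigma0 -> 0 < delta ->
  regularly sigma0 (fun S sigma =>
  p_lower S <= p12 S <= p_upper S ->
  1 - delta <= sbm_prob (S := S) (fun G =>
    near_ratio1 eps (chi G)%:R
      (((n1 S)%:R ^+ 2 * q11 S + 2 * (n1 S)%:R * (n2 S)%:R * q12 S
          + (n2 S)%:R ^+ 2 * q22 S)
        / (2 * (1 - sigma) * nn S * ln (nn S))))).
Proof.
move=> s0q e0 e22 e8 d0.
have e1 : 0 < e < 1 / 8 by move: s0q e0 e8; clear; lra.
have e11 : 0 < e <= 1 by move: e1; clear; lra.
have d2 : 0 < delta / 2 by rewrite divr_gt0.
have := regularlyI (regularly_regular sigma0 half_gt0)
  (regularlyI (regularly_big_indep e11 s0q d2) (regularly_chi_upper e0 e8 s0q d2)).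
apply: regularlyS => S sigma [/(colour_rate_gt0 s0q) T0 [HL HU]].
rewrite lower_le_p12 p12_le_upper => /andP[cl cu].
have [A1 A2] := load_ge cl.
have nn0 := nn_gt0 S.
have HU' := HU _ _ (lexx _) (loadM S (q12 S)) A1 A2 (load_le cu).
apply: sbm_prob_ge HL HU' => G.
have -> : Num.min (q12 S) ((q11 S + q22 S) / 2) = q12 S.
  by rewrite min_l// ler_pdivlMr// mulrC.
have t0 : 0 <= (1 + e) * colour_rate S sigma.
  by rewrite mulr_ge0 ?(ltW T0)//; move: e0; clear; lra.
move=> /(chi_lower cu t0)[HC _ _]; rewrite -leNgt => HC'.
have FE : ((n1 S)%:R ^+ 2 * q11 S + 2 * (n1 S)%:R * (n2 S)%:R * q12 S
          + (n2 S)%:R ^+ 2 * q22 S) / (2 * (1 - sigma) * nn S * ln (nn S))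
    = load S (q12 S) / colour_rate S sigma.
  rewrite /load -[RHS]mulrA -invfM; congr (_ / _); rewrite /qform /colour_rate; ring.
rewrite FE; apply: (near_ratio1_interval e1 e22) => //.
  rewrite divr_ge0 ?(ltW T0)//; apply: le_trans A1.
  by rewrite mulr_ge0// q11_ge0.
by rewrite ler_pdivrMr// mulrAC.
Qed.

(** At the capped cross rate the load is exactly [n1 q11 + n2 q22]. The chain of [block_load] over
    [1 + e], [chi G], the sum of the block chromatic numbers and [(1 + 4 * e) * block_load] gives
    both comparisons. *)
Lemma regularly_separate_case (sigma0 eps delta e : R) : 0 < sigma0 < 1 / 4 ->
  0 < e -> 22 * e <= eps -> 8 * e <= 1 - 4 * sigma0 -> 0 < delta ->
  regularly sigma0 (fun S sigma =>
  p_upper S <= p12 S <= 1 ->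
  1 - delta <= sbm_prob (S := S) (fun G =>
    near_ratio1 eps (chi G)%:R
      ((chi (induced_subgraph G (block1 S)))%:R + (chi (induced_subgraph G (block2 S)))%:R)
    && near_ratio1 eps (chi G)%:R
      (((n1 S)%:R * q11 S + (n2 S)%:R * q22 S) / (2 * (1 - sigma) * ln (nn S))))).
Proof.
move=> s0q e0 e22 e8 d0.
have e1 : 0 < e < 1 / 8 by move: s0q e0 e8; clear; lra.
have e11 : 0 < e <= 1 by move: e1; clear; lra.
have d2 : 0 < delta / 2 by rewrite divr_gt0.
have := regularlyI (regularly_regular sigma0 half_gt0)
  (regularlyI (regularly_big_indep e11 s0q d2)
  (regularlyI (regularly_block_bad e0 e8 s0q d2) (regularly_chi_blocks e1 s0q))).
apply: regularlyS => S sigma [/(colour_rate_gt0 s0q) T0 [HL [HB HC]]].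
rewrite upper_le_p12 => /andP[cu _].
apply: sbm_prob_ge HL HB => G.
have -> : Num.min (q12 S) ((q11 S + q22 S) / 2) = (q11 S + q22 S) / 2.
  by rewrite min_r// ler_pdivrMr// mulrC.
have t0 : 0 <= (1 + e) * colour_rate S sigma.
  by rewrite mulr_ge0 ?(ltW T0)//; move: e0; clear; lra.
have c2 : 2 * ((q11 S + q22 S) / 2) <= q11 S + q22 S by rewrite mulrC divfK.
move=> /(chi_lower c2 t0)[HC1 _ _] /HC.
have := chi_le_blocks G; rewrite -(ler_nat R) natrD.
set x := (chi G)%:R; set y := _%:R + _%:R => xy yF.
have loadE : load S ((q11 S + q22 S) / 2) = (n1 S)%:R * q11 S + (n2 S)%:R * q22 S.
  rewrite /load /qform /nn natrD; field.
  by rewrite -natrD gt_eqF// nn_gt0.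
have F0 : 0 <= block_load S sigma.
  by rewrite divr_ge0 ?(ltW T0)// addr_ge0// mulr_ge0 ?q11_ge0 ?q22_ge0.
have Fx : block_load S sigma <= (1 + e) * x.
  by rewrite /block_load -loadE ler_pdivrMr// mulrAC.
apply/andP; split; last first.
  apply: (near_ratio1_interval e1 e22) => //; apply: (le_trans xy); apply: (le_trans yF).
  by rewrite ler_wpM2r//; move: e0; clear; lra.
have x0 : 0 <= x by [].
have y0 : 0 <= y by exact: le_trans xy.
rewrite /near_ratio1 (ger0_norm y0) ler_distl.
set F := block_load S sigma in yF F0 Fx.
have h1 : 22 * e * y <= eps * y by rewrite ler_wpM2r.
have h3 : e * x <= e * y by rewrite ler_wpM2l// ltW.
have h4 : e * F <= e * ((1 + e) * x) by rewrite ler_wpM2l// ltW.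
have h5 : e * (e * x) <= 1 / 8 * (e * x).
  by rewrite ler_wpM2r ?mulr_ge0 ?(ltW e0)//; move: e1; clear; lra.
have h6 : 0 <= e * x by rewrite mulr_ge0// ltW.
by move: h1 h3 h4 h5 h6 xy yF Fx; clear; lra.
Qed.

(** The maximum of the block chromatic numbers lies between [F / (1 + e)] and [chi G], which is at
    most [(1 + 10 * e) * F]; both comparisons follow from this sandwich. *)
Lemma regularly_parallel_case (sigma0 eps delta e : R) : 0 < sigma0 < 1 / 4 ->
  0 < e -> 22 * e <= eps -> 8 * e <= 1 - 4 * sigma0 -> 0 < delta ->
  regularly sigma0 (fun S sigma =>
  0 <= p12 S <= p_lower S ->
  1 - delta <= sbm_prob (S := S) (fun G =>
    near_ratio1 eps (chi G)%:R
      (Num.max (chi (induced_subgraph G (block1 S)))%:R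
               (chi (induced_subgraph G (block2 S)))%:R)
    && near_ratio1 eps (chi G)%:R
      (Num.max ((n1 S)%:R * q11 S) ((n2 S)%:R * q22 S)
        / (2 * (1 - sigma) * ln (nn S))))).
Proof.
move=> s0q e0 e22 e8 d0.
have e1 : 0 < e < 1 / 8 by move: s0q e0 e8; clear; lra.
have e11 : 0 < e <= 1 by move: e1; clear; lra.
have d2 : 0 < delta / 2 by rewrite divr_gt0.
have := regularlyI (regularly_regular sigma0 half_gt0)
  (regularlyI (regularly_big_indep e11 s0q d2) (regularly_chi_upper e0 e8 s0q d2)).
apply: regularlyS => S sigma [/(colour_rate_gt0 s0q) T0 [HL HU]].
rewrite p12_le_lower => /andP[_ cl].
have [A1 A2] := load_ge (lexx (c_lower S)).
have HU' := HU _ _ cl (loadM S (c_lower S)) A1 A2 (load_le (c_lower_le S)).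
apply: sbm_prob_ge HL HU' => G; rewrite load_lower.
set ct := Num.min _ _.
have t0 : 0 <= (1 + e) * colour_rate S sigma.
  by rewrite mulr_ge0 ?(ltW T0)//; move: e0; clear; lra.
have c2 : 2 * ct <= q11 S + q22 S.
  by rewrite mulrC -ler_pdivlMr// ge_min lexx orbT.
move=> /(chi_lower c2 t0)[_ HC1 HC2]; rewrite -leNgt => HC.
have c1x := chi_induced_le_chi G (block1 S).
have c2x := chi_induced_le_chi G (block2 S).
rewrite -(ler_nat R) in c1x; rewrite -(ler_nat R) in c2x.
set x := (chi G)%:R in HC c1x c2x *.
set y := Num.max (chi (induced_subgraph G (block1 S)))%:R _.
have yx : y <= x by rewrite ge_max c1x c2x.
have y0 : 0 <= y by rewrite le_max ler0n.
rewrite -/(colour_rate S sigma).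
set F := Num.max _ _ / _ in HC *.
have F0 : 0 <= F by rewrite divr_ge0 ?(ltW T0)// le_max mulr_ge0// q11_ge0.
have Fy : F <= (1 + e) * y.
  rewrite /F ler_pdivrMr// mulrAC ge_max; apply/andP; split.
    by apply: (le_trans HC1); rewrite ler_wpM2l// le_max lexx.
  by apply: (le_trans HC2); rewrite ler_wpM2l// le_max lexx orbT.
apply/andP; split; last first.
  apply: (near_ratio1_interval e1 e22) => //; apply: (le_trans Fy).
  by rewrite ler_wpM2l//; move: e0; clear; lra.
rewrite /near_ratio1 (ger0_norm y0) ler_distl.
have h1 : 22 * e * y <= eps * y by rewrite ler_wpM2r.
have h4 : e * F <= e * ((1 + e) * y) by rewrite ler_wpM2l// ltW.
have h5 : e * (e * y) <= 1 / 8 * (e * y).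
  by rewrite ler_wpM2r ?mulr_ge0 ?(ltW e0)//; move: e1; clear; lra.
have h6 : 0 <= e * y by rewrite mulr_ge0// ltW.
by move: h1 h4 h5 h6 yx Fy HC; clear; lra.
Qed.

End Cases.

(** The bound on [qmax] comes from the ratio hypothesis: the square of the larger rate divided by
    the smaller one is at least the larger rate. *)
Lemma regularly_unif (R : realType) (I : Type) (S : I -> nat -> sbm R)
    (sigma0 : R) (sigma : I -> nat -> R) (P : sbm R -> R -> Prop) :
  (forall i n, 0 <= sigma i n <= sigma0) ->
  unif_infty (fun i n => nn (S i n)) ->
  unif_power (fun i n => q11 (S i n)) (fun i n => nn (S i n)) sigma ->
  unif_power (fun i n => q22 (S i n)) (fun i n => nn (S i n)) sigma ->
  unif_ll
    (fun i n => q11 (S i n) ^+ 2 / q22 (S i n) + q22 (S i n) ^+ 2 / q11 (S i n))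
    (fun i n => ln (nn (S i n))) ->
  regularly sigma0 P -> unif_eventually (fun i n => P (S i n) (sigma i n)).
Proof.
move=> sr Hn [e1 o1 H1] [e2 o2 H2] Hll [eta eta0 HP].
have G1 := Hn (expR eta^-1); have G2 := o1 _ eta0; have G3 := o2 _ eta0.
have G4 := Hll _ eta0.
rewrite /unif_eventually in G1 G2 G3 G4 H1 H2 *.
near=> n => i; apply: HP.
have : eta^-1 <= ln (nn (S i n)).
  by rewrite -ler_expR expR_ln_nn; move: i; near: n.
have : `|e1 i n| <= eta by move: i; near: n.
have : `|e2 i n| <= eta by move: i; near: n.
have : q11 (S i n) = nn (S i n) `^ (- sigma i n + e1 i n) by move: i; near: n.
have : q22 (S i n) = nn (S i n) `^ (- sigma i n + e2 i n) by move: i; near: n.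
have : `|q11 (S i n) ^+ 2 / q22 (S i n) + q22 (S i n) ^+ 2 / q11 (S i n)| <=
   eta * `|ln (nn (S i n))| by move: i; near: n.
rewrite -[in nn _ `^ _](expR_ln_nn (S i n)) -[in nn _ `^ _](expR_ln_nn (S i n)) -!expRM.
set L := ln _; set a := q11 _; set b := q22 _ => ll bE aE.
rewrite !ler_norml => /andP[e2l e2u] /andP[e1l e1u] L1.
have L0 : 0 < L by apply: lt_le_trans L1; rewrite invr_gt0.
have a0 : 0 < a by rewrite aE expR_gt0.
have b0 : 0 < b by rewrite bE expR_gt0.
rewrite (gtr0_norm L0) in ll.
have {}ll := le_trans (ler_norm _) ll.
have ab0 : 0 <= a ^+ 2 / b by rewrite divr_ge0 ?sqr_ge0// ltW.
have ba0 : 0 <= b ^+ 2 / a by rewrite divr_ge0 ?sqr_ge0// ltW.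
split=> //.
- rewrite le_min -/a -/b aE bE !ler_expR ![_ * L]mulrC; apply/andP; split;
    rewrite ler_wpM2l ?(ltW L0)//; lra.
- rewrite ge_max -/a -/b aE bE !ler_expR ![_ * L]mulrC; apply/andP; split;
    rewrite ler_wpM2l ?(ltW L0)//; lra.
rewrite /qmax -/a -/b -/L; have [ab|ab] := leP a b.
  apply: (@le_trans _ _ (b ^+ 2 / a)); last by lra.
  by rewrite ler_pdivlMr// expr2 ler_wpM2l// ltW.
apply: (@le_trans _ _ (a ^+ 2 / b)); last by lra.
by rewrite ler_pdivlMr// expr2 ler_wpM2l// ltW.
Unshelve. all: by end_near.
Qed.

Theorem theorem3p1 (R : realType) (I : Type) (S : I -> nat -> sbm R)
    (sigma0 : R) (sigma : I -> nat -> R)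
    (sigma0_range : 0 < sigma0 < 1 / 4)
    (sigma_range : forall i n, 0 <= sigma i n <= sigma0)
    (nn_infty : unif_infty (fun i n => nn (S i n)))
    (q11_power : unif_power (fun i n => q11 (S i n)) (fun i n => nn (S i n)) sigma)
    (q22_power : unif_power (fun i n => q22 (S i n)) (fun i n => nn (S i n)) sigma)
    (q_ll : unif_ll
      (fun i n => q11 (S i n) ^+ 2 / q22 (S i n) + q22 (S i n) ^+ 2 / q11 (S i n))
      (fun i n => ln (nn (S i n)))) :
  [/\ whp_if S (fun T : sbm R => p_lower T <= p12 T <= p_upper T)
        (fun eps i n G =>
          let T := S i n in
          near_ratio1 eps (chi G)%:R
            (((n1 T)%:R ^+ 2 * q11 T + 2 * (n1 T)%:R * (n2 T)%:R * q12 T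
                + (n2 T)%:R ^+ 2 * q22 T)
              / (2 * (1 - sigma i n) * nn T * ln (nn T)))),
      whp_if S (fun T : sbm R => p_upper T <= p12 T <= 1)
        (fun eps i n G =>
          let T := S i n in
          near_ratio1 eps (chi G)%:R
            ((chi (induced_subgraph G (block1 T)))%:R + (chi (induced_subgraph G (block2 T)))%:R)
          && near_ratio1 eps (chi G)%:R
            (((n1 T)%:R * q11 T + (n2 T)%:R * q22 T)
              / (2 * (1 - sigma i n) * ln (nn T))))
    & whp_if S (fun T : sbm R => 0 <= p12 T <= p_lower T)
        (fun eps i n G =>
          let T := S i n in
          near_ratio1 eps (chi G)%:R
            (Num.max (chi (induced_subgraph G (block1 T)))%:R
                     (chi (induced_subgraph G (block2 T)))%:R)
          && near_ratio1 eps (chi G)%:R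
            (Num.max ((n1 T)%:R * q11 T) ((n2 T)%:R * q22 T)
              / (2 * (1 - sigma i n) * ln (nn T))))].
Proof.
have choose (eps : R) : 0 < eps -> exists2 e : R, 0 < e & 22 * e <= eps /\ 8 * e <= 1 - 4 * sigma0.
  (* The first term leaves room for the accumulated relative errors; the second is the margin that
     [sigma0 < 1 / 4] gives to overlaps in a pair. *)
  move=> eps0; exists (Num.min (eps / 22) ((1 - 4 * sigma0) / 8)).
    by rewrite lt_min; move: sigma0_range eps0; clear; lra.
  split; rewrite -ler_pdivlMl// [leRHS]mulrC; first by rewrite ge_min lexx.
  by rewrite ge_min lexx orbT.
have transfer P := @regularly_unif R I S sigma0 sigma P sigma_range nn_infty
  q11_power q22_power q_ll.
split=> eps delta eps0 delta0; have [e e0 [e22 e8]] := choose eps eps0.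
- exact: transfer (regularly_mixed_case sigma0_range e0 e22 e8 delta0).
- exact: transfer (regularly_separate_case sigma0_range e0 e22 e8 delta0).
- exact: transfer (regularly_parallel_case sigma0_range e0 e22 e8 delta0).
Qed.
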